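(* Assume the perforated geometry and admissible data described in the context. Let $(\rho_\varepsilon,u_\varepsilon,\vartheta_\varepsilon)$ be a finite-energy weak solution of the microscopic system on $(0,T)$ and $(\rho,u,\vartheta,p)$ a regular effective solution on $[0,T]$. Then there exists $C>0$, uniform in (small) $\varepsilon$, such that for a.e. $t\in(0,T)$ $$\|\vartheta_\varepsilon(t)-\vartheta(t)\|_{H^1(\Omega)}\le C\big(\|\widetilde u_\varepsilon(t)-u(t)\|_{L^2(\Omega)}+\varepsilon^3\big),$$ $$\|\vartheta_\varepsilon(t)-\vartheta(t)\|_{L^\infty(\Omega)}\le C\big(\|\widetilde u_\varepsilon(t)-u(t)\|_{L^2(\Omega)}+\varepsilon\big),$$ $$\|\mu(\vartheta_\varepsilon(t))-\mu(\vartheta(t))\|_{L^\infty(\Omega)}\le C\big(\|\widetilde u_\varepsilon(t)-u(t)\|_{L^2(\Omega)}+\varepsilon\big).$$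
   Context: Notation. $(\nabla v)_{ij}=\partial_jv_i$, $A:B=\sum_{i,j}A_{ij}B_{ij}$, $\mathcal D(v)=\frac12(\nabla v+(\nabla v)^{T})$. $\mathbf e_1,\mathbf e_2,\mathbf e_3$ is the canonical basis of $\mathbb R^3$. A tilde denotes extension by zero from $\Omega_\varepsilon$ to $\Omega$. Perforated geometry. $Y=(-\frac12,\frac12)^3$; $\Omega\subset\mathbb R^3$ is a bounded connected domain of class $C^{2,\beta}$, $\beta\in(0,1)$; $T_0\subset\subset B(0,1/8)$ is a fixed simply connected reference hole of class $C^{2,\beta}$ with connected exterior. $\mathcal K_\varepsilon=\{k\in\mathbb Z^3:\varepsilon(k+\overline Y)\subset\subset\Omega\}$, $T_{\varepsilon,k}=\varepsilon k+\varepsilon^3T_0$, $\mathcal H_\varepsilon=\bigcup_{k\in\mathcal K_\varepsilon}\overline{T_{\varepsilon,k}}$, $\Omega_\varepsilon=\Omega\setminus\mathcal H_\varepsilon$. Admissible data. $T\in(0,\infty)$; $\mu\in W^{1,\infty}(\mathbb R)$ with $0<\mu_{\min}\le\mu\le\mu_{\max}<\infty$; $\kappa_{\mathrm f},\kappa_{\mathrm s}>0$ and $\kappa_\varepsilon=\kappa_{\mathrm f}\mathbf 1_{\Omega_\varepsilon}+\kappa_{\mathrm s}\mathbf 1_{\mathcal H_\varepsilon}$; $f\in W^{1,\infty}((0,T)\times\Omega;\mathbb R^3)$; $F\in W^{2,\infty}(\Omega)$ time independent, $g=\nabla F$; $0<\rho_{\min}<\rho_{\max}$. Microscopic initial data: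 $\rho_{\min}\le\rho_\varepsilon^0\le\rho_{\max}$ a.e. in $\Omega_\varepsilon$, $u_\varepsilon^0\in L^2(\Omega_\varepsilon;\mathbb R^3)$, $\operatorname{div}u_\varepsilon^0=0$, $u_\varepsilon^0\cdot n=0$ on $\partial\Omega_\varepsilon$ (weak normal trace). $\widehat{\rho_\varepsilon^0}$ is $\rho_\varepsilon^0$ extended to $\mathcal H_\varepsilon$ by the constant $\rho_{\min}$. Finite-energy weak solution (of $\partial_t\rho_\varepsilon+\operatorname{div}(\rho_\varepsilon u_\varepsilon)=0$, $\operatorname{div}u_\varepsilon=0$, $\partial_t(\rho_\varepsilon u_\varepsilon)+\operatorname{div}(\rho_\varepsilon u_\varepsilon\otimes u_\varepsilon)-\operatorname{div}(2\mu(\vartheta_\varepsilon)\mathcal D(u_\varepsilon))+\nabla p_\varepsilon=\rho_\varepsilon f-\vartheta_\varepsilon g$ in $(0,T)\times\Omega_\varepsilon$, $-\operatorname{div}(\kappa_\varepsilon\nabla\vartheta_\varepsilon)=\widetilde u_\varepsilon\cdot g$ in $(0,T)\times\Omega$, with $u_\varepsilon=0$ on $\partial\Omega_\varepsilon$, $\kappa_\varepsilon\nabla\vartheta_\varepsilon\cdot n=0$ on $\partial\Omega$). It is a triple $(\rho_\varepsilon,u_\varepsilon,\vartheta_\varepsilon)$ with: $\rho_{\min}\le\rho_\varepsilon\le\rho_{\max}$; $\vartheta_\varepsilon\in L^2(0,T;H^1(\Omega))$ with $\int_\Omega\vartheta_\varepsilon(t)\,dx=0$; $u_\varepsilon\in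 L^\infty(0,T;L^2(\Omega_\varepsilon))\cap L^2(0,T;H_0^1(\Omega_\varepsilon))$, $\operatorname{div}u_\varepsilon=0$, $u_\varepsilon$ having a representative in $C_{\rm weak}([0,T];L^2(\Omega_\varepsilon))$ with $u_\varepsilon(0)=u_\varepsilon^0$; the density is extended to $\Omega$ by transport with the velocity $\widetilde u_\varepsilon$ from the initial value $\widehat{\rho_\varepsilon^0}$, the extension being denoted $\widehat\rho_\varepsilon$, and for all $b\in C^1([\rho_{\min},\rho_{\max}])$, $\psi\in C_c^1([0,T)\times\Omega)$: $\int_0^T\!\int_\Omega b(\widehat\rho_\varepsilon)(\partial_t\psi+\widetilde u_\varepsilon\cdot\nabla\psi)\,dx\,dt+\int_\Omega b(\widehat{\rho_\varepsilon^0})\psi(0)\,dx=0$; for all divergence-free $\phi\in C_c^1([0,T)\times\Omega_\varepsilon;\mathbb R^3)$: $\int_0^T\!\int_{\Omega_\varepsilon}[\rho_\varepsilon u_\varepsilon\cdot\partial_t\phi+\rho_\varepsilon u_\varepsilon\otimes u_\varepsilon:\nabla\phi-2\mu(\vartheta_\varepsilon)\mathcal D(u_\varepsilon):\mathcal D(\phi)+(\rho_\varepsilon f-\vartheta_\varepsilon g)\cdot\phi]\,dx\,dt+\int_{\Omega_\varepsilon}\rho_\varepsilon^0u_\varepsilon^0\cdot\phi(0)\,dx=0$; for a.e. $t$ and all $\varphi\in H^1(\Omega)$: $\int_\Omega\kappa_\varepsilon\nabla\vartheta_\varepsilon(t)\cdot\nabla\varphi\,dx=\int_\Omega\widetilde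 u_\varepsilon(t)\cdot g\,\varphi\,dx$; and for a.e. $t\in(0,T)$: $\frac12\int_{\Omega_\varepsilon}\rho_\varepsilon(t)|u_\varepsilon(t)|^2dx+\int_0^t\!\int_{\Omega_\varepsilon}2\mu(\vartheta_\varepsilon)|\mathcal D(u_\varepsilon)|^2dx\,ds+\int_0^t\!\int_\Omega\kappa_\varepsilon|\nabla\vartheta_\varepsilon|^2dx\,ds\le\frac12\int_{\Omega_\varepsilon}\rho_\varepsilon^0|u_\varepsilon^0|^2dx+\int_0^t\!\int_{\Omega_\varepsilon}\rho_\varepsilon f\cdot u_\varepsilon\,dx\,ds$. Resistance matrix. $(V^i,Q^i)$, $i=1,2,3$, is the finite-energy solution of $-\Delta V^i+\nabla Q^i=0$, $\operatorname{div}V^i=0$ in $\mathbb R^3\setminus\overline{T_0}$, $V^i=0$ on $\partial T_0$, $V^i\to\mathbf e_i$, $Q^i\to0$ at infinity; $(M_0)_{ij}=\int_{\mathbb R^3\setminus\overline{T_0}}\nabla V^i:\nabla V^j\,dy$ (symmetric positive definite). Regular effective solution on $[0,T]$. $(\rho,u,\vartheta,p)$ with $\partial_t\rho+\operatorname{div}(\rho u)=0$, $\operatorname{div}u=0$, $\partial_t(\rho u)+\operatorname{div}(\rho u\otimes u)-\operatorname{div}(2\mu(\vartheta)\mathcal D(u))+\mu(\vartheta)M_0u+\nabla p=\rho f-\vartheta g$, $-\kappa_{\mathrm f}\Delta\vartheta=u\cdot g$ in $(0,T)\times\Omega$ (momentum equation in the sense of distributions); $u=0$, $\partial_n\vartheta=0$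 on $\partial\Omega$; $\int_\Omega\vartheta(t)\,dx=\int_\Omega p(t)\,dx=0$; $\rho(0)=\rho_0$, $u(0)=u_0$; and $\rho_{\min}\le\rho\le\rho_{\max}$, $\rho\in W^{1,\infty}((0,T)\times\Omega)$, $u\in W^{1,\infty}(0,T;W^{2,\infty}(\Omega;\mathbb R^3))$, $\vartheta\in L^\infty(0,T;W^{2,\infty}(\Omega))$, $p\in L^\infty(0,T;L^2(\Omega))$. *)

(* Defs.v *)
From HB Require Import structures.
From mathcomp Require Import all_boot all_order all_algebra.
From mathcomp Require Import all_classical all_reals all_analysis.

Set Implicit Arguments.
Unset Strict Implicit.
Unset Printing Implicit Defensive.

Import Order.TTheory GRing.Theory Num.Theory.
Import numFieldNormedType.Exports.

Local Open Scope classical_set_scope.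
Local Open Scope ring_scope.

(* Equivalence classes of measurable functions are represented by Borel
   functions, and every condition on them is imposed almost everywhere; the
   elements of a Bochner space such as L^2(0,T;H^1) are jointly measurable.
   A time-dependent field is curried, [w t x] or [w t i x], with [i] the
   component; [G t i x] and [D t i j x] stand for \partial_i w and
   \partial_j w_i. *)

Lemma product_sigma_finite d1 d2 (T1 : measurableType d1)
    (T2 : measurableType d2) (R : realType)
    (m1 : {measure set T1 -> \bar R}) (m2 : {sigma_finite_measure set T2 -> \bar R}) :
  sigma_finite setT m1 -> sigma_finite setT m2 -> sigma_finite setT (m1 \x m2)%E.
Proof.
move=> /sigma_finiteP[A [TA ndA Aoo]] /sigma_finiteP[B [TB ndB Boo]].
exists (fun n => A n `*` B n).
  rewrite -setXTT TA TB predeqE => -[x y]; split.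
    move=> [/= [n _ Anx] [k _ Bky]]; exists (maxn n k) => //; split.
    - by move: x Anx; exact/subsetPset/ndA/leq_maxl.
    - by move: y Bky; exact/subsetPset/ndB/leq_maxr.
  by move=> [n _ []/= ? ?]; split; exists n.
move=> k; have [? ?] := Aoo k; have [? ?] := Boo k.
split; first exact: measurableX.
by rewrite product_measure1E// lte_mul_pinfty// ge0_fin_numE.
Qed.

Section Space.
Context {R : realType}.

(* The normed space is R * R * R; [lebesgue_measure] lives on the convertible
   carrier [measurableTypeR R], hence the measures below. *)
Definition leb := @lebesgue_measure R.
HB.instance Definition _ := SigmaFiniteMeasure.on leb.

Definition leb3 := ((leb \x leb) \x leb)%E.
HB.instance Definition _ := Measure.on leb3.

(* The canonical sigma-finite instance of a product measure in the library is
   masked by the one for subprobabilities, so it is declared by hand. *)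
Let leb3_sigma_finite : sigma_finite setT leb3.
Proof.
have leb2 : sigma_finite setT (leb \x leb)%E.
  exact: product_sigma_finite (sigma_finiteT leb) (sigma_finiteT leb).
exact: product_sigma_finite leb2 (sigma_finiteT leb).
Qed.
HB.instance Definition _ :=
  Measure_isSigmaFinite.Build _ _ _ leb3 leb3_sigma_finite.

Definition leb4 := (leb \x leb3)%E.
HB.instance Definition _ := Measure.on leb4.

Definition R3 := (R * R * R)%type.

Definition vec (a : 'I_3 -> R) : R3 := (a 0, a 1, a 2%:R).
Definition component (i : 'I_3) (x : R3) : R :=
  if i == 0 then x.1.1 else if i == 1 then x.1.2 else x.2.
Definition ev (i : 'I_3) : R3 := vec (fun j => (i == j)%:R).

(* the Euclidean norm; the library norm on a product is the maximum norm *)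
Definition euclid (x : R3) : R := Num.sqrt (\sum_(i < 3) component i x ^+ 2).

Definition compactly_in (A B : set R3) :=
  compact (closure A) /\ closure A `<=` B.

Definition boundary (U : set R3) := closure U `\` U°.

End Space.

Section DifferentiableFunctions.
Context {R : realType}.

(* In finite dimension, f is C^n as soon as all its iterated directional
   derivatives up to order n exist and are continuous. *)
Fixpoint Ck (V : normedModType R) (n : nat) (U : set V) (f : V -> R) : Prop :=
  (forall x, U x -> {for x, continuous f}) /\
  match n with
  | 0 => True
  | n'.+1 => forall v, (forall x, U x -> derivable f x v) /\
                       Ck n' U (fun x => 'D_v f x)
  end.

Definition compact_support (V : normedModType R) (U : set V) (f : V -> R) :=
  compact (closure [set x | f x != 0]) /\ closure [set x | f x != 0] `<=` U.

Definition Ck_c (V : normedModType R) (n : nat) (U : set V) (f : V -> R) :=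
  Ck n setT f /\ compact_support U f.

Definition Cinf_c (V : normedModType R) (U : set V) (f : V -> R) :=
  forall n, Ck_c n U f.

End DifferentiableFunctions.

Section Geometry.
Context {R : realType}.
Implicit Types (U A : set (@R3 R)).

Definition C2_hoelder (beta : R) (h : R * R -> R) :=
  Ck 2 setT h /\
  forall v w, exists L, forall y z : R * R,
    `|'D_w (fun x => 'D_v h x) y - 'D_w (fun x => 'D_v h x) z|
      <= L * `|y - z| `^ beta.

(* near each boundary point, after an orthogonal change of coordinates, the
   set is the region above the graph of a C^{2,beta} function *)
Definition class_C2 (beta : R) U :=
  forall x0 : @R3 R, boundary U x0 ->
  exists (r : R) (Q : 'M[R]_3) (h : R * R -> R),
    [/\ 0 < r, Q *m Q^T = 1%:M, C2_hoelder beta h &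
      forall x : @R3 R, euclid (x - x0) < r ->
        let y i := \sum_(j < 3) Q i j * component j x in
        U x <-> h (y 0, y 1) < y 2%:R].

Definition simply_connected A :=
  [/\ A !=set0,
    forall x y, A x -> A y -> exists c : R -> @R3 R,
      [/\ {within `[0, 1], continuous c}, c @` `[0, 1] `<=` A,
          c 0 = x & c 1 = y] &
    forall c : R -> @R3 R, {within `[0, 1], continuous c} ->
      c @` `[0, 1] `<=` A -> c 0 = c 1 ->
      exists H : R * R -> @R3 R,
        [/\ {within `[0, 1] `*` `[0, 1], continuous H},
            H @` (`[0, 1] `*` `[0, 1]) `<=` A,
            forall s, 0 <= s <= 1 -> H (0, s) = c s,
            forall s, 0 <= s <= 1 -> H (1, s) = c 0 &
            forall s, 0 <= s <= 1 -> H (s, 0) = c 0 /\ H (s, 1) = c 0]].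

Record smooth_domain (beta : R) U : Prop := {
  dom_open : open U;
  dom_nonempty : U !=set0;
  dom_bounded : bounded_set U;
  dom_connected : connected U;
  dom_class : class_C2 beta U }.

Record reference_hole (beta : R) A : Prop := {
  hole_open : open A;
  hole_inside : compactly_in A [set x | euclid x < 8^-1];
  hole_simply_connected : simply_connected A;
  hole_class : class_C2 beta A;
  hole_exterior : connected (~` closure A) }.

Definition cell : set (@R3 R) := [set y | forall i, - 2^-1 < component i y < 2^-1].

Definition node (k : 'I_3 -> int) : @R3 R := vec (fun i => (k i)%:~R).

Definition inner_cells U (eps : R) : set ('I_3 -> int) :=
  [set k | compactly_in [set eps *: (node k + y) | y in closure cell] U].

Definition small_hole A (eps : R) (k : 'I_3 -> int) : set (@R3 R) :=
  [set eps *: node k + eps ^+ 3 *: y | y in A].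

Definition holes U A (eps : R) : set (@R3 R) :=
  \bigcup_(k in inner_cells U eps) closure (small_hole A eps k).

Definition perforated U A (eps : R) : set (@R3 R) := U `\` holes U A eps.

End Geometry.

Section Sobolev.
Context {R : realType}.
Local Notation R3 := (@R3 R).
Implicit Types (U : set R3) (f g : R3 -> R) (p : \bar R).

Definition inLp p U f : Prop := f \_ U \in Lfun (@leb3 R) p.

Definition L1loc U f := forall K, compact K -> K `<=` U -> inLp 1%:E K f.

Definition wderiv U (v : R3) f g :=
  [/\ L1loc U f, L1loc U g &
    forall phi : R3 -> R, Cinf_c U phi ->
      \int[leb3]_(x in U) (f x * 'D_v phi x) =
      - \int[leb3]_(x in U) (g x * phi x)].

Definition wgrad U f (G : 'I_3 -> R3 -> R) := forall i, wderiv U (ev i) f (G i).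

Definition inH1 U f (G : 'I_3 -> R3 -> R) :=
  [/\ inLp 2%:E U f, forall i, inLp 2%:E U (G i) & wgrad U f G].

(* The weak gradient is unique up to null sets, so the infimum ranges over one
   value; it is +oo if f has no weak gradient. *)
Definition H1norm U f : \bar R :=
  ereal_inf [set ('N[@leb3 R]_2%:E [EFin \o
      ((fun x => Num.sqrt (f x ^+ 2 + \sum_(i < 3) G i x ^+ 2)) \_ U)])%E
    | G in [set G : 'I_3 -> R3 -> R | wgrad U f G]].

Definition inH10 U f :=
  (exists G, inH1 U f G) /\
  forall r : R, 0 < r -> exists2 phi : R3 -> R, Cinf_c U phi &
    (H1norm U (fun x => (f x - phi x)%R) < r%:E)%E.

Definition inW2inf U f (G : 'I_3 -> R3 -> R) (H : 'I_3 -> 'I_3 -> R3 -> R) :=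
  [/\ inLp +oo%E U f,
      forall i, inLp +oo%E U (G i),
      forall i j, inLp +oo%E U (H i j),
      wgrad U f G & forall i, wgrad U (G i) (H i)].

Definition L2norm U (w : 'I_3 -> R3 -> R) : \bar R :=
  ('N[@leb3 R]_2%:E [EFin \o
     ((fun x => Num.sqrt (\sum_(i < 3) w i x ^+ 2)) \_ U)])%E.

Definition Linfnorm U f : \bar R := ('N[@leb3 R]_(+oo) [EFin \o (f \_ U)])%E.

(* w . n = 0 on the boundary of U, for a field w with weak divergence d *)
Definition normal_trace0 U (w : 'I_3 -> R3 -> R) (d : R3 -> R) :=
  forall phi G, inH1 U phi G ->
    \int[leb3]_(x in U) (\sum_(i < 3) w i x * G i x + d x * phi x) = 0.

(* W^{1,oo}(R); the continuous representative is the one that is composed *)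
Definition inW1inf_line (m : R -> R) :=
  [/\ continuous m, m \in Lfun (@leb R) +oo%E &
    exists2 m', m' \in Lfun (@leb R) +oo%E &
      forall phi : R -> R, Cinf_c setT phi ->
        \int[leb]_(s in setT) (m s * 'D_1 phi s) =
        - \int[leb]_(s in setT) (m' s * phi s)].

End Sobolev.

Section SpaceTime.
Context {R : realType}.
Local Notation R3 := (@R3 R).
Implicit Types (T : R) (U : set R3) (w z : R -> R3 -> R).

Definition cylinder T U : set (R * R3) := `]0, T[ `*` U.

Definition integral4 T U (F : R -> R3 -> R) : R :=
  \int[leb]_(t in `]0, T[) \int[leb3]_(x in U) F t x.

Definition dt : R * R3 := (1, 0).
Definition dx (i : 'I_3) : R * R3 := (0, ev i).

Definition inLp4 (p : \bar R) (A : set (R * R3)) w : Prop :=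
  (fun y : R * R3 => w y.1 y.2) \_ A \in Lfun (@leb4 R) p.

Definition wderiv4 T U (v : R * R3) w z :=
  [/\ forall K, compact K -> K `<=` cylinder T U -> inLp4 1%:E K w,
      forall K, compact K -> K `<=` cylinder T U -> inLp4 1%:E K z &
    forall phi : R * R3 -> R, Cinf_c (cylinder T U) phi ->
      integral4 T U (fun t x => w t x * 'D_v phi (t, x)) =
      - integral4 T U (fun t x => z t x * phi (t, x))].

Definition inW1inf4 T U w :=
  inLp4 +oo%E (cylinder T U) w /\
  forall v, v = dt \/ (exists i, v = dx i) ->
    exists2 z, inLp4 +oo%E (cylinder T U) z & wderiv4 T U v w z.

(* L^oo(0,T;L^2); for finite T it is contained in L^2((0,T) x U) *)
Definition inLinfL2 T U w :=
  inLp4 2%:E (cylinder T U) w /\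
  exists M : R, {ae leb, forall t, 0 < t < T ->
    ('N[@leb3 R]_2%:E [EFin \o (w t \_ U)] <= M%:E)%E}.

Definition inL2H1 T U w (G : R -> 'I_3 -> R3 -> R) :=
  [/\ inLp4 2%:E (cylinder T U) w,
      forall i, inLp4 2%:E (cylinder T U) (G ^~ i) &
      {ae leb, forall t, 0 < t < T -> inH1 U (w t) (G t)}].

Definition inLinfW2inf T U w (G : R -> 'I_3 -> R3 -> R)
    (H : R -> 'I_3 -> 'I_3 -> R3 -> R) :=
  [/\ inLp4 +oo%E (cylinder T U) w,
      forall i, inLp4 +oo%E (cylinder T U) (G ^~ i),
      forall i j, inLp4 +oo%E (cylinder T U) (fun t => H t i j) &
      {ae leb, forall t, 0 < t < T -> inW2inf U (w t) (G t) (H t)}].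

(* C^1_c([0,T) x U): restrictions to t >= 0 of C^1 functions on the whole
   space-time with compact support in (-oo,T) x U *)
Definition C1c_initial T U (phi : R * R3 -> R) := Ck_c 1 (`]-oo, T[ `*` U) phi.

Definition Cweak_with_initial T U (u : R -> 'I_3 -> R3 -> R)
    (u0 : 'I_3 -> R3 -> R) :=
  exists ub : R -> 'I_3 -> R3 -> R,
    [/\ {ae leb, forall t, 0 < t < T ->
           {ae leb3, forall x, U x -> forall i, ub t i x = u t i x}},
        forall t, 0 <= t <= T -> forall i, inLp 2%:E U (ub t i),
        forall a, (forall i, inLp 2%:E U (a i)) ->
          {within `[0, T], continuous (fun t : R =>
             \int[leb3]_(x in U) \sum_(i < 3) ub t i x * a i x)} &
        {ae leb3, forall x, U x -> forall i, ub 0 i x = u0 i x}].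

(* w(0) = w0, for the representative of w that is continuous at 0 in L^2 *)
Definition initial_value T U w (w0 : R3 -> R) :=
  inLp 2%:E U w0 /\
  exists wb : R -> R3 -> R,
    {ae leb, forall t, 0 < t < T ->
       {ae leb3, forall x, U x -> wb t x = w t x}} /\
    (('N[@leb3 R]_2%:E [EFin \o ((fun x => wb t x - w0 x)%R \_ U)])%E
       @[t --> 0^'+] --> 0%E).

Definition symm (D : 'I_3 -> 'I_3 -> R) (i j : 'I_3) : R := (D i j + D j i) / 2.

Definition contract (A B : 'I_3 -> 'I_3 -> R) : R :=
  \sum_(i < 3) \sum_(j < 3) A i j * B i j.

Definition dot (a b : 'I_3 -> R) : R := \sum_(i < 3) a i * b i.

End SpaceTime.

Section Systems.
Context {R : realType}.
Local Notation R3 := (@R3 R).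

Record data := Data {
  Omega : set R3;
  hole : set R3;
  Tf : R;
  visc : R -> R;
  visc_min : R;
  visc_max : R;
  kf : R;
  ks : R;
  force : R -> 'I_3 -> R3 -> R;
  pot : R3 -> R;
  grav : 'I_3 -> R3 -> R;
  rho_min : R;
  rho_max : R }.

Record admissible (beta : R) (P : data) : Prop := {
  adm_beta : 0 < beta < 1;
  adm_Omega : smooth_domain beta (Omega P);
  adm_hole : reference_hole beta (hole P);
  adm_Tf : 0 < Tf P;
  adm_visc : inW1inf_line (visc P);
  adm_visc_min : 0 < visc_min P;
  adm_visc_bounds : forall s, visc_min P <= visc P s <= visc_max P;
  adm_kf : 0 < kf P;
  adm_ks : 0 < ks P;
  adm_force : forall i, inW1inf4 (Tf P) (Omega P) (fun t => force P t i);
  adm_grav : exists H, inW2inf (Omega P) (pot P) (grav P) H;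
  adm_rho : 0 < rho_min P < rho_max P }.

Definition Omega_ (P : data) (eps : R) : set R3 :=
  perforated (Omega P) (hole P) eps.

Definition kappa_ (P : data) (eps : R) (x : R3) : R :=
  if x \in Omega_ P eps then kf P else ks P.

Record micro_initial (P : data) (eps : R) (rho0 : R3 -> R)
    (u0 : 'I_3 -> R3 -> R) : Prop := {
  mi_rho : inLp +oo%E (Omega_ P eps) rho0;
  mi_rho_bounds : {ae leb3, forall x, Omega_ P eps x ->
    rho_min P <= rho0 x <= rho_max P};
  mi_u : forall i, inLp 2%:E (Omega_ P eps) (u0 i);
  mi_div : forall phi : R3 -> R, Cinf_c (Omega_ P eps) phi ->
    \int[leb3]_(x in Omega_ P eps) \sum_(i < 3) u0 i x * 'D_(ev i) phi x = 0;
  mi_trace : normal_trace0 (Omega_ P eps) u0 (fun=> 0) }.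

(* The extension to Omega of the density by transport, from the initial value
   extended to the holes by rho_min. A C^1 function on [rho_min, rho_max] is the
   restriction of a C^1 function b on the line. *)
Definition transported_extension (P : data) (eps : R) (rho0 : R3 -> R)
    (rho : R -> R3 -> R) (u : R -> 'I_3 -> R3 -> R) (rhat : R -> R3 -> R) :=
  let rhat0 x := if x \in Omega_ P eps then rho0 x else rho_min P in
  [/\ inLp4 +oo%E (cylinder (Tf P) (Omega P)) rhat,
      {ae leb4, forall y, cylinder (Tf P) (Omega P) y ->
         rho_min P <= rhat y.1 y.2 <= rho_max P},
      {ae leb4, forall y, cylinder (Tf P) (Omega_ P eps) y ->
         rhat y.1 y.2 = rho y.1 y.2} &
      forall (b : R -> R) psi, Ck 1 setT b -> C1c_initial (Tf P) (Omega P) psi ->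
        integral4 (Tf P) (Omega P) (fun t x => b (rhat t x) *
          ('D_dt psi (t, x) +
           \sum_(i < 3) (u t i \_ (Omega_ P eps)) x * 'D_(dx i) psi (t, x)))
        + \int[leb3]_(x in Omega P) (b (rhat0 x) * psi (0, x)) = 0].

(* Du and Gth are the weak spatial gradients of u and th *)
Record weak_solution_with (P : data) (eps : R)
    (rho0 : R3 -> R) (u0 : 'I_3 -> R3 -> R)
    (rho : R -> R3 -> R) (u : R -> 'I_3 -> R3 -> R) (th : R -> R3 -> R)
    (Du : R -> 'I_3 -> 'I_3 -> R3 -> R) (Gth : R -> 'I_3 -> R3 -> R)
    : Prop := {
  ws_rho : inLp4 +oo%E (cylinder (Tf P) (Omega_ P eps)) rho;
  ws_rho_bounds : {ae leb4, forall y, cylinder (Tf P) (Omega_ P eps) y ->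
    rho_min P <= rho y.1 y.2 <= rho_max P};
  ws_th : inL2H1 (Tf P) (Omega P) th Gth;
  ws_th_mean : {ae leb, forall t, 0 < t < Tf P ->
    \int[leb3]_(x in Omega P) th t x = 0};
  ws_u_LinfL2 : forall i, inLinfL2 (Tf P) (Omega_ P eps) (fun t => u t i);
  ws_u_L2H1 : forall i,
    inL2H1 (Tf P) (Omega_ P eps) (fun t => u t i) (fun t => Du t i);
  ws_u_H10 : {ae leb, forall t, 0 < t < Tf P ->
    forall i, inH10 (Omega_ P eps) (u t i)};
  ws_div : {ae leb4, forall y, cylinder (Tf P) (Omega_ P eps) y ->
    \sum_(i < 3) Du y.1 i i y.2 = 0};
  ws_u_initial : Cweak_with_initial (Tf P) (Omega_ P eps) u u0;
  ws_transport : exists rhat, transported_extension P eps rho0 rho u rhat;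
  ws_momentum : forall phi : 'I_3 -> R * R3 -> R,
    (forall i, C1c_initial (Tf P) (Omega_ P eps) (phi i)) ->
    (forall t x, 0 <= t < Tf P -> Omega_ P eps x ->
       \sum_(i < 3) 'D_(dx i) (phi i) (t, x) = 0) ->
    let Dphi t x i j := 'D_(dx j) (phi i) (t, x) in
    integral4 (Tf P) (Omega_ P eps) (fun t x =>
        rho t x * dot (fun i => u t i x) (fun i => 'D_dt (phi i) (t, x))
      + rho t x * contract (fun i j => u t i x * u t j x) (Dphi t x)
      - 2 * visc P (th t x) *
          contract (symm (fun i j => Du t i j x)) (symm (Dphi t x))
      + dot (fun i => rho t x * force P t i x - th t x * grav P i x)
            (fun i => phi i (t, x)))
    + \int[leb3]_(x in Omega_ P eps)
        (rho0 x * dot (fun i => u0 i x) (fun i => phi i (0, x))) = 0;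
  ws_temperature : {ae leb, forall t, 0 < t < Tf P ->
    forall phi G, inH1 (Omega P) phi G ->
      \int[leb3]_(x in Omega P)
        (kappa_ P eps x * dot (fun i => Gth t i x) (fun i => G i x)) =
      \int[leb3]_(x in Omega P)
        (dot (fun i => (u t i \_ (Omega_ P eps)) x) (fun i => grav P i x) * phi x)};
  ws_energy : {ae leb, forall t, 0 < t < Tf P ->
    2^-1 * \int[leb3]_(x in Omega_ P eps)
             (rho t x * \sum_(i < 3) u t i x ^+ 2)
    + integral4 t (Omega_ P eps) (fun s x => 2 * visc P (th s x) *
        contract (symm (fun i j => Du s i j x)) (symm (fun i j => Du s i j x)))
    + integral4 t (Omega P) (fun s x =>
        kappa_ P eps x * \sum_(i < 3) Gth s i x ^+ 2)
    <= 2^-1 * \int[leb3]_(x in Omega_ P eps)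
                (rho0 x * \sum_(i < 3) u0 i x ^+ 2)
    + integral4 t (Omega_ P eps) (fun s x =>
        rho s x * dot (fun i => force P s i x) (fun i => u s i x))} }.

Definition finite_energy_weak_solution (P : data) (eps : R)
    (rho0 : R3 -> R) (u0 : 'I_3 -> R3 -> R)
    (rho : R -> R3 -> R) (u : R -> 'I_3 -> R3 -> R) (th : R -> R3 -> R) :=
  exists Du Gth, weak_solution_with P eps rho0 u0 rho u th Du Gth.

(* Away from the hole the finite-energy solution of the Stokes system is smooth,
   and it is continuous up to the boundary of the hole. *)
Record stokes_profile (A : set R3) (i : 'I_3) (V : 'I_3 -> R3 -> R)
    (Q : R3 -> R) : Prop := {
  st_V : forall k, Ck 2 (~` closure A) (V k);
  st_Q : Ck 1 (~` closure A) Q;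
  st_energy : forall k l, inLp 2%:E (~` closure A) ('D_(ev l) (V k));
  st_momentum : forall x k, ~ closure A x ->
    - \sum_(l < 3) 'D_(ev l) ('D_(ev l) (V k)) x + 'D_(ev k) Q x = 0;
  st_div : forall x, ~ closure A x -> \sum_(k < 3) 'D_(ev k) (V k) x = 0;
  st_V_continuous : forall k, {within ~` A, continuous (V k)};
  st_V_boundary : forall x k, boundary A x -> V k x = 0;
  st_infinity : forall d : R, 0 < d -> exists r : R, forall x, r < euclid x ->
    (forall k, `|V k x - (i == k)%:R| < d) /\ `|Q x| < d }.

Definition resistance_matrix (A : set R3) (M : 'M[R]_3) :=
  exists (V : 'I_3 -> 'I_3 -> R3 -> R) (Q : 'I_3 -> R3 -> R),
    (forall i, stokes_profile A i (V i) (Q i)) /\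
    forall i j, M i j = \int[leb3]_(y in ~` closure A)
      contract (fun k l => 'D_(ev l) (V i k) y) (fun k l => 'D_(ev l) (V j k) y).

(* Du, D2u, ut, Dut, D2ut, Gth, Hth are the weak derivatives of u and th *)
Record effective_solution_with (P : data) (M : 'M[R]_3)
    (rho0 : R3 -> R) (u0 : 'I_3 -> R3 -> R)
    (rho : R -> R3 -> R) (u : R -> 'I_3 -> R3 -> R) (th p : R -> R3 -> R)
    (Du : R -> 'I_3 -> 'I_3 -> R3 -> R)
    (D2u : R -> 'I_3 -> 'I_3 -> 'I_3 -> R3 -> R)
    (ut : R -> 'I_3 -> R3 -> R)
    (Dut : R -> 'I_3 -> 'I_3 -> R3 -> R)
    (D2ut : R -> 'I_3 -> 'I_3 -> 'I_3 -> R3 -> R)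
    (Gth : R -> 'I_3 -> R3 -> R) (Hth : R -> 'I_3 -> 'I_3 -> R3 -> R)
    : Prop := {
  es_rho_bounds : {ae leb4, forall y, cylinder (Tf P) (Omega P) y ->
    rho_min P <= rho y.1 y.2 <= rho_max P};
  es_rho : inW1inf4 (Tf P) (Omega P) rho;
  es_u : forall i, inLinfW2inf (Tf P) (Omega P)
    (fun t => u t i) (fun t => Du t i) (fun t => D2u t i);
  es_ut : forall i, inLinfW2inf (Tf P) (Omega P)
    (fun t => ut t i) (fun t => Dut t i) (fun t => D2ut t i);
  es_dt_u : forall i,
    wderiv4 (Tf P) (Omega P) dt (fun t => u t i) (fun t => ut t i);
  es_th : inLinfW2inf (Tf P) (Omega P) th Gth Hth;
  es_p : inLinfL2 (Tf P) (Omega P) p;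
  es_continuity : exists (rt : R -> R3 -> R) (J : 'I_3 -> R -> R3 -> R),
    [/\ wderiv4 (Tf P) (Omega P) dt rho rt,
        forall i, wderiv4 (Tf P) (Omega P) (dx i)
          (fun t x => rho t x * u t i x) (J i) &
        {ae leb4, forall y, cylinder (Tf P) (Omega P) y ->
          rt y.1 y.2 + \sum_(i < 3) J i y.1 y.2 = 0}];
  es_div : {ae leb4, forall y, cylinder (Tf P) (Omega P) y ->
    \sum_(i < 3) Du y.1 i i y.2 = 0};
  es_momentum : forall phi : 'I_3 -> R * R3 -> R,
    (forall i, Cinf_c (cylinder (Tf P) (Omega P)) (phi i)) ->
    let Dphi t x i j := 'D_(dx j) (phi i) (t, x) in
    integral4 (Tf P) (Omega P) (fun t x =>
      - (rho t x * dot (fun i => u t i x) (fun i => 'D_dt (phi i) (t, x)))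
      - rho t x * contract (fun i j => u t i x * u t j x) (Dphi t x)
      + 2 * visc P (th t x) *
          contract (symm (fun i j => Du t i j x)) (symm (Dphi t x))
      + visc P (th t x) *
          dot (fun i => \sum_(j < 3) M i j * u t j x) (fun i => phi i (t, x))
      - p t x * \sum_(i < 3) Dphi t x i i) =
    integral4 (Tf P) (Omega P) (fun t x =>
      dot (fun i => rho t x * force P t i x - th t x * grav P i x)
          (fun i => phi i (t, x)));
  es_temperature : {ae leb4, forall y, cylinder (Tf P) (Omega P) y ->
    - (kf P * \sum_(i < 3) Hth y.1 i i y.2) =
    dot (fun i => u y.1 i y.2) (fun i => grav P i y.2)};
  es_u_boundary : {ae leb, forall t, 0 < t < Tf P ->
    forall i, inH10 (Omega P) (u t i)};
  es_th_boundary : {ae leb, forall t, 0 < t < Tf P ->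
    normal_trace0 (Omega P) (Gth t) (fun x => \sum_(i < 3) Hth t i i x)};
  es_th_mean : {ae leb, forall t, 0 < t < Tf P ->
    \int[leb3]_(x in Omega P) th t x = 0};
  es_p_mean : {ae leb, forall t, 0 < t < Tf P ->
    \int[leb3]_(x in Omega P) p t x = 0};
  es_rho_initial : initial_value (Tf P) (Omega P) rho rho0;
  es_u_initial : forall i,
    initial_value (Tf P) (Omega P) (fun t => u t i) (u0 i) }.

Definition regular_effective_solution (P : data) (M : 'M[R]_3)
    (rho0 : R3 -> R) (u0 : 'I_3 -> R3 -> R)
    (rho : R -> R3 -> R) (u : R -> 'I_3 -> R3 -> R) (th p : R -> R3 -> R) :=
  exists Du D2u ut Dut D2ut Gth Hth, effective_solution_with P M rho0 u0
    rho u th p Du D2u ut Dut D2ut Gth Hth.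

End Systems.

Arguments data : clear implicits.

(* Main.v *)
Require Import Defs.
From HB Require Import structures.
From mathcomp Require Import all_boot all_order all_algebra.
From mathcomp Require Import all_classical all_reals all_analysis.
From mathcomp Require Import measurable_realfun ess_sup_inf ring lra zify.

Set Implicit Arguments.
Unset Strict Implicit.
Unset Printing Implicit Defensive.

Import Order.TTheory GRing.Theory Num.Theory.
Import numFieldNormedType.Exports.

Local Open Scope classical_set_scope.
Local Open Scope ring_scope.

(** The difference w of the two temperatures, extended by zero, solves for almost
    every time an elliptic equation whose right-hand side is the velocity
    difference times g plus the divergence of a bounded field supported in the
    holes, whose total volume is O(eps^6). Testing with w and using Poincare's
    inequality gives the H^1 bound, the holes contributing the square root eps^3 of
    their volume.

    For the uniform bound, w is truncated at a level k. If |{w > k}| <= c0 lam^3,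
    the Faber-Krahn inequality controls the L^2 norm of the truncation v by
    lam |grad v|, and the hole term is bounded by C eps lam since the holes meet
    {w > k} in measure at most C eps^2 lam^2. A De Giorgi iteration over levels
    then bounds w by a multiple of the velocity difference plus eps. The viscosity
    is Lipschitz, being in W^{1,oo}.

    Both inequalities on the domain rest on averaging w(x + lam n + z) - w(x) over
    small cubes of z: the C^2 boundary yields a uniform cone condition, and weak
    derivatives control translates along segments staying in the domain. *)

(** Why eps^3 in one bound and eps in the other: at most C eps^-3 holes of volume C eps^9 give the
    flux defect (kf - kappa) grad theta an L^2 norm of order eps^3. On a set {w > k} of measure c0
    lam^3 that norm is also at most C lam^(3/2), and the geometric mean of the two with weights 1/3
    and 2/3 is C eps lam. By Faber-Krahn a source of norm f acts like f lam, so both terms are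
    linear in lam. The truncated function then has squared norm at most Q lam^4 with Q of order (f +
    eps)^2, and 4 exceeds the exponent 3 in the measure, which makes the iteration converge.

    Faber-Krahn at the scale lam stands in for a Sobolev embedding, so no extension operator enters.
    To translate freely, functions live on the whole space, extended by zero, and the domain only
    restricts the test functions. The chain rule is proved by difference quotients instead of smooth
    approximation; this asks for truncations with Lipschitz derivative. The argument runs at a fixed
    time, and its constants see the effective solution only through a bound [Mt], uniform in time,
    for the gradient of its temperature. *)

(** * Translation invariance and open sets in three dimensions *)

Section LebesgueShift.
Context {R : realType}.
Local Open Scope ereal_scope.

(** Lebesgue measure is determined by its values on half-open intervals, and the preimage of such an
    interval under a translation is one of the same length. *)
Lemma lebesgue_shift (a : R) (A : set R) : measurable A ->
  pushforward (@leb R) (fun x : R => (x + a)%R : measurableTypeR R) A = @leb R A.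
Proof.
move=> mA; rewrite /leb; apply/esym; apply: lebesgue_measure_unique => //.
  by apply: measurable_funD.
move=> mf.
move=> X [[x y] /= _ <-]; rewrite /pushforward /=.
have -> : (fun x1 : R => (x1 + a)%R) @^-1` `]x, y] = `](x - a)%R, (y - a)%R]%classic.
  by apply/seteqP; split => z /=; rewrite !in_itv/= ltrBlDr lerBrDr.
rewrite !lebesgue_measure_itv /= !lte_fin ltrD2r.
by case: ifP => // _; rewrite -!EFinD; congr EFin; ring.
Qed.

Lemma ge0_integral_shift (a : R) (f : R -> \bar R) :
  measurable_fun setT f -> (forall x, 0 <= f x) ->
  \int[@leb R]_x f (x + a)%R = \int[@leb R]_x f x.
Proof.
move=> mf f0.
have mphi : measurable_fun [set: measurableTypeR R]
    (fun x : measurableTypeR R => (x + a)%R : measurableTypeR R).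
  by apply: measurable_funD.
rewrite -[LHS]/(\int[@leb R]_x (f \o (fun x => (x + a)%R)) x).
rewrite -[LHS](@ge0_integral_pushforward _ _ _ _ _ _ mphi (@leb R) _ _ measurableT mf) //.
by apply: eq_measure_integral => A mA _; exact: lebesgue_shift.
Qed.

(** Named so that the first factor of [leb3] carries the sigma-finite instance that Tonelli's
    theorem asks for. *)
Definition leb2 := (@leb R \x @leb R)%E.
HB.instance Definition _ := Measure.on leb2.
Let leb2_sigma_finite : sigma_finite setT leb2.
Proof. exact: product_sigma_finite (sigma_finiteT leb) (sigma_finiteT leb). Qed.
HB.instance Definition _ :=
  Measure_isSigmaFinite.Build _ _ _ leb2 leb2_sigma_finite.

Lemma leb3_tonelli (f : @R3 R -> \bar R) :
  measurable_fun setT f -> (forall x, 0 <= f x) ->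
  \int[@leb3 R]_x f x = \int[@leb R]_x \int[@leb R]_y \int[@leb R]_z f (x, y, z).
Proof.
move=> mf f0.
rewrite -[LHS]/(\int[leb2 \x @leb R]_x f x).
rewrite fubini_tonelli1//.
rewrite fubini_tonelli1//.
  exact: measurable_fun_fubini_tonelli_F.
by move=> x; apply: integral_ge0.
Qed.


Lemma measurable_fun_R3 d (T : measurableType d) (f : T -> @R3 R) :
  measurable_fun setT (fun x => (f x).1.1) ->
  measurable_fun setT (fun x => (f x).1.2) ->
  measurable_fun setT (fun x => (f x).2) -> measurable_fun setT f.
Proof.
move=> m1 m2 m3.
have -> : f = (fun x => ((f x).1.1, (f x).1.2, (f x).2)).
  by apply/funext => x; case: (f x) => [[? ?] ?].
by apply/measurable_fun_pair => //; apply/measurable_fun_pair.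
Qed.

Lemma measurable_coord11 : measurable_fun setT (fun x : @R3 R => x.1.1).
Proof. exact: (measurableT_comp measurable_fst measurable_fst). Qed.
Lemma measurable_coord12 : measurable_fun setT (fun x : @R3 R => x.1.2).
Proof. exact: (measurableT_comp measurable_snd measurable_fst). Qed.
Lemma measurable_coord2 : measurable_fun setT (fun x : @R3 R => x.2).
Proof. exact: measurable_snd. Qed.

Lemma measurable_shift3 (a : @R3 R) :
  measurable_fun setT (fun x : @R3 R => (x + a)%R : @R3 R).
Proof.
apply: measurable_fun_R3 => /=; apply: measurable_funD => //.
- exact: measurable_coord11.
- exact: measurable_coord12.
Qed.

(** Tonelli's theorem reduces the claim to three one-dimensional translations, one for each partial
    integral. *)
Lemma ge0_integral_leb3_shift (a : @R3 R) (f : @R3 R -> \bar R) :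
  measurable_fun setT f -> (forall x, 0 <= f x) ->
  \int[@leb3 R]_x f (x + a)%R = \int[@leb3 R]_x f x.
Proof.
move=> mf f0.
have mphi := measurable_shift3 a.
have mfa : measurable_fun setT (fun x : @R3 R => f (x + a)%R) by exact: measurableT_comp mf mphi.
have fa0 x : 0 <= f (x + a)%R by exact: f0.
rewrite (leb3_tonelli mf f0) (leb3_tonelli mfa fa0).
move: a mphi mfa fa0 => [[a1 a2] a3] _ _ _ /=.
pose F2 (xy : R * R) := \int[@leb R]_z f (xy, z).
have mF2 : measurable_fun setT F2 by exact: measurable_fun_fubini_tonelli_F.
have F20 xy : 0 <= F2 xy by apply: integral_ge0.
pose F1 x := \int[@leb R]_y F2 (x, y).
have mF1 : measurable_fun setT F1 by exact: (measurable_fun_fubini_tonelli_F (m2 := @leb R)).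
have F10 x : 0 <= F1 x by apply: integral_ge0.
transitivity (\int[@leb R]_x F1 (x + a1)%R); last exact: ge0_integral_shift mF1 F10.
apply: eq_integral => x _; rewrite /F1.
have mF2x : measurable_fun setT (fun y => F2 ((x + a1)%R, y)) by exact: measurableT_comp.
transitivity (\int[@leb R]_y F2 ((x + a1)%R, (y + a2)%R)); last first.
  exact: (ge0_integral_shift _ mF2x).
apply: eq_integral => y _; rewrite /F2.
have mfxy : measurable_fun setT (fun z => f (((x + a1)%R, (y + a2)%R), z)).
  exact: measurableT_comp.
exact: (ge0_integral_shift _ mfxy).
Qed.

(** Measurable sets of [R3] are those of the product sigma-algebra, so an open set has to be written
    as a countable union: balls of the maximum norm are products of intervals, and those with
    rational centre and radius 1/(n+1) suffice. *)
Lemma open_measurable3 (U : set (@R3 R)) : open U -> measurable U.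
Proof.
move=> oU.
pose bx (q : rat * rat * rat * nat) : set (@R3 R) :=
  (ball (ratr q.1.1.1 : R) (q.2.+1%:R^-1) `*` ball (ratr q.1.1.2 : R) (q.2.+1%:R^-1))
   `*` ball (ratr q.1.2 : R) (q.2.+1%:R^-1).
have -> : U = \bigcup_q (if `[< bx q `<=` U >] then bx q else set0).
  apply/seteqP; split => [x Ux|x [q _]]; last by case: asboolP => // qU /qU.
  have [e /= e0 eU] : nbhs_ball x U by apply/nbhs_ballP; move: oU; rewrite openE; exact.
  have [n ne] : exists n : nat, (n.+1%:R^-1 < e / 2)%R.
    have e2 : (0 < e / 2)%R by rewrite divr_gt0.
    near \oo => n; exists n; near: n.
    exact: (near_infty_natSinv_lt (PosNum e2)).
  have [h1 h2 h3] : [/\ exists q, ball (ratr q : R) (n.+1%:R^-1) x.1.1,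
    exists q, ball (ratr q : R) (n.+1%:R^-1) x.1.2 & exists q, ball (ratr q : R) (n.+1%:R^-1) x.2].
    have H (y : R) : exists q, ball (ratr q : R) (n.+1%:R^-1) y.
      have n0 : (0 < n.+1%:R^-1 :> R)%R by rewrite invr_gt0.
      move: (n.+1%:R^-1 : R)%R n0 => d d0.
      have [|q] := @rat_in_itvoo R (y - d)%R (y + d)%R.
        by rewrite ltrBlDr -addrA ltrDl addr_gt0.
      rewrite in_itv/= => /andP[q1 q2]; exists q.
      rewrite /ball/= ltr_norml; apply/andP; split.
        by rewrite ltrBrDr addrC.
      by rewrite ltrBlDr addrC.
    by split; apply: H.
  case: h1 => q1 h1; case: h2 => q2 h2; case: h3 => q3 h3.
  exists (q1, q2, q3, n) => //=; case: asboolP => [_|[]]; first by [].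
  move=> y [[/= y1 y2] y3]; apply: eU.
  have ed : (n.+1%:R^-1 + n.+1%:R^-1 <= e)%R by rewrite [leRHS]splitr lerD // ltW.
  split; [split|]; apply: le_ball ed _ _; apply: ball_triangle; (try eassumption);
    exact: ball_sym.
apply: countable_bigcupT_measurable => [|q]; first exact: countableP.
case: ifP => [_|//]; apply: measurableX; last exact: measurable_ball.
by apply: measurableX; exact: measurable_ball.
Unshelve. all: by end_near.
Qed.
End LebesgueShift.

(** * Calculus of [Ck] functions *)

Section CkCalculus.
Context {R : realType} {V : normedModType R}.
Implicit Types (f g : V -> R) (n : nat).

Lemma Ck_continuous n f : Ck n setT f -> continuous f.
Proof. by case: n => [|n] [cf _] x; exact: cf. Qed.

Lemma Ck_derivable n f v x : Ck n.+1 setT f -> derivable f x v.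
Proof. by move=> [_ /(_ v) [df _]]; exact: df. Qed.

Lemma Ck_derive n f v : Ck n.+1 setT f -> Ck n setT ('D_v f).
Proof. by move=> [_ /(_ v) [_]]. Qed.

Lemma CkW n f : Ck n.+1 setT f -> Ck n setT f.
Proof.
elim: n f => [|n IH] f [cf df]; first by split.
split=> // v; have [d1 d2] := df v; split => //; exact: IH.
Qed.

Lemma Ck_cst n (c : R) : Ck n setT (fun _ : V => c).
Proof.
elim: n c => [|n IH] c.
  by split => // x _; exact: cst_continuous.
split => [x _|v]; first exact: cst_continuous.
split => [x _|]; first exact: derivable_cst.
have -> : (fun x => 'D_v (fun _ : V => c) x) = (fun=> 0).
  by apply/funext => x; exact: derive_cst.
exact: IH.
Qed.

Lemma CkD n f g : Ck n setT f -> Ck n setT g -> Ck n setT (fun x => f x + g x).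
Proof.
elim: n f g => [|n IH] f g [cf df] [cg dg].
  by split => // x _; apply: continuousD; [exact: cf|exact: cg].
split => [x _|v]; first by apply: continuousD; [exact: cf|exact: cg].
have [d1 d2] := df v; have [e1 e2] := dg v; split.
  by move=> x _; apply: derivableD; [exact: d1|exact: e1].
have -> : (fun x => 'D_v (fun x => f x + g x) x) = (fun x => 'D_v f x + 'D_v g x).
  by apply/funext => x; apply: deriveD; [exact: d1|exact: e1].
exact: IH.
Qed.

Lemma CkM n f g : Ck n setT f -> Ck n setT g -> Ck n setT (fun x => f x * g x).
Proof.
elim: n f g => [|n IH] f g /[dup] Cf [cf df] /[dup] Cg [cg dg].
  by split => // x _; apply: continuousM; [exact: cf|exact: cg].
split => [x _|v]; first by apply: continuousM; [exact: cf|exact: cg].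
have [d1 d2] := df v; have [e1 e2] := dg v; split.
  by move=> x _; apply: derivableM; [exact: d1|exact: e1].
have -> : (fun x => 'D_v (fun x => f x * g x) x) =
    (fun x => f x * 'D_v g x + g x * 'D_v f x).
  by apply/funext => x; apply: deriveM; [exact: d1|exact: e1].
by apply: CkD; apply: IH => //; exact: CkW.
Qed.

Lemma CkX n f k : Ck n setT f -> Ck n setT (fun x => f x ^+ k).
Proof.
move=> Cf; elim: k => [|k IH]; first exact: Ck_cst.
have -> : (fun x => f x ^+ k.+1) = (fun x => f x * f x ^+ k).
  by apply/funext => x; rewrite exprS.
exact: CkM.
Qed.

Lemma Ck_shift n f (a : V) : Ck n setT f -> Ck n setT (fun x => f (x + a)).
Proof.
have E (g : V -> R) (v x : V) : 'D_v (fun x => g (x + a)) x = 'D_v g (x + a).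
  rewrite /derive; do 2 f_equal; apply/funext => h /=.
  by rewrite addrA.
elim: n f => [|n IH] f [cf df].
  split => // x _; apply: (@continuous_comp _ _ _ (fun x => x + a) f).
    by apply: continuousD; [exact: cvg_id|exact: cst_continuous].
  exact: cf.
split => [x _|v].
  apply: (@continuous_comp _ _ _ (fun x => x + a) f).
    by apply: continuousD; [exact: cvg_id|exact: cst_continuous].
  exact: cf.
have [d1 d2] := df v; split => [x _|].
  have := d1 (x + a) I; rewrite /derivable.
  set F1 := (F in cvg (F @ _) -> _); set F2 := (F in _ -> cvg (F @ _)).
  suff -> : F1 = F2 by [].
  by apply/funext => h /=; rewrite /F1/F2/= addrA.
have -> : (fun x => 'D_v (fun x => f (x + a)) x) = (fun x => 'D_v f (x + a)).
  by apply/funext => x; exact: E.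
exact: (IH ('D_v f)).
Qed.

(** For linear [p], the derivative of the composite along [v] is the derivative of [f] along [p v],
    composed with [p]; the induction therefore needs no product rule. It lifts one-dimensional bumps
    to the coordinates of [R3]. *)
Lemma Ck_comp_linear n (p : V -> R) (f : R -> R) : continuous p ->
  (forall h x y, p (h *: x + y) = h * p x + p y) ->
  Ck n setT f -> Ck n setT (fun x => f (p x)).
Proof.
move=> cp lp.
have E (g : R -> R) (v x : V) : 'D_v (fun x => g (p x)) x = 'D_(p v) g (p x).
  rewrite /derive; do 2 f_equal; apply/funext => h /=.
  by rewrite lp.
elim: n f => [|n IH] f [cf df].
  by split => // x _; apply: continuous_comp; [exact: cp|exact: cf].
split => [x _|v]; first by apply: continuous_comp; [exact: cp|exact: cf].
have [d1 d2] := df (p v); split => [x _|].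
  have := d1 (p x) I; rewrite /derivable.
  set F1 := (F in cvg (F @ _) -> _); set F2 := (F in _ -> cvg (F @ _)).
  suff -> : F1 = F2 by [].
  by apply/funext => h /=; rewrite /F1/F2/= lp.
have -> : (fun x => 'D_v (fun x => f (p x)) x) = (fun x => 'D_(p v) f (p x)).
  by apply/funext => x; exact: E.
exact: (IH ('D_(p v) f)).
Qed.

End CkCalculus.

(** * Smooth functions on the line that vanish to infinite order at 0 *)

Section Ck1.
Context {R : realType}.

Lemma derive_scale (f : R -> R) x v : derivable f x 1 -> 
  derivable f x v /\ 'D_v f x = v * derive1 f x.
Proof.
move=> /derivable1_diffP df; split; first exact: diff_derivable.
rewrite deriveE// derive1E deriveE//.
by rewrite -[in LHS](mulr1 v) -[v * 1]/(v *: (1 : R)) linearZ.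
Qed.

Lemma Ck1S n (f : R -> R) : (forall x, derivable f x 1) -> Ck n setT (derive1 f) ->
  Ck n.+1 setT f.
Proof.
move=> df cf; split => [x _|v].
  exact/differentiable_continuous/derivable1_diffP.
split => [x _|]; first by have [] := derive_scale v (df x).
have -> : (fun x => 'D_v f x) = (fun x => v * derive1 f x).
  by apply/funext => x; have [] := derive_scale v (df x).
by apply: CkM => //; exact: Ck_cst.
Qed.

(* This family of functions is closed under differentiation. *)
Definition flat (P : {poly R}) (x : R) : R :=
  if 0 < x then P.[x^-1] * expR (- x^-1) else 0.

(** With y = 1/x >= 1, |P(y)| is at most the sum of the absolute values of the coefficients times
    y^n, and exp(-y) is at most (n+2)! / y^(n+2). The two spare powers make the difference quotient
    at 0 vanish. *)
Lemma flat_bound (P : {poly R}) :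
  exists2 C, 0 <= C & forall x, 0 < x <= 1 -> `|flat P x| <= C * x ^+ 2.
Proof.
pose n := size P.
exists ((\sum_(i < n) `|P`_i|) * n.+2`!%:R).
  by rewrite mulr_ge0// sumr_ge0.
move=> x /andP[x0 x1]; rewrite /flat x0 normrM (ger0_norm (expR_ge0 _)).
have y1 : 1 <= x^-1 by rewrite invf_ge1.
have -> : x ^+ 2 = (x^-1 ^+ 2)^-1 by rewrite exprVn invrK.
move: (x^-1) y1 => y y1 {x x0 x1}.
have y0 : 0 < y by exact: lt_le_trans y1.
have yn k : 0 < y ^+ k by rewrite exprn_gt0.
apply: (@le_trans _ _ (((\sum_(i < n) `|P`_i|) * y ^+ n) * (n.+2`!%:R / y ^+ n.+2))).
  apply: ler_pM; rewrite ?expR_ge0//.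
    rewrite horner_coef (le_trans (ler_norm_sum _ _ _))// mulr_suml.
    apply: ler_sum => i _; rewrite normrM ler_wpM2l// normrX (ger0_norm (ltW y0)).
    by rewrite ler_weXn2l// ltnW.
  rewrite expRN -[leRHS]invrK lef_pV2 ?posrE ?expR_gt0//; last first.
    by rewrite invr_gt0 divr_gt0// ltr0n fact_gt0.
  rewrite invf_div; apply: le_trans (expR_ge1Dxn n.+1 (ltW y0)).
  by rewrite lerDr.
rewrite -[X in X <= _]mulrA -[leRHS]mulrA ler_wpM2l ?sumr_ge0// mulrCA ler_wpM2l ?ler0n//.
by rewrite -[n.+2]addn2 exprD invfM mulrA divff ?mul1r// gt_eqF.
Qed.

Lemma flat_le0 P x : x <= 0 -> flat P x = 0.
Proof. by rewrite /flat ltNge => ->. Qed.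

(** For x > 0 the derivative of P(1/x) exp(-1/x) is x^-2 (P - P')(1/x) exp(-1/x), the member of the
    family for X^2 (P - P'). At 0 the quadratic bound of [flat_bound] gives derivative 0. *)
Lemma is_derive_flat (P : {poly R}) (x : R) :
  is_derive x (1 : R) (flat P) (flat ('X^2 * (P - deriv P)) x).
Proof.
have [x0|x0|->] := ltgtP x 0.
- rewrite flat_le0 ?ltW//; apply: (near_eq_is_derive (f := cst 0)).
  by near=> y; rewrite flat_le0// ltW//; near: y; exact: lt_nbhsl.
- apply: (near_eq_is_derive (f := fun x : R => P.[x^-1] * expR (- x^-1))).
    by near=> y; rewrite /flat; case: ifPn => //; rewrite -leNgt => /le_gtF; apply: contraFeq => _; near: y; exact: lt_nbhsr.
  have xn0 : x != 0 by rewrite gt_eqF.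
  have dV : is_derive x 1 (fun y : R => y^-1) (- x ^- 2 *: (1 : R)).
    by apply: (@is_deriveV _ (id : R -> R) x 1 1).
  have dP := is_derive1_comp (is_derive_poly P x^-1) dV.
  have dE := @is_derive1_comp R (@expR R) (fun y : R => - y^-1) x _ _ (is_derive_expR (- x^-1)) (is_deriveN dV).
  have dM := is_deriveM dP dE; apply: (is_derive_eq dM).
  rewrite /=.
  rewrite /flat x0 hornerM hornerXn hornerD hornerN.
  by rewrite /GRing.scale/= !mulr1 exprVn; ring.
- rewrite flat_le0//; have [C C0 hC] := flat_bound P.
  have H : h^-1 *: (flat P (h *: 1 + 0) - flat P 0) @[h --> (0:R)^'] --> (0 : R).
    apply/cvgr0Pnorm_le => e e0; near=> h.
    rewrite (flat_le0 P (lexx 0)) subr0 addr0 -[h *: 1]/(h * 1) mulr1 normrZ normfV.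
    have [h0|h0] := leP h 0; first by rewrite flat_le0// normr0 mulr0 ltW.
    have h1 : h <= 1 by rewrite ltW//; near: h; exact/nbhs_dnbhs/lt_nbhsl.
    apply: le_trans (_ : C * h <= _).
      rewrite gtr0_norm// ler_pdivrMl// [leRHS]mulrC -mulrA -expr2; apply: hC.
      by rewrite h0.
    have he : h <= e / (C + 1).
      by rewrite ltW//; near: h; apply/nbhs_dnbhs/lt_nbhsl; rewrite divr_gt0// ltr_wpDl.
    apply: le_trans (_ : (C + 1) * h <= _); first by rewrite ler_pM2r// lerDl.
    by rewrite mulrC -ler_pdivlMr// ltr_wpDl.
  apply: DeriveDef; first by apply/cvg_ex; exists 0.
  exact/cvg_lim.
Unshelve. all: by end_near.
Qed.

Lemma Ck_flat n P : Ck n setT (flat P).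
Proof.
elim: n P => [|n IH] P.
  split => // x _; apply: differentiable_continuous; apply/derivable1_diffP.
  by have [] := is_derive_flat P x.
apply: Ck1S => [x|]; first by have [] := is_derive_flat P x.
have -> : derive1 (flat P) = flat ('X^2 * (P - deriv P)).
  by apply/funext => x; rewrite derive1E; case: (is_derive_flat P x).
exact: IH.
Qed.
End Ck1.

(** * Boxes and smooth approximations of their indicators *)

Section Boxes.
Context {R : realType}.
Implicit Types (a b x : @R3 R).

Definition box3 a b : set (@R3 R) :=
  (`]a.1.1, b.1.1[ `*` `]a.1.2, b.1.2[) `*` `]a.2, b.2[.
Definition cbox3 a b : set (@R3 R) :=
  (`[a.1.1, b.1.1] `*` `[a.1.2, b.1.2]) `*` `[a.2, b.2].

Lemma measurable_box3 a b : measurable (box3 a b).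
Proof. by apply: measurableX => //; exact: measurableX. Qed.

Lemma measurable_cbox3 a b : measurable (cbox3 a b).
Proof. by apply: measurableX => //; exact: measurableX. Qed.

Lemma compact_cbox3 a b : compact (cbox3 a b).
Proof.
by apply: compact_setX; [apply: compact_setX|]; exact: segment_compact.
Qed.

Lemma box3_cbox3 a b : box3 a b `<=` cbox3 a b.
Proof.
move=> x [[/= + +] +]; rewrite !in_itv/= => /andP[/ltW ? /ltW ?] /andP[/ltW ? /ltW ?] /andP[/ltW ? /ltW ?].
by split; [split|]; rewrite /= in_itv/=; apply/andP.
Qed.

Lemma closed_cbox3 a b : closed (cbox3 a b).
Proof. by apply: compact_closed; [exact: norm_hausdorff|exact: compact_cbox3]. Qed.

Lemma leb3_box_lty a b : (@leb3 R (cbox3 a b) < +oo)%E.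
Proof.
have -> : @leb3 R (cbox3 a b) =
    (@leb R `[a.1.1, b.1.1] * @leb R `[a.1.2, b.1.2] * @leb R `[a.2, b.2])%E.
  rewrite [LHS](@product_measure1E _ _ _ _ _ leb2 (@leb R))//; last exact: measurableX.
  congr (_ * _)%E; exact: product_measure1E.
rewrite /leb !lebesgue_measure_itv/=.
by do 3 case: ifP => _; rewrite ?mule0 ?mul0e // -?EFinD -?EFinM ?ltry.
Qed.

Definition bump1 (a b x : R) : R := flat 1 (x - a) * flat 1 (b - x).

Lemma flat1_itv (x : R) : 0 <= flat 1 x < 1.
Proof.
rewrite /flat; case: ifPn => [x0|_]; last by rewrite lexx ltr01.
by rewrite hornerE mul1r expR_ge0 expR_lt1 oppr_lt0 invr_gt0.
Qed.

Lemma flat1_gt0 (x : R) : (0 < flat 1 x) = (0 < x).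
Proof.
by rewrite /flat; case: ifPn => [x0|_]; rewrite ?ltxx// hornerE mul1r expR_gt0.
Qed.

Lemma Ck_bump1 n (a b : R) : Ck n setT (bump1 a b).
Proof.
apply: CkM; first by apply: Ck_shift; exact: Ck_flat.
have -> : (fun z : R => flat 1 (b - z)) = (fun z : R => (fun y : R => flat 1 (y + b)) (- z)).
  by apply/funext => z /=; rewrite addrC.
have cN : continuous (-%R : R -> R) by exact: opp_continuous.
have lN (h x y : R) : - (h *: x + y) = h * - x + - y.
  by rewrite -[h *: x]/(h * x) opprD mulrN.
have CF : Ck n setT (fun y : R => flat 1 (y + b)) by apply: Ck_shift; exact: Ck_flat.
exact: (Ck_comp_linear cN lN CF).
Qed.

Lemma bump1_itv (a b x : R) : 0 <= bump1 a b x < 1.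
Proof.
have /andP[h1 h2] := flat1_itv (x - a); have /andP[h3 h4] := flat1_itv (b - x).
by rewrite /bump1 mulr_ge0//= mulr_ilt1.
Qed.

Lemma bump1_gt0 (a b x : R) : (0 < bump1 a b x) = (a < x < b).
Proof.
rewrite -(subr_gt0 a x) -(subr_gt0 x b) -(flat1_gt0 (x - a)) -(flat1_gt0 (b - x)) /bump1.
have /andP[+ _] := flat1_itv (x - a); have /andP[+ _] := flat1_itv (b - x).
move: (flat 1 (x - a)) (flat 1 (b - x)) => u v; rewrite !le0r.
move=> /orP[/eqP ->|v0] /orP[/eqP ->|u0]; rewrite ?mulr0 ?mul0r ?ltxx ?andbF//.
by rewrite u0 v0 mulr_gt0.
Qed.

Definition bump3 a b x : R :=
  bump1 a.1.1 b.1.1 x.1.1 * bump1 a.1.2 b.1.2 x.1.2 * bump1 a.2 b.2 x.2.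

(** Smooth functions with support in one fixed closed box, converging pointwise to the indicator of
    the open box as m grows: the base 1 - [bump3] lies in [0, 1] and is less than 1 exactly inside
    the box. *)
Definition plateau a b (m : nat) x : R := 1 - (1 - bump3 a b x) ^+ m.

Lemma Ck_bump3 n a b : Ck n setT (bump3 a b).
Proof.
have c11 : continuous (fun x : @R3 R => x.1.1).
  by move=> x; apply: (@continuous_comp _ _ _ fst fst); exact: cvg_fst.
have c12 : continuous (fun x : @R3 R => x.1.2).
  by move=> x; apply: (@continuous_comp _ _ _ fst snd); [exact: cvg_fst|exact: cvg_snd].
have c2 : continuous (fun x : @R3 R => x.2) by move=> x; exact: cvg_snd.
apply: CkM; [apply: CkM|].
- exact: (@Ck_comp_linear _ _ _ (fun x : @R3 R => x.1.1) _ _ _ (Ck_bump1 _ _ _)).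
- exact: (@Ck_comp_linear _ _ _ (fun x : @R3 R => x.1.2) _ _ _ (Ck_bump1 _ _ _)).
- exact: (@Ck_comp_linear _ _ _ (fun x : @R3 R => x.2) _ _ _ (Ck_bump1 _ _ _)).
Qed.

Lemma Ck_plateau n a b m : Ck n setT (plateau a b m).
Proof.
have -> : plateau a b m = (fun x => 1 + (- 1) * (1 + (- 1) * bump3 a b x) ^+ m).
  by apply/funext => x; rewrite /plateau !mulN1r.
apply: CkD; first exact: Ck_cst.
apply: CkM; first exact: Ck_cst.
apply: CkX; apply: CkD; first exact: Ck_cst.
by apply: CkM; [exact: Ck_cst|exact: Ck_bump3].
Qed.

Lemma bump3_itv a b x : 0 <= bump3 a b x < 1.
Proof.
have /andP[h1 h2] := bump1_itv a.1.1 b.1.1 x.1.1.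
have /andP[h3 h4] := bump1_itv a.1.2 b.1.2 x.1.2.
have /andP[h5 h6] := bump1_itv a.2 b.2 x.2.
have h7 : 0 <= bump1 a.1.1 b.1.1 x.1.1 * bump1 a.1.2 b.1.2 x.1.2 < 1.
  by rewrite mulr_ge0//= mulr_ilt1.
case/andP: h7 => h7 h8.
by rewrite /bump3 mulr_ge0//= mulr_ilt1.
Qed.

Lemma bump3_gt0 a b x : box3 a b x -> 0 < bump3 a b x.
Proof.
move=> [[/=]]; rewrite !in_itv/= => h1 h2 h3.
by rewrite /bump3; apply: mulr_gt0; [apply: mulr_gt0|]; rewrite bump1_gt0.
Qed.

Lemma bump3_out a b x : ~ box3 a b x -> bump3 a b x = 0.
Proof.
move=> nb; apply/eqP; apply: contra_notT nb => nb.
have : 0 < bump3 a b x by rewrite lt_def nb; case/andP: (bump3_itv a b x).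
rewrite /bump3; have /andP[h1 _] := bump1_itv a.1.1 b.1.1 x.1.1.
have /andP[h2 _] := bump1_itv a.1.2 b.1.2 x.1.2.
have /andP[h3 _] := bump1_itv a.2 b.2 x.2.
rewrite lt_def => /andP[+ _]; rewrite !mulf_eq0 !negb_or => /andP[/andP[k1 k2] k3].
split; [split|]; rewrite /= in_itv/= -bump1_gt0 lt_def.
all: by apply/andP; split; rewrite // /bump1 mulf_eq0 negb_or.
Qed.

Lemma plateau_itv a b m x : 0 <= plateau a b m x <= 1.
Proof.
rewrite /plateau subr_ge0 gerBl; have /andP[h1 /ltW h2] := bump3_itv a b x.
by rewrite exprn_ge0 ?exprn_ile1 ?subr_ge0// lerBlDl lerDr.
Qed.

Lemma plateau_out a b m x : ~ box3 a b x -> plateau a b m x = 0.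
Proof. by move=> nb; rewrite /plateau bump3_out// subr0 expr1n subrr. Qed.

Lemma cvg_plateau a b x : plateau a b m x @[m --> \oo] --> (\1_(box3 a b) x : R).
Proof.
rewrite indicE; case: (boolP (x \in box3 a b)); rewrite ?inE ?notin_setE => bx.
- have b0 := bump3_gt0 bx; have /andP[h1 h2] := bump3_itv a b x.
  rewrite /plateau -[X in _ --> X](subr0 1); apply: cvgB; first exact: cvg_cst.
  apply: cvg_expr; rewrite ger0_norm; last by rewrite subr_ge0 ltW.
  by rewrite gtrBl.
- under eq_fun do rewrite plateau_out//.
  exact: cvg_cst.
Qed.

Lemma Cinf_plateau (V : set (@R3 R)) a b m : cbox3 a b `<=` V ->
  Cinf_c V (plateau a b m).
Proof.
move=> abV n; split; first exact: Ck_plateau.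
have sub : closure [set x | plateau a b m x != 0] `<=` cbox3 a b.
  rewrite (closure_id (cbox3 a b)).1; last exact: closed_cbox3.
  apply: closureS => x /= h; apply: box3_cbox3; apply: contrapT => nb.
  by rewrite plateau_out ?eqxx in h.
split; last exact: subset_trans sub abV.
by apply: (subclosed_compact _ (@compact_cbox3 a b)) => //; exact: closed_closure.
Qed.
End Boxes.

(** * Fundamental lemma of the calculus of variations *)

Section FundamentalLemma.
Context {R : realType}.
Implicit Types (a b x : @R3 R).

Lemma continuous_measurable3 (f : @R3 R -> R) : continuous f -> measurable_fun setT f.
Proof.
move=> /continuousP cf; apply: (measurability _ (RGenOpens.measurableE R)).
move=> _ [_ [p [q ->] <-]]; rewrite setTI; apply: open_measurable3.
exact/cf/interval_open.
Qed.

Lemma Ck_measurable n (f : @R3 R -> R) : Ck n setT f -> measurable_fun setT f.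
Proof. by move=> /Ck_continuous; exact: continuous_measurable3. Qed.

Definition boxes : set (set (@R3 R)) := [set A | exists a b, A = box3 a b].

Lemma box3I a b a' b' : box3 a b `&` box3 a' b' =
  box3 (Num.max a.1.1 a'.1.1, Num.max a.1.2 a'.1.2, Num.max a.2 a'.2)
       (Num.min b.1.1 b'.1.1, Num.min b.1.2 b'.1.2, Num.min b.2 b'.2).
Proof.
apply/seteqP; split => x; rewrite /box3 /=.
  move=> [[[]]]; rewrite /= ?in_itv/= => /andP[? ?] /andP[? ?] /andP[? ?].
  move=> [[]]; rewrite /= ?in_itv/= => /andP[? ?] /andP[? ?] /andP[? ?].
  by split; [split|]; rewrite /= ?in_itv/= gt_max lt_min; repeat (apply/andP; split).
move=> [[]]; rewrite /= ?in_itv/= !gt_max !lt_min.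
move=> /andP[/andP[? ?] /andP[? ?]] /andP[/andP[? ?] /andP[? ?]] /andP[/andP[? ?] /andP[? ?]].
by split; split; [split| |split|]; rewrite /= ?in_itv/=; apply/andP.
Qed.

Lemma boxes_setI : setI_closed boxes.
Proof. by move=> _ _ [a [b ->]] [a' [b' ->]]; rewrite box3I; eexists; eexists. Qed.

(** The identity, with the sigma-algebra generated by the boxes on its source, is measurable: the
    preimage of an open interval under a coordinate is the union over k of boxes whose two other
    sides are (-k, k). *)
Lemma measurable_boxes : @measurable _ (@R3 R) = <<s boxes >>.
Proof.
apply/seteqP; split; last first.
  apply: smallest_sub; first exact: sigma_algebra_measurable.
  by move=> _ [a [b ->]]; exact: measurable_box3.
pose T := g_sigma_algebraType boxes.
have mid : measurable_fun [set: T] (fun x : T => x : @R3 R).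
  have gen (c : @R3 R -> R) (F : R -> R -> nat -> set (@R3 R)) :
      (forall p q k, boxes (F p q k)) ->
      (forall p q x, (p < c x < q) <-> exists k, F p q k x) ->
      measurable_fun [set: T] (fun x : T => c (x : @R3 R)).
    move=> FB cF; apply: (measurability _ (RGenOpens.measurableE R)).
    move=> _ [_ [p [q ->] <-]]; rewrite setTI.
    have -> : (fun x : T => c (x : @R3 R)) @^-1` `]p, q[ = \bigcup_k F p q k.
      apply/seteqP; split => [x|x [k _ Fx]]; rewrite /= ?in_itv/=.
        by move=> /cF[k Fx]; exists k.
      by apply/cF; exists k.
    by apply: bigcupT_measurable => k; apply: sub_sigma_algebra.
  have bd (y z : R) : exists k : nat, - (k%:R : R) < y < k%:R /\ - (k%:R : R) < z < k%:R.
    pose m := Num.max `|y| `|z|.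
    exists (Num.bound m).
    have hm : m < (Num.bound m)%:R by apply: archi_boundP; rewrite /m le_max normr_ge0.
    by rewrite -!ltr_norml; split; apply: le_lt_trans hm; rewrite /m le_max lexx ?orbT.
  apply: measurable_fun_R3.
  - apply: (gen (fun x => x.1.1) (fun p q k => box3 (p, - k%:R, - k%:R) (q, k%:R, k%:R))).
      by move=> p q k; do 2 eexists.
    move=> p q x; split => [pq|[k [[/=]]]]; last by rewrite ?in_itv.
    have [k [h1 h2]] := bd x.1.2 x.2.
    by exists k; split; [split|]; rewrite /= ?in_itv.
  - apply: (gen (fun x => x.1.2) (fun p q k => box3 (- k%:R, p, - k%:R) (k%:R, q, k%:R))).
      by move=> p q k; do 2 eexists.
    move=> p q x; split => [pq|[k [[/=]]]]; last by rewrite ?in_itv.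
    have [k [h1 h2]] := bd x.1.1 x.2.
    by exists k; split; [split|]; rewrite /= ?in_itv.
  - apply: (gen (fun x => x.2) (fun p q k => box3 (- k%:R, - k%:R, p) (k%:R, k%:R, q))).
      by move=> p q k; do 2 eexists.
    move=> p q x; split => [pq|[k [[/=]]]]; last by rewrite ?in_itv.
    have [k [h1 h2]] := bd x.1.1 x.1.2.
    by exists k; split; [split|]; rewrite /= ?in_itv.
move=> A mA.
by have := mid measurableT A mA; rewrite setTI.
Qed.

Definition loc_integrable (g : @R3 R -> R) :=
  forall a b, (@leb3 R).-integrable (cbox3 a b) (EFin \o g).

(** Test with the functions [plateau a b m] and let m tend to infinity by dominated convergence. *)
Lemma box_integral0 (V : set (@R3 R)) g a b : loc_integrable g -> 
  (forall phi, Cinf_c V phi -> \int[@leb3 R]_x (g x * phi x) = 0) ->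
  cbox3 a b `<=` V -> (\int[@leb3 R]_(x in box3 a b) (g x)%:E = 0)%E.
Proof.
move=> ig gV abV.
have mg : measurable_fun (cbox3 a b) (EFin \o g) by exact: measurable_int (ig a b).
have mC : measurable (cbox3 a b) := measurable_cbox3 a b.
have mB : measurable (box3 a b) := measurable_box3 a b.
have phi0 m : (\int[@leb3 R]_(x in cbox3 a b) (g x * plateau a b m x)%:E = 0)%E.
  have := gV _ (Cinf_plateau m abV).
  have -> : \int[leb3]_x (g x * plateau a b m x) =
            \int[leb3]_(x in cbox3 a b) (g x * plateau a b m x).
    rewrite [RHS]Rintegral_mkcond; apply: eq_Rintegral => x _.
    rewrite patchE; case: ifPn => //; rewrite notin_setE => nx.
    by rewrite plateau_out ?mulr0// => /box3_cbox3.
  rewrite /Rintegral => /eqP; rewrite fine_eq0; first by move/eqP.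
  apply: integrable_fin_num => //; apply: le_integrable (ig a b) => //.
    apply/measurable_EFinP/measurable_funM; first exact/measurable_EFinP.
    apply: measurable_funTS.
    exact: Ck_measurable (Ck_plateau 0 a b m).
  move=> x _; rewrite lee_fin normrM ler_piMr// ger0_norm; by case/andP: (plateau_itv a b m x).
have mI : measurable_fun (cbox3 a b) (fun x => (g x * \1_(box3 a b) x)%:E).
  apply/measurable_EFinP/measurable_funM; first exact/measurable_EFinP.
  by apply: measurable_funTS; exact: measurable_indic.
have mP m : measurable_fun (cbox3 a b) (fun x => (g x * plateau a b m x)%:E).
  apply/measurable_EFinP/measurable_funM; first exact/measurable_EFinP.
  by apply: measurable_funTS; exact: Ck_measurable (Ck_plateau 0 a b m).
have iabs : (@leb3 R).-integrable (cbox3 a b) (fun x => `|(g x)%:E|)%E.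
  exact: integrable_abse (ig a b).
have [| |_ _ +] := @dominated_convergence _ _ _ (@leb3 R) _ mC _ _ _ mP mI _ iabs _.
- apply: nearW => x _; apply: cvg_EFin; first exact: nearW.
  apply: cvgM; [exact: cvg_cst|exact: cvg_plateau].
- apply: nearW => x m _; rewrite lee_fin normrM ler_piMr// ger0_norm//; by case/andP: (plateau_itv a b m x).
under eq_fun do rewrite phi0.
move=> /cvg_lim; rewrite lim_cst// => -> //.
transitivity (\int[@leb3 R]_(x in cbox3 a b) ((EFin \o g) \_ (box3 a b)) x)%E.
  rewrite -integral_mkcondr; congr (integral _ _ _).
  by apply/esym/setIidr; exact: box3_cbox3.
apply: eq_integral => x _; rewrite patchE indicE; case: ifPn => xb /=.
  by rewrite mulr1.
by rewrite mulr0.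
Qed.

#[global] Instance leb3_ae_filter : Filter (almost_everywhere (@leb3 R)).
Proof. exact: (ae_filter_ringOfSetsType (@leb3 R)). Qed.

#[global] Instance leb_ae_filter : Filter (almost_everywhere (@leb R)).
Proof. exact: (ae_filter_ringOfSetsType (@leb R)). Qed.

(** The sets S over which g has zero integral within the box form a Dynkin system containing the
    boxes, a family stable under intersection; hence every measurable S is one of them. *)
Lemma box_ae0 (V : set (@R3 R)) g a b : loc_integrable g ->
  (forall phi, Cinf_c V phi -> \int[@leb3 R]_x (g x * phi x) = 0) ->
  cbox3 a b `<=` V -> {ae leb3, forall x, box3 a b x -> g x = 0}.
Proof.
move=> ig gV abV.
have mB : measurable (box3 a b) := measurable_box3 a b.
have iB : (@leb3 R).-integrable (box3 a b) (EFin \o g).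
  by apply: integrableS (ig a b) => //; [exact: measurable_cbox3|exact: box3_cbox3].
pose P S := (\int[@leb3 R]_(x in box3 a b `&` S) (g x)%:E = 0)%E.
have PT : P setT by rewrite /P setIT; exact: box_integral0 gV abV.
have PS S : measurable S -> P S.
  rewrite measurable_boxes; apply: (dynkin_induction measurable_boxes boxes_setI) => //.
  - move=> _ [a' [b' ->]]; rewrite /P box3I; apply: (box_integral0 ig gV).
    apply: subset_trans abV => x [[]]; rewrite /= ?in_itv/= !ge_max !le_min.
    move=> /andP[/andP[? ?] /andP[? ?]] /andP[/andP[? ?] /andP[? ?]] /andP[/andP[? ?] /andP[? ?]].
    by split; [split|]; rewrite /= ?in_itv/=; apply/andP.
  - move=> A mA PSS; move: PT; rewrite /P -[X in box3 a b `&` X](setUv A) setIUr.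
    rewrite integral_setU//=.
    + by rewrite [X in (X + _)%E]PSS add0e.
    + exact: measurableI.
    + by apply: measurableI => //; exact: measurableC.
    + by rewrite -setIUr setUv setIT; exact: measurable_int iB.
    + by apply/disj_setPS => x [[_ Sx] [_ /(_ Sx)]].
  - move=> F mF tF PF.
    have mBF k : measurable (box3 a b `&` F k) by exact: (measurableI _ _ mB (mF k)).
    rewrite /P setI_bigcupr integral_bigcup//.
    + by apply: eseries0 => k _ _; exact: PF.
    + by move=> i j _ _ [x [[_ Fi] [_ Fj]]]; apply: (tF i j) => //; exists x.
    + rewrite -setI_bigcupr; apply: (integrableS _ _ _ iB) => //.
      by apply: (measurableI _ _ mB); exact: bigcupT_measurable.
have h E : E `<=` box3 a b -> measurable E ->
    (\int[@leb3 R]_(x in E) (EFin \o g) x = \int[@leb3 R]_(x in E) cst 0 x)%E.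
  move=> Eb mE; rewrite integral0; move: (PS E mE).
  by rewrite /P (setIidr Eb).
have := @integral_ae_eq _ _ _ (@leb3 R) _ mB (cst 0%E) _ iB (measurable_cst _) h.
by apply: filterS => x H bx; have [] := H bx.
Qed.

Lemma open_cover_boxes (V : set (@R3 R)) x : open V -> V x ->
  exists q : (rat * rat * rat) * (rat * rat * rat),
    let a : @R3 R := (ratr q.1.1.1, ratr q.1.1.2, ratr q.1.2) in
    let b : @R3 R := (ratr q.2.1.1, ratr q.2.1.2, ratr q.2.2) in
    box3 a b x /\ cbox3 a b `<=` V.
Proof.
move=> oV Vx.
have [e /= e0 eV] : nbhs_ball x V by apply/nbhs_ballP; move: oV; rewrite openE; exact.
have H (y : R) : exists p q : rat, y - e < ratr p < y /\ y < ratr q < y + e.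
  have [|p] := @rat_in_itvoo R (y - e) y; first by rewrite gtrBl.
  have [|q] := @rat_in_itvoo R y (y + e); first by rewrite ltrDl.
  by rewrite !in_itv/= => ? ?; exists p, q.
have [p1 [q1 [/andP[? ?] /andP[? ?]]]] := H x.1.1.
have [p2 [q2 [/andP[? ?] /andP[? ?]]]] := H x.1.2.
have [p3 [q3 [/andP[? ?] /andP[? ?]]]] := H x.2.
exists ((p1, p2, p3), (q1, q2, q3)) => /=; split.
  by split; [split|]; rewrite /= ?in_itv/=; apply/andP.
move=> y [[]]; rewrite /= ?in_itv/= => /andP[? ?] /andP[? ?] /andP[? ?].
apply: eV; split; [split|]; rewrite /ball/= ltr_distlC; apply/andP; split;
  first [apply: lt_le_trans; eassumption | apply: le_lt_trans; eassumption].
Qed.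

(** Boxes with rational corners whose closed versions lie in V cover V, and there are countably
    many, so the exceptional sets of [box_ae0] have a null union. *)
Lemma ae0_of_test (V : set (@R3 R)) g : open V -> loc_integrable g ->
  (forall phi, Cinf_c V phi -> \int[@leb3 R]_x (g x * phi x) = 0) ->
  {ae leb3, forall x, V x -> g x = 0}.
Proof.
move=> oV ig gV.
pose a (q : (rat * rat * rat) * (rat * rat * rat)) : @R3 R :=
  (ratr q.1.1.1, ratr q.1.1.2, ratr q.1.2).
pose b (q : (rat * rat * rat) * (rat * rat * rat)) : @R3 R :=
  (ratr q.2.1.1, ratr q.2.1.2, ratr q.2.2).
pose N q := if `[< cbox3 (a q) (b q) `<=` V >]
  then ~` [set x | box3 (a q) (b q) x -> g x = 0] else set0.
have N0 q : (@leb3 R).-negligible (N q).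
  rewrite /N; case: asboolP => qV; last exact: negligible_set0.
  exact: box_ae0 ig gV qV.
have : (@leb3 R).-negligible (\bigcup_n oapp N set0 (unpickle n)).
  apply: negligible_bigcup => n; case: unpickle => [q|] //=; exact: negligible_set0.
apply: negligibleS => x /= /not_implyP[Vx gx].
have [q [bx qV]] := open_cover_boxes oV Vx.
have Nx : N q x by rewrite /N asboolT// => /(_ bx).
suff : (\bigcup_n oapp N set0 (unpickle n)) x by [].
move: (pickleK q); set n := pickle q => nq.
exists n; first exact: I.
by rewrite nq.
Qed.

End FundamentalLemma.

(** * Square-integrable functions on the whole space *)

Section L2.
Context {R : realType}.
Implicit Types (f g : @R3 R -> R) (d : @R3 R).

Definition int3 f := (@leb3 R).-integrable setT (EFin \o f).

Lemma int3_measurable f : int3 f -> measurable_fun setT f.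
Proof. by move=> /measurable_int/measurable_EFinP. Qed.

Lemma int3_le f g : measurable_fun setT f -> (forall x, `|f x| <= g x) -> int3 g -> int3 f.
Proof.
move=> mf fg ig; apply: (le_integrable _ _ _ ig) => //; first exact/measurable_EFinP.
by move=> x _ /=; rewrite lee_fin (le_trans (fg x))// ler_norm.
Qed.

Lemma int3D f g : int3 f -> int3 g -> int3 (fun x => f x + g x).
Proof. by move=> h1 h2; exact: integrableD h1 h2. Qed.

Lemma int3B f g : int3 f -> int3 g -> int3 (fun x => f x - g x).
Proof. by move=> h1 h2; exact: integrableB h1 h2. Qed.

Lemma int3Z (r : R) f : int3 f -> int3 (fun x => r * f x).
Proof. by move=> h; exact: integrableZl h. Qed.

Lemma int3_norm f : int3 f -> int3 (fun x => `|f x|).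
Proof. by move=> h; exact: (integrable_norm (D := setT)). Qed.

(** Replacing f by the minimum of f and g, which agrees with f almost everywhere, makes the
    inequality pointwise. *)
Lemma int3_ae_le f g : measurable_fun setT f -> int3 g -> int3 f -> 
  {ae leb3, forall x, f x <= g x} -> \int[@leb3 R]_x f x <= \int[@leb3 R]_x g x.
Proof.
move=> mf ig if_ fg.
pose N := [set x | ~ f x <= g x].
have -> : \int[@leb3 R]_x f x = \int[@leb3 R]_x (Num.min (f x) (g x)).
  congr fine; apply: ae_eq_integral => //.
  - exact/measurable_EFinP.
  - apply/measurable_EFinP; apply: measurable_minr => //; exact: int3_measurable.
  - by move: fg; apply: filterS => x fgx _ /=; rewrite min_l.
apply: le_Rintegral => // [|x _]; last by rewrite ge_min lexx orbT.
have mm : measurable_fun setT (fun x => Num.min (f x) (g x)).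
  by apply: measurable_minr => //; exact: int3_measurable.
have i2 : int3 (fun x => `|f x| + `|g x|).
  by apply: int3D; exact: int3_norm.
apply: (int3_le mm _ i2) => x; rewrite /Num.min; case: ifP => _.
  by rewrite lerDl.
by rewrite lerDr.
Qed.

Lemma Rint3D f g : int3 f -> int3 g ->
  \int[@leb3 R]_x (f x + g x) = \int[@leb3 R]_x f x + \int[@leb3 R]_x g x.
Proof. by move=> h1 h2; exact: RintegralD. Qed.

Lemma Rint3B f g : int3 f -> int3 g ->
  \int[@leb3 R]_x (f x - g x) = \int[@leb3 R]_x f x - \int[@leb3 R]_x g x.
Proof. by move=> h1 h2; exact: RintegralB. Qed.

Lemma Rint3Z (r : R) f : int3 f ->
  \int[@leb3 R]_x (r * f x) = r * \int[@leb3 R]_x f x.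
Proof. by move=> h; exact: RintegralZl. Qed.

Lemma Rint3_le f g : int3 f -> int3 g -> (forall x, f x <= g x) ->
  \int[@leb3 R]_x f x <= \int[@leb3 R]_x g x.
Proof. by move=> h1 h2 h; apply: le_Rintegral. Qed.

Lemma EFin_Rint3 f : int3 f ->
  ((\int[@leb3 R]_x f x)%:E = \int[@leb3 R]_x (f x)%:E)%E.
Proof. by move=> h; rewrite /Rintegral fineK//; exact: integrable_fin_num. Qed.

Lemma measurable_comp_shift f d : measurable_fun setT f ->
  measurable_fun setT (fun x : @R3 R => f (x + d)).
Proof. by move=> mf; apply: measurableT_comp mf (measurable_shift3 d). Qed.

Lemma int3_shift f d : int3 f -> int3 (fun x : @R3 R => f (x + d)).
Proof.
move=> /integrableP[/measurable_EFinP mf fi]; apply/integrableP; split.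
  by apply/measurable_EFinP; exact: (measurable_comp_shift d mf).
apply: le_lt_trans fi.
rewrite -(ge0_integral_leb3_shift d (f := fun x => `|(f x)%:E|%E))//.
exact/measurableT_comp/measurable_EFinP.
Qed.

Lemma Rint3_shift f d : int3 f ->
  \int[@leb3 R]_x f (x + d) = \int[@leb3 R]_x f x.
Proof.
move=> fi; have mf := int3_measurable fi.
rewrite /Rintegral; congr fine.
rewrite integralE [RHS]integralE; congr (_ - _)%E.
- have m : measurable_fun setT ((EFin \o f)^\+)%E.
    by apply: measurable_funepos; apply/measurable_EFinP.
  rewrite -(ge0_integral_leb3_shift d m); last by move=> x; exact: funepos_ge0.
  by apply: eq_integral => x _; rewrite !funeposE.
- have m : measurable_fun setT ((EFin \o f)^\-)%E.
    by apply: measurable_funeneg; apply/measurable_EFinP.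
  rewrite -(ge0_integral_leb3_shift d m); last by move=> x; exact: funeneg_ge0.
  by apply: eq_integral => x _; rewrite !funenegE.
Qed.

Definition L2f f := measurable_fun setT f /\ int3 (fun x => f x ^+ 2).
Definition n2 f := \int[@leb3 R]_x (f x ^+ 2).

Lemma n2_ge0 f : 0 <= n2 f.
Proof. by apply: Rintegral_ge0 => x _; exact: sqr_ge0. Qed.

Lemma L2f_le f g : measurable_fun setT f -> (forall x, `|f x| <= `|g x|) -> L2f g -> L2f f.
Proof.
move=> mf fg [mg ig]; split => //; apply: (int3_le _ _ ig).
  exact: measurable_funX.
by move=> x; rewrite normrX -[leRHS]real_normK ?num_real// lerXn2r ?nnegrE.
Qed.

Lemma n2_le f g : measurable_fun setT f -> (forall x, `|f x| <= `|g x|) -> L2f g ->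
  n2 f <= n2 g.
Proof.
move=> mf fg Lg; have [_ i1] := L2f_le mf fg Lg; have [_ i2] := Lg.
apply: Rint3_le => // x.
by rewrite -(real_normK (num_real (f x))) -(real_normK (num_real (g x))) lerXn2r ?nnegrE.
Qed.

Lemma int3M f g : L2f f -> L2f g -> int3 (fun x => f x * g x).
Proof.
move=> [mf i_f] [mg i_g]; apply: (int3_le (g := fun x => f x ^+ 2 + g x ^+ 2)).
- exact: measurable_funM.
- move=> x; rewrite normrM.
  rewrite -(real_normK (num_real (f x))) -(real_normK (num_real (g x))).
  have := sqr_ge0 (`|f x| - `|g x|); have := normr_ge0 (f x); have := normr_ge0 (g x).
  move: `|f x| `|g x| => u v; nra.
- exact: int3D.
Qed.

Lemma L2fD f g : L2f f -> L2f g -> L2f (fun x => f x + g x).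
Proof.
move=> Lf Lg; have i := int3M Lf Lg; case: Lf Lg => [mf i_f] [mg i_g]; split.
  exact: measurable_funD.
have -> : (fun x => (f x + g x) ^+ 2) = (fun x => (f x ^+ 2 + g x ^+ 2) + 2 * (f x * g x)).
  by apply/funext => x; ring.
by apply: int3D; [exact: int3D|exact: int3Z].
Qed.

Lemma L2fZ r f : L2f f -> L2f (fun x => r * f x).
Proof.
move=> [mf i_f]; split; first exact: measurable_funM.
have -> : (fun x => (r * f x) ^+ 2) = (fun x => r ^+ 2 * f x ^+ 2).
  by apply/funext => x; ring.
exact: int3Z.
Qed.

Lemma n2Z r f : L2f f -> n2 (fun x => r * f x) = r ^+ 2 * n2 f.
Proof.
move=> [mf i_f]; rewrite /n2 -Rint3Z//; congr Rintegral.
by apply/funext => x; ring.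
Qed.

Lemma L2fB f g : L2f f -> L2f g -> L2f (fun x => f x - g x).
Proof.
move=> Lf Lg; have -> : (fun x => f x - g x) = (fun x => f x + (-1) * g x).
  by apply/funext => x; ring.
by apply: L2fD => //; exact: L2fZ.
Qed.

Lemma L2f_shift f d : L2f f -> L2f (fun x : @R3 R => f (x + d)).
Proof.
by move=> [mf i_f]; split; [exact: measurable_comp_shift|exact: (int3_shift d i_f)].
Qed.

Lemma n2_shift f d : L2f f -> n2 (fun x : @R3 R => f (x + d)) = n2 f.
Proof. by move=> [mf i_f]; exact: (Rint3_shift d i_f). Qed.

Lemma n2D f g : L2f f -> L2f g -> n2 (fun x => f x + g x) <= 2 * n2 f + 2 * n2 g.
Proof.
move=> Lf Lg; have [_ h] := L2fD Lf Lg; case: Lf Lg => [mf i_f] [mg i_g].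
rewrite /n2 -!Rint3Z// -Rint3D//; [|exact: int3Z..].
apply: Rint3_le => //; first by apply: int3D; exact: int3Z.
by move=> x; have := sqr_ge0 (f x - g x); nra.
Qed.

Lemma L2f_cauchy_schwarz f g : L2f f -> L2f g ->
  (\int[@leb3 R]_x (f x * g x)) ^+ 2 <= n2 f * n2 g.
Proof.
move=> Lf Lg; set c := \int[_]_x _.
have H (a b : R) : 0 <= a ^+ 2 * n2 f + 2 * a * b * c + b ^+ 2 * n2 g.
  have i := int3M Lf Lg; case: (Lf) (Lg) => [mf i_f] [mg i_g].
  have -> : a ^+ 2 * n2 f + 2 * a * b * c + b ^+ 2 * n2 g =
      n2 (fun x => a * f x + b * g x).
    rewrite /n2 /c -!Rint3Z// -Rint3D; [|exact: int3Z..].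
    rewrite -Rint3D; [|by apply: int3D; exact: int3Z|exact: int3Z].
    by congr Rintegral; apply/funext => x; ring.
  exact: n2_ge0.
have := n2_ge0 f; have := n2_ge0 g; rewrite le_eqVlt => /predU1P[g0|g0] f0.
  rewrite -g0 mulr0; have [->|c0] := eqVneq c 0; first by rewrite expr0n.
  (* If g has norm zero and c is nonzero, this choice makes the quadratic form equal to n2 f - 2 (n2
     f + 1), which is negative. *)
  have := H 1 (- ((n2 f + 1) / c)); rewrite -g0 mulr0 addr0 expr1n !mul1r.
  have -> : 2 * 1 * - ((n2 f + 1) / c) * c = - 2 * (n2 f + 1) by field.
  by move=> ?; lra.
(* Here the quadratic form equals n2 g (n2 f n2 g - c^2). *)
have := H (n2 g) (- c); nra.
Qed.

Lemma L2f_loc f : L2f f -> loc_integrable f.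
Proof.
move=> [mf i_f] a b; have mC := measurable_cbox3 a b.
have i1 : (@leb3 R).-integrable (cbox3 a b) (EFin \o (fun x => 1 + f x ^+ 2)).
  have ic : (@leb3 R).-integrable (cbox3 a b) (EFin \o cst 1).
    apply/integrableP; split; first by apply/measurable_EFinP; exact: measurable_cst.
    by rewrite /= integral_cst//= normr1 mul1e; exact: leb3_box_lty.
  have i2 : (@leb3 R).-integrable (cbox3 a b) (EFin \o (fun x => f x ^+ 2)).
    exact: integrableS i_f.
  exact: integrableD ic i2.
apply: (le_integrable _ _ _ i1) => //.
  by apply/measurable_EFinP; exact: measurable_funTS.
move=> x _ /=; rewrite lee_fin [leRHS]ger0_norm; last by rewrite addr_ge0// sqr_ge0.
rewrite -(real_normK (num_real (f x))); move: `|f x| (normr_ge0 (f x)) => u u0; nra.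
Qed.

End L2.

(** * Averages along segments *)

Section Averages.
Context {R : realType}.
Implicit Types (f g : @R3 R -> R) (d : @R3 R).

Lemma measurable_pairr (x : @R3 R) : measurable_fun setT (fun t : R => (t, x)).
Proof. by apply: measurable_fun_pair; [exact: measurable_id|exact: measurable_cst]. Qed.

(** The inner integrals are real valued, and [fine] sends infinite values to 0. They agree with the
    extended integrals [G] and [H] only almost everywhere, so the identity is proved for these and
    then transferred. *)
Lemma Rfubini (F : R * @R3 R -> R) : measurable_fun setT F ->
  (\int[@leb R]_t \int[@leb3 R]_x `|(F (t, x))%:E| < +oo)%E ->
  [/\ \int[@leb3 R]_x \int[@leb R]_t F (t, x) = \int[@leb R]_t \int[@leb3 R]_x F (t, x),
      int3 (fun x => \int[@leb R]_t F (t, x)),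
      {ae leb3, forall x, (@leb R).-integrable setT (fun t => (F (t, x))%:E)} &
      (@leb R).-integrable setT (fun t => (\int[@leb3 R]_x F (t, x))%:E)].
Proof.
move=> mF FI.
have mEF : measurable_fun setT (EFin \o F) by exact/measurable_EFinP.
have i12 : ((@leb R) \x (@leb3 R))%E.-integrable setT (EFin \o F).
  exact/integrable12ltyP.
have ae2 : {ae leb3, forall x, (@leb R).-integrable setT (fun t => (F (t, x))%:E)}.
  exact: (ae_integrable2 i12).
have ae1 : {ae leb, forall t, (@leb3 R).-integrable setT (fun x => (F (t, x))%:E)}.
  exact: (ae_integrable1 i12).
pose G x := (\int[@leb R]_t (F (t, x))%:E)%E.
pose H t := (\int[@leb3 R]_x (F (t, x))%:E)%E.
have iG : (@leb3 R).-integrable setT G.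
  apply/integrableP; split; first exact: (measurable_fubini_G i12).
  have h21 := (@integrable21ltyP _ _ _ _ _ (@leb R) (@leb3 R) _ mEF).1 i12.
  apply: (le_lt_trans _ h21).
  have mabs : measurable_fun setT (fun tx => `|(EFin \o F) tx|)%E by exact: measurableT_comp.
  apply: ge0_le_integral => //.
  - by apply: measurableT_comp => //; exact: (measurable_fubini_G i12).
  - exact: (measurable_fun_fubini_tonelli_G (m1 := @leb R) (fun tx => `|(EFin \o F) tx|%E)).
  - move=> x _; apply: le_abse_integral => //.
    exact: (measurableT_comp mEF (measurable_pairr x)).
have iH : (@leb R).-integrable setT H by exact: (integrable_fubini_F i12).
have mG : measurable_fun setT G := measurable_int _ iG.
have mH : measurable_fun setT H := measurable_int _ iH.
have aeG : ae_eq (@leb3 R) setT (fun x => (\int[@leb R]_t F (t, x))%:E) G.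
  move: ae2; apply: filterS => x ix _; rewrite /Rintegral fineK//.
  exact: integrable_fin_num.
have aeH : ae_eq (@leb R) setT (fun t => (\int[@leb3 R]_x F (t, x))%:E) H.
  move: ae1; apply: filterS => x ix _; rewrite /Rintegral fineK//.
  exact: integrable_fin_num.
have mG' : measurable_fun setT (fun x => (\int[@leb R]_t F (t, x))%:E).
  by apply/measurable_EFinP; exact: measurableT_comp mG.
have mH' : measurable_fun setT (fun t => (\int[@leb3 R]_x F (t, x))%:E).
  by apply/measurable_EFinP; exact: measurableT_comp mH.
have iG' : int3 (fun x => \int[@leb R]_t F (t, x)).
  apply/integrableP; split => //.
  move/integrableP : iG => [_]; apply: le_lt_trans.
  rewrite le_eqVlt; apply/orP; left; apply/eqP; apply: ae_eq_integral => //.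
  - exact: measurableT_comp.
  - exact: measurableT_comp.
  - by move: aeG; apply: filterS => x K _; congr (abse _); exact: K.
split => //.
- rewrite /Rintegral.
  rewrite (@ae_eq_integral _ _ _ (@leb3 R) _ _ _ measurableT mG' mG aeG).
  rewrite (@ae_eq_integral _ _ _ (@leb R) _ _ _ measurableT mH' mH aeH).
  congr fine; rewrite /G /H.
  by have := Fubini i12.
- apply/integrableP; split => //.
  move/integrableP : iH => [_]; apply: le_lt_trans.
  rewrite le_eqVlt; apply/orP; left; apply/eqP; apply: ae_eq_integral => //.
  - exact: measurableT_comp.
  - exact: measurableT_comp.
  - by move: aeH; apply: filterS => x K _; congr (abse _); exact: K.
Qed.

(** A weight of total mass 1: averages over t in [0, 1] become integrals over the whole line, to
    which Fubini's theorem applies directly. *)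
Definition chi (t : R) : R := \1_`[0, 1] t.

Lemma chi_ge0 t : 0 <= chi t. Proof. by rewrite /chi indicE. Qed.

Lemma measurable_chi : measurable_fun setT chi.
Proof. exact: measurable_indic. Qed.

Lemma integral_chi : (\int[@leb R]_t (chi t)%:E = 1)%E.
Proof.
transitivity (@lebesgue_measure R `[0, 1]%classic).
  by rewrite /chi integral_indic// setIT.
by rewrite lebesgue_measure_itv/= lte_fin ltr01 oppr0 adde0.
Qed.

Lemma integrable_chi : (@leb R).-integrable setT (EFin \o chi).
Proof.
apply/integrableP; split; first by apply/measurable_EFinP; exact: measurable_chi.
under eq_integral do rewrite /= ger0_norm ?chi_ge0//.
by rewrite integral_chi ltry.
Qed.

Lemma measurable_line d :
  measurable_fun setT (fun tx : R * @R3 R => tx.2 + tx.1 *: d : @R3 R).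
Proof.
have m2 : measurable_fun setT (fun tx : R * @R3 R => tx.2) by exact: measurable_snd.
apply: measurable_fun_R3; apply: measurable_funD => /=.
- exact: (measurableT_comp measurable_coord11 m2).
- by apply: measurable_funM => //; exact: measurable_fst.
- exact: (measurableT_comp measurable_coord12 m2).
- by apply: measurable_funM => //; exact: measurable_fst.
- exact: (measurableT_comp measurable_coord2 m2).
- by apply: measurable_funM => //; exact: measurable_fst.
Qed.

(** When g is the derivative of f along d, this is the increment f (x + d) - f x. *)
Definition avg g d x : R := \int[@leb R]_t (chi t * g (x + t *: d)).

Lemma measurable_chi_line g d : measurable_fun setT g ->
  measurable_fun setT (fun tx : R * @R3 R => chi tx.1 * g (tx.2 + tx.1 *: d)).
Proof.
move=> mg; apply: measurable_funM.
  exact: (measurableT_comp measurable_chi measurable_fst).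
exact: (measurableT_comp mg (measurable_line d)).
Qed.

Lemma chi_line_fin g d : int3 g ->
  (\int[@leb R]_t \int[@leb3 R]_x `|(chi t * g (x + t *: d))%:E| < +oo)%E.
Proof.
move=> ig.
have -> : (\int[@leb R]_t \int[@leb3 R]_x `|(chi t * g (x + t *: d))%:E| =
    \int[@leb R]_t ((chi t)%:E * (\int[@leb3 R]_x `|g x|)%:E))%E.
  apply: eq_integral => t _.
  under eq_integral do rewrite /= normrM (ger0_norm (chi_ge0 t)) EFinM.
  have ig2 := int3_norm (int3_shift (t *: d) ig).
  rewrite ge0_integralZl//; last 2 first.
  - by apply/measurable_EFinP; exact: int3_measurable ig2.
  - by rewrite lee_fin chi_ge0.
  rewrite -(EFin_Rint3 ig2); congr (_ * _%:E)%E.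
  exact: (Rint3_shift (t *: d) (int3_norm ig)).
rewrite ge0_integralZr//.
- by rewrite integral_chi mul1e ltry.
- by apply/measurable_EFinP; exact: measurable_chi.
- by move=> t _; rewrite lee_fin chi_ge0.
- by rewrite lee_fin; apply: Rintegral_ge0.
Qed.

Lemma Rint_chi_cst (c : R) : \int[@leb R]_t (chi t * c) = c.
Proof.
rewrite RintegralZr//; last exact: integrable_chi.
by rewrite /Rintegral integral_chi mul1r.
Qed.

Lemma avg_int3 g d : int3 g ->
  [/\ int3 (avg g d), \int[@leb3 R]_x avg g d x = \int[@leb3 R]_x g x &
   {ae leb3, forall x, (@leb R).-integrable setT (fun t => (chi t * g (x + t *: d))%:E)}].
Proof.
move=> ig.
have [E i2 ae _] := Rfubini (measurable_chi_line d (int3_measurable ig)) (chi_line_fin d ig).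
split => //; rewrite [LHS]E /=.
transitivity (\int[@leb R]_t (chi t * \int[@leb3 R]_x g x)); last exact: Rint_chi_cst.
apply: eq_Rintegral => t _; rewrite Rint3Z; last exact: int3_shift.
by rewrite Rint3_shift.
Qed.

Lemma integrable_chi_sqr (h : R -> R) : measurable_fun setT h ->
  (@leb R).-integrable setT (fun t => (chi t * h t ^+ 2)%:E) ->
  (@leb R).-integrable setT (fun t => (chi t * h t)%:E).
Proof.
move=> mh i2.
have i3 : (@leb R).-integrable setT (EFin \o (fun t => chi t + chi t * h t ^+ 2)).
  exact: integrableD integrable_chi i2.
apply: (le_integrable _ _ _ i3) => //.
  by apply/measurable_EFinP; apply: measurable_funM => //; exact: measurable_chi.
move=> t _ /=; rewrite lee_fin normrM (ger0_norm (chi_ge0 t)).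
rewrite [leRHS]ger0_norm; last first.
  by apply: addr_ge0; [exact: chi_ge0|apply: mulr_ge0; [exact: chi_ge0|exact: sqr_ge0]].
have := chi_ge0 t; rewrite -(real_normK (num_real (h t))).
move: `|h t| (normr_ge0 (h t)) (chi t) => u u0 c c0.
rewrite -subr_ge0 [X in 0 <= X](_ : _ = c * ((u - 2^-1) ^+ 2 + 3 / 4)); last by field.
by apply: mulr_ge0 => //; have := sqr_ge0 (u - 2^-1); lra.
Qed.

(** Jensen's inequality for the probability density [chi], obtained from the nonnegativity of the
    variance about the mean m. *)
Lemma sqr_Rint_chi (h : R -> R) : 
  measurable_fun setT h ->
  (@leb R).-integrable setT (fun t => (chi t * h t ^+ 2)%:E) ->
  (\int[@leb R]_t (chi t * h t)) ^+ 2 <= \int[@leb R]_t (chi t * h t ^+ 2).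
Proof.
move=> mh i2.
have i1 := integrable_chi_sqr mh i2.
set m := \int[@leb R]_t (chi t * h t).
have : 0 <= \int[@leb R]_t (chi t * (h t - m) ^+ 2).
  by apply: Rintegral_ge0 => t _; rewrite mulr_ge0 ?chi_ge0 ?sqr_ge0.
have -> : \int[@leb R]_t (chi t * (h t - m) ^+ 2) =
    \int[@leb R]_t ((chi t * h t ^+ 2 - (2 * m) * (chi t * h t)) + m ^+ 2 * chi t).
  by apply: eq_Rintegral => t _; ring.
have ia : (@leb R).-integrable setT (EFin \o (fun t => 2 * m * (chi t * h t))).
  exact: integrableZl i1.
have ib : (@leb R).-integrable setT (EFin \o (fun t => m ^+ 2 * chi t)).
  exact: integrableZl integrable_chi.
have ic : (@leb R).-integrable setT (EFin \o (fun t => chi t * h t ^+ 2 - 2 * m * (chi t * h t))).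
  exact: integrableB i2 ia.
rewrite RintegralD// RintegralB// RintegralZl// RintegralZl//; last exact: integrable_chi.
rewrite -/m; have -> : \int[@leb R]_t chi t = 1 by rewrite /Rintegral integral_chi.
by nra.
Qed.

(** Jensen's inequality in t and translation invariance in x. Since g is only square integrable,
    measurability in x is not read off Fubini's theorem for g; it comes from the positive and
    negative parts by Tonelli. *)
Lemma L2_avg g d : L2f g -> L2f (avg g d) /\ n2 (avg g d) <= n2 g.
Proof.
move=> [mg ig].
have mavg : measurable_fun setT (avg g d).
  have mF := measurable_chi_line d mg.
  pose G (tx : R * @R3 R) := (chi tx.1 * g (tx.2 + tx.1 *: d))%:E.
  have mEF : measurable_fun setT G by exact/measurable_EFinP.
  have -> : avg g d = (fun x => fine (\int[@leb R]_t (G^\+ (t, x)) -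
     \int[@leb R]_t (G^\- (t, x)))%E).
    apply/funext => x; rewrite /avg /Rintegral; congr fine; rewrite integralE.
    by congr (_ - _)%E; apply: eq_integral => t _; rewrite ?funeposE ?funenegE.
  apply: measurableT_comp => //; apply: emeasurable_funB.
    apply: (measurable_fun_fubini_tonelli_G (m1 := @leb R)).
      exact: measurable_funepos.
    by move=> x; exact: funepos_ge0.
  apply: (measurable_fun_fubini_tonelli_G (m1 := @leb R)).
    exact: measurable_funeneg.
  by move=> x; exact: funeneg_ge0.
have [iB EB aeB] := avg_int3 d ig.
have le : {ae leb3, forall x, avg g d x ^+ 2 <= avg (fun x => g x ^+ 2) d x}.
  move: aeB; apply: filterS => x ix; apply: sqr_Rint_chi => //.
  apply: (measurableT_comp mg).
  exact: (measurableT_comp (measurable_line d) (measurable_pairr x)).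
have mavg2 : measurable_fun setT (fun x => avg g d x ^+ 2) by exact: measurable_funX.
have i2 : int3 (fun x => avg g d x ^+ 2).
  apply/integrableP; split; first exact/measurable_EFinP.
  move/integrableP : iB => [mB]; apply: le_lt_trans.
  apply: ae_ge0_le_integral => //.
  - exact/measurableT_comp/measurable_EFinP.
  - exact/measurableT_comp.
  - move: le; apply: filterS => x lex _; rewrite lee_fin ger0_norm ?sqr_ge0//.
    by rewrite (le_trans lex)// ler_norm.
split=> //; rewrite /n2 -EB.
exact: int3_ae_le.
Qed.

(** Fubini's theorem and, for each t, a translation by t d carry the average from g to z. The
    integrability that Fubini asks for comes from |g z| <= g^2 + z^2. *)
Lemma avg_test g z d : L2f g -> L2f z ->
  \int[@leb3 R]_x (avg g d x * z x) =
  \int[@leb R]_t (chi t * \int[@leb3 R]_y (g y * z (y - t *: d))) /\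
  (@leb R).-integrable setT (fun t => (chi t * \int[@leb3 R]_y (g y * z (y - t *: d)))%:E).
Proof.
move=> Lg Lz; have [[mg ig] [mz iz]] := (Lg, Lz).
pose F (tx : R * @R3 R) := (chi tx.1 * g (tx.2 + tx.1 *: d)) * z tx.2.
have mF : measurable_fun setT F.
  apply: measurable_funM; first exact: measurable_chi_line.
  exact: (measurableT_comp mz measurable_snd).
have Lgs t : L2f (fun x : @R3 R => g (x + t *: d)) by exact: L2f_shift.
have FI : (\int[@leb R]_t \int[@leb3 R]_x `|(F (t, x))%:E| < +oo)%E.
  apply: (@le_lt_trans _ _ (\int[@leb R]_t (chi t * (n2 g + n2 z))%:E)%E); last first.
    under eq_integral do rewrite EFinM.
    rewrite ge0_integralZr//.
    - by rewrite integral_chi mul1e ltry.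
    - by apply/measurable_EFinP; exact: measurable_chi.
    - by move=> t _; rewrite lee_fin chi_ge0.
    - by rewrite lee_fin addr_ge0 ?n2_ge0.
  have mabs : measurable_fun setT (fun tx => `|(F tx)%:E|)%E.
    by apply: measurableT_comp => //; apply/measurable_EFinP.
  apply: ge0_le_integral => //.
  - by move=> t _; apply: integral_ge0.
  - exact: (measurable_fun_fubini_tonelli_F (m2 := @leb3 R) (fun tx => `|(F tx)%:E|%E)).
  - by apply/measurable_EFinP/measurable_funM => //; exact: measurable_chi.
  move=> t _; have i1 := int3_norm (int3Z (chi t) (int3M (Lgs t) Lz)).
  have -> : (\int[@leb3 R]_x `|(F (t, x))%:E| =
      (\int[@leb3 R]_x `|chi t * (g (x + t *: d) * z x)|)%:E)%E.
    by rewrite EFin_Rint3//; apply: eq_integral => x _; rewrite /F /= mulrA.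
  rewrite lee_fin -(n2_shift (t *: d) Lg) /n2.
  have [_ ig2] := Lgs t.
  rewrite -Rint3D// -Rint3Z; last exact: int3D.
  apply: Rint3_le => //; first by apply: int3Z; exact: int3D.
  move=> x; rewrite normrM (ger0_norm (chi_ge0 t)) ler_wpM2l ?chi_ge0// normrM.
  rewrite -(real_normK (num_real (g _))) -(real_normK (num_real (z _))).
  have := sqr_ge0 (`|g (x + t *: d)| - `|z x|).
  have := normr_ge0 (g (x + t *: d)); have := normr_ge0 (z x).
  move: `|g _| `|z x| => u v; nra.
have [E _ _ iE] := Rfubini mF FI.
have H t : \int[@leb3 R]_x F (t, x) = chi t * \int[@leb3 R]_y (g y * z (y - t *: d)).
  have i1 := int3M Lg (L2f_shift (- (t *: d)) Lz).
  rewrite -(Rint3_shift (t *: d) i1) -Rint3Z; last exact: (int3_shift (t *: d) i1).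
  by apply: eq_Rintegral => x _; rewrite /F /= addrK mulrA.
split; last first.
  by apply: eq_integrable iE => // t _; rewrite H.
transitivity (\int[@leb3 R]_x \int[@leb R]_t F (t, x)); last first.
  by rewrite E; apply: eq_Rintegral => t _; rewrite H.
have [Lavg _] := L2_avg d Lg.
have [_ iF _ _] := Rfubini mF FI.
rewrite /Rintegral; congr fine; apply: ae_eq_integral => //.
- by apply/measurable_EFinP; exact: int3_measurable (int3M Lavg Lz).
- exact: measurable_int iF.
have [_ _ ae] := avg_int3 d ig.
move: ae; apply: filterS => x ix _; congr EFin.
rewrite /avg -RintegralZr//.
apply: integrable_chi_sqr ix; apply: (measurableT_comp mg).
exact: (measurableT_comp (measurable_line d) (measurable_pairr x)).
Qed.


End Averages.

(** * Directional derivatives: mean values and linearity in the direction *)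

Section DirectionalDerivative.
Context {R : realType} {V : normedModType R}.
Implicit Types (f : V -> R) (x u v : V).

Lemma is_derive_line f x v (t : R) : derivable f (x + t *: v) v ->
  is_derive t (1 : R) (fun t : R => f (x + t *: v)) ('D_v f (x + t *: v)).
Proof.
move=> df.
have E : (fun h : R => h^-1 *: ((f (x + (h *: (1 : R) + t) *: v)) - f (x + t *: v))) =
    (fun h : R => h^-1 *: (f (h *: v + (x + t *: v)) - f (x + t *: v))).
  apply/funext => h; congr (_ *: (f _ - _)).
  by rewrite -[h *: 1]/(h * 1) mulr1 scalerDl addrCA.
apply: DeriveDef; first by rewrite /derivable /= E.
by rewrite /derive /= E.
Qed.

(** The mean value theorem is applied on [0, 1] to t -> f (x + t h v), so that h may have either
    sign. *)
Lemma derive_line_mvt f x v (h : R) : (forall y, derivable f y v) -> 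
  (exists2 t, 0 <= t <= 1 & f (x + h *: v) - f x = h * 'D_v f (x + (t * h) *: v)).
Proof.
move=> df.
have D1 y : is_derive y (1 : R) (fun t : R => f (x + t *: (h *: v)))
    (h * 'D_v f (x + y *: (h *: v))).
  rewrite scalerA.
  have -> : (fun t : R => f (x + t *: (h *: v))) = (fun t : R => f (x + t *: v)) \o (fun t => t * h).
    by apply/funext => t /=; rewrite scalerA.
  rewrite mulrC; apply: is_derive1_comp.
    exact: (is_derive_line (df _)).
  have dM := is_deriveM (is_derive_id y (1 : R)) (is_derive_cst h y (1 : R)).
  by apply: (is_derive_eq dM); rewrite scaler0 add0r -[_ *: _]/(h * 1) mulr1.
have A1 (y : R) : y \in `]0, 1[%R -> is_derive y (1 : R) (fun t : R => f (x + t *: (h *: v)))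
    (h * 'D_v f (x + y *: (h *: v))) by move=> _; exact: D1.
have A2 : {within `[0, 1], continuous (fun t : R => f (x + t *: (h *: v)))}.
  by apply: derivable_within_continuous => y _; have [] := D1 y.
have [c] := MVT_segment ler01 A1 A2.
rewrite in_itv /= => c01.
rewrite scale1r scale0r addr0 subr0 mulr1 => E; exists c => //.
by rewrite E scalerA.
Qed.

Lemma derive_scaledir f x v (c : R) : derivable f x v -> 'D_(c *: v) f x = c * 'D_v f x.
Proof.
move=> df.
have := @is_derive_line f x v 0; rewrite scale0r addr0 => /(_ df) [D1 D2].
have [c1 c2] := derive_scale c D1.
have -> : 'D_(c *: v) f x = 'D_c (fun t : R => f (x + t *: v)) 0.
  rewrite /derive; do 2 f_equal; apply/funext => h /=; congr (_ *: (f _ - f _)).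
    by rewrite addr0 -[h *: c]/(h * c) scalerA addrC.
  by rewrite scale0r addr0.
by rewrite c2 derive1E D2.
Qed.

(** [Ck] speaks of directional derivatives only, so additivity has to be earned: the increment along
    v is taken at the moving point x + h u, written by the mean value theorem as h times a value of
    ['D_v f] near x, and continuity of that derivative gives the limit. *)
Lemma derive_adddir f x u v : Ck 1 setT f -> 'D_(u + v) f x = 'D_u f x + 'D_v f x.
Proof.
move=> Cf.
have df w y : derivable f y w by exact: Ck_derivable Cf.
have cv : continuous ('D_v f) by exact/(@Ck_continuous _ _ 0)/Ck_derive.
apply: cvg_lim => //=.
have -> : (fun h : R => h^-1 *: (f (h *: (u + v) + x) - f x)) =
    (fun h : R => h^-1 *: (f (h *: u + x) - f x) +
       h^-1 *: (f (h *: (u + v) + x) - f (h *: u + x))).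
  by apply/funext => h; rewrite -scalerDr; congr (_ *: _); ring.
apply: cvgD; first exact: df.
apply/cvgrPdist_le => e e0.
have /cvgr_dist_le /(_ _ e0) /nbhs_ballP [r /= r0 hr] := cv x.
near=> h.
have h0 : h != 0 by near: h; exact: nbhs_dnbhs_neq.
have [t t01] := derive_line_mvt (h *: u + x) h (df v).
rewrite -addrA [x + h *: v]addrC addrA -scalerDr => ->.
rewrite -[_^-1 *: _]/(_^-1 * _) mulrA mulVf// mul1r.
apply: hr; rewrite -ball_normE /ball_/=.
have -> : x - (h *: u + x + (t * h) *: v) = - (h *: u + (t * h) *: v).
  by rewrite [h *: u + x]addrC -addrA opprD addrA subrr add0r.
rewrite normrN.
have [t0 t1] := andP t01.
apply: (@le_lt_trans _ _ (`|h| * (`|u| + `|v|))).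
  rewrite mulrDr; apply: (le_trans (ler_normD _ _)); rewrite !normrZ; apply: lerD => //.
  by rewrite ler_wpM2r// ler_piMl// ger0_norm.
apply: (@le_lt_trans _ _ (`|h| * (`|u| + `|v| + 1))).
  by rewrite ler_wpM2l// lerDl.
rewrite -ltr_pdivlMr; last by rewrite ltr_wpDl// addr_ge0.
near: h; apply: dnbhs0_lt; rewrite divr_gt0// ltr_wpDl// addr_ge0.
Unshelve. all: by end_near.
Qed.

End DirectionalDerivative.

(** * Test functions: stability, bounds and increments *)

Section TestFunctions.
Context {R : realType}.
Implicit Types (U V : set (@R3 R)) (phi : @R3 R -> R) (d v x : @R3 R).

Lemma Cinf_c_Ck U phi n : Cinf_c U phi -> Ck n setT phi.
Proof. by move=> /(_ n)[]. Qed.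

Lemma Cinf_c_derive U v phi : Cinf_c U phi -> Cinf_c U ('D_v phi).
Proof.
move=> C n; split; first by apply: Ck_derive; exact: (Cinf_c_Ck n.+1 C).
have [_ [K1 K2]] := C 0.
have sub : [set x | 'D_v phi x != 0] `<=` closure [set x | phi x != 0].
  move=> x /= Dx; apply: contrapT => nx; move/negP: Dx; apply; apply/eqP.
  have oC : open (~` closure [set x | phi x != 0]).
    by apply: closed_openC; exact: closed_closure.
  rewrite (near_eq_derive (g := cst 0)); first exact: derive_cst.
  have : nbhs x (~` closure [set x | phi x != 0]) by apply: open_nbhs_nbhs; split.
  apply: filterS => y ny /=; apply/eqP; apply: contra_notT ny => ny.
  exact: subset_closure.
have sub2 : closure [set x | 'D_v phi x != 0] `<=` closure [set x | phi x != 0].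
  rewrite [X in _ `<=` X](closure_id _).1; last exact: closed_closure.
  exact: closureS.
split; last exact: subset_trans K2.
by apply: subclosed_compact K1 _ => //; exact: closed_closure.
Qed.

Lemma Cinf_c_shift U V d phi : Cinf_c V phi -> (forall x, V x -> U (x + d)) ->
  Cinf_c U (fun x => phi (x - d)).
Proof.
move=> C VU n; split; first by apply: Ck_shift; exact: (Cinf_c_Ck n C).
have [_ [K1 K2]] := C 0.
have cs : continuous (fun x : @R3 R => x - d).
  by move=> x; apply: continuousB; [exact: cvg_id|exact: cst_continuous].
have cs' : continuous (fun x : @R3 R => x + d).
  by move=> x; apply: continuousD; [exact: cvg_id|exact: cst_continuous].
have sub : closure [set x | phi (x - d) != 0] `<=` (fun x => x + d) @` closure [set x | phi x != 0].
  have -> : (fun x => x + d) @` closure [set x | phi x != 0] =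
      (fun x => x - d) @^-1` closure [set x | phi x != 0].
    apply/seteqP; split => [_ [x + <-]|x xC] /=; first by rewrite addrK.
    by exists (x - d) => //; rewrite subrK.
  rewrite [X in _ `<=` X](closure_id _).1.
    by apply: closureS => x /= h; exact: subset_closure.
  by apply: closed_comp; [move=> x _; exact: cs|exact: closed_closure].
split.
  apply: (@subclosed_compact _ _ ((fun x => x + d) @` closure [set x | phi x != 0])) => //.
    exact: closed_closure.
  apply: continuous_compact => //.
  by apply: continuous_subspaceT => x; exact: cs'.
by move=> x /sub[y yC <-]; apply: VU; exact: K2.
Qed.

Lemma compact_cbox (K : set (@R3 R)) : compact K -> exists a b, K `<=` cbox3 a b.
Proof.
move=> /compact_bounded[M [_ hM]].
pose c := M + 1; have hc := hM c (ltr_pwDr ltr01 (lexx M)).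
exists (- c, - c, - c), (c, c, c) => x /hc.
rewrite /cbox3 /= !prod_normE /= !ge_max => /andP[/andP[]].
by rewrite !ler_norml => h1 h2 h3; split; [split|]; rewrite /= in_itv.
Qed.

Lemma Cinf_c_box U phi : Cinf_c U phi ->
  exists a b, forall x, ~ cbox3 a b x -> phi x = 0.
Proof.
move=> /(_ 0)[_ [K _]]; have [a [b ab]] := compact_cbox K.
exists a, b => x nx; apply/eqP; apply: contra_notT nx => nx; apply: ab.
exact: subset_closure.
Qed.

Lemma Cinf_c_bounded U phi : Cinf_c U phi -> exists2 M, 0 <= M & forall x, `|phi x| <= M.
Proof.
move=> C; have [a [b ab]] := Cinf_c_box C.
have cp := Ck_continuous (Cinf_c_Ck 0 C).
have /compact_bounded[M [_ hM]] : compact (phi @` cbox3 a b).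
  by apply: continuous_compact; [exact: continuous_subspaceT|exact: compact_cbox3].
exists (`|M| + 1); first by rewrite addr_ge0.
move=> x; have [bx|/ab ->] := pselect (cbox3 a b x); last by rewrite normr0 addr_ge0.
by apply: (hM (`|M| + 1)); [rewrite ltr_pwDr// ler_norm|exists x].
Qed.

Lemma bounded_support_int3 (f : @R3 R -> R) (M : R) a b : measurable_fun setT f ->
  (forall x, `|f x| <= M) -> (forall x, ~ cbox3 a b x -> f x = 0) -> int3 f.
Proof.
move=> mf fM fab.
have mC : measurable (cbox3 a b) := measurable_cbox3 a b.
apply: (int3_le (g := fun x => M * \1_(cbox3 a b) x)) => //.
  move=> x; rewrite indicE; case: (boolP (x \in _)) => [_|]; first by rewrite mulr1.
  by rewrite notin_setE => /fab ->; rewrite normr0 mulr0.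
apply: int3Z; apply/integrableP; split.
  by apply/measurable_EFinP; exact: measurable_indic.
under eq_integral do rewrite /= ger0_norm//.
by rewrite integral_indic// setIT; exact: leb3_box_lty.
Qed.

Lemma bounded_support_L2f (f : @R3 R -> R) (M : R) a b : measurable_fun setT f ->
  (forall x, `|f x| <= M) -> (forall x, ~ cbox3 a b x -> f x = 0) -> L2f f.
Proof.
move=> mf fM fab; split => //.
apply: (@bounded_support_int3 _ (M ^+ 2) a b).
- exact: measurable_funX.
- by move=> x; rewrite normrX lerXn2r ?nnegrE// (le_trans _ (fM x)).
- by move=> x /fab ->; rewrite expr0n.
Qed.

Lemma Cinf_c_L2f U phi : Cinf_c U phi -> L2f phi.
Proof.
move=> C; have [a [b ab]] := Cinf_c_box C; have [M _ hM] := Cinf_c_bounded C.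
exact: bounded_support_L2f (Ck_measurable (Cinf_c_Ck 0 C)) hM ab.
Qed.

(** The fundamental theorem of calculus on the segment from x to x + d; [wd_shift] carries it over
    to weak derivatives by duality. *)
Lemma avg_derive U phi d x : Cinf_c U phi -> avg ('D_d phi) d x = phi (x + d) - phi x.
Proof.
move=> C.
have dphi y : derivable phi y d by have := Cinf_c_Ck 1 C; exact: Ck_derivable.
have D1 (t : R) := is_derive_line (dphi (x + t *: d)).
have cD : continuous (fun t : R => 'D_d phi (x + t *: d)).
  move=> t; apply: (@continuous_comp _ _ _ (fun t : R => x + t *: d) ('D_d phi)).
    by apply: continuousD; [exact: cst_continuous|exact: scalel_continuous].
  by have := Ck_continuous (Cinf_c_Ck 0 (Cinf_c_derive d C)); apply.
have := @continuous_FTC2 R (fun t : R => 'D_d phi (x + t *: d))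
  (fun t : R => phi (x + t *: d)) 0 1 ltr01.
rewrite scale1r scale0r addr0 => H.
have E : (\int[@leb R]_(t in `[0%R, 1%R]) ('D_d phi (x + t *: d))%:E =
    (phi (x + d))%:E - (phi x)%:E)%E.
  apply: H.
  - exact: continuous_subspaceT.
  - have cF : continuous (fun t : R => phi (x + t *: d)).
      by move=> t; apply/differentiable_continuous/derivable1_diffP; have [] := D1 t.
    split; first by move=> t _; have [] := D1 t.
    + exact: cvg_at_right_filter (cF 0).
    + exact: cvg_at_left_filter (cF 1).
  - by move=> t _; rewrite derive1E; have [] := D1 t.
rewrite /avg /Rintegral.
rewrite -[RHS]/(fine ((phi (x + d))%:E - (phi x)%:E)%E) -E; congr fine.
rewrite [RHS]integral_mkcond; apply: eq_integral => t _.
rewrite patchE /chi indicE; case: ifP => _; first by rewrite mul1r.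
by rewrite mul0r.
Qed.

End TestFunctions.

(** * Weak derivatives and translates *)

Section WeakDerivative.
Context {R : realType}.
Implicit Types (U V : set (@R3 R)) (f g : @R3 R -> R) (d v x : @R3 R).

(** Functions are defined on the whole space and U only restricts the test functions, so that the
    integrals can be translated. [wderiv_wd] and [wd_wderiv] relate this to [wderiv] through
    extension by zero. *)
Definition wd U v f g := forall phi, Cinf_c U phi ->
  \int[@leb3 R]_x (f x * 'D_v phi x) = - \int[@leb3 R]_x (g x * phi x).

Lemma wdD U u v f g h : L2f f -> L2f g -> L2f h -> wd U u f g -> wd U v f h ->
  wd U (u + v) f (fun x => g x + h x).
Proof.
move=> Lf Lg Lh wg wh phi C.
have Lphi := Cinf_c_L2f C.
transitivity (\int[@leb3 R]_x (f x * 'D_u phi x + f x * 'D_v phi x)).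
  apply: eq_Rintegral => x _; rewrite derive_adddir ?mulrDr//.
  exact: Cinf_c_Ck C.
rewrite Rint3D; last 2 first.
- by apply: int3M => //; exact: Cinf_c_L2f (Cinf_c_derive u C).
- by apply: int3M => //; exact: Cinf_c_L2f (Cinf_c_derive v C).
rewrite wg// wh// -opprD -Rint3D; [|exact: int3M..].
by congr (- _); apply: eq_Rintegral => x _; rewrite mulrDl.
Qed.

Lemma wdZ U v (c : R) f g : L2f f -> L2f g -> wd U v f g ->
  wd U (c *: v) f (fun x => c * g x).
Proof.
move=> Lf Lg wg phi C.
have Lphi := Cinf_c_L2f C.
transitivity (\int[@leb3 R]_x (c * (f x * 'D_v phi x))).
  apply: eq_Rintegral => x _; rewrite derive_scaledir 1?mulrCA//.
  by have := Cinf_c_Ck 1 C; exact: Ck_derivable.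
rewrite Rint3Z; last by apply: int3M => //; exact: Cinf_c_L2f (Cinf_c_derive v C).
rewrite wg// mulrN -Rint3Z; last exact: int3M.
by congr (- _); apply: eq_Rintegral => x _; rewrite mulrA.
Qed.

Lemma derive_shiftE (phi : @R3 R -> R) v a x :
  'D_v (fun y : @R3 R => phi (y + a)) x = 'D_v phi (x + a).
Proof.
by rewrite /derive; do 2 f_equal; apply/funext => h /=; rewrite addrA.
Qed.

Lemma integrable_chi_bounded (h : R -> R) (M : R) : measurable_fun setT h ->
  (forall t, `|h t| <= M) -> (@leb R).-integrable setT (fun t => (chi t * h t)%:E).
Proof.
move=> mh hM.
have i : (@leb R).-integrable setT (EFin \o (fun t => M * chi t)).
  exact: integrableZl integrable_chi.
apply: (le_integrable _ _ _ i) => //.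
  by apply/measurable_EFinP; apply: measurable_funM => //; exact: measurable_chi.
move=> t _ /=; rewrite lee_fin normrM (ger0_norm (chi_ge0 t)) mulrC.
rewrite normrM (ger0_norm (chi_ge0 t)) ler_wpM2r ?chi_ge0//.
by rewrite (le_trans (hM t))// ler_norm.
Qed.

Lemma wd_shift U V d f g : open V -> L2f f -> L2f g -> wd U d f g ->
  (forall x t, V x -> 0 <= t <= 1 -> U (x + t *: d)) ->
  {ae leb3, forall x, V x -> f (x + d) - f x = avg g d x}.
Proof.
move=> oV Lf Lg wg VU.
have [Lavg _] := L2_avg d Lg.
have Ls := L2f_shift d Lf.
have LF : L2f (fun x => f (x + d) - f x - avg g d x) by apply: L2fB => //; exact: L2fB.
have := ae0_of_test oV (L2f_loc LF).
move=> H; have {H}: {ae leb3, forall x, V x -> f (x + d) - f x - avg g d x = 0}; last first.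
  by apply: filterS => x h Vx; apply/eqP; rewrite -subr_eq0 h.
apply: H => phi C.
have Lphi := Cinf_c_L2f C.
have CD := Cinf_c_derive d C.
have LD := Cinf_c_L2f CD.
have E1 : \int[@leb3 R]_x (f (x + d) * phi x) = \int[@leb3 R]_x (f x * phi (x - d)).
  have i := int3M Lf (L2f_shift (- d) Lphi).
  by rewrite -(Rint3_shift d i); apply: eq_Rintegral => x _; rewrite /= addrK.
have E2 : \int[@leb3 R]_x (avg g d x * phi x) =
    - \int[@leb3 R]_x (avg ('D_d phi) (- d) x * f x).
  have [-> _] := avg_test d Lg Lphi.
  have [-> i2] := avg_test (- d) LD Lf.
  rewrite -[RHS]mulN1r -RintegralZl//; apply: eq_Rintegral => t _.
  rewrite /chi indicE; case: (boolP (t \in _)) => [|_]; last by rewrite !mul0r mulr0.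
  rewrite inE/= in_itv/= => t01; rewrite !mul1r mulN1r.
  have Ct : Cinf_c U (fun y => phi (y - t *: d)).
    by apply: Cinf_c_shift C _ => x Vx; exact: VU.
  have := wg _ Ct => /(congr1 -%R); rewrite opprK => <-; congr (- _).
  have i3 := int3M Lf (L2f_shift (- (t *: d)) LD).
  transitivity (\int[@leb3 R]_x (f x * 'D_d phi (x - t *: d))).
    by apply: eq_Rintegral => x _; rewrite derive_shiftE.
  rewrite -(Rint3_shift (t *: d) i3).
  apply: eq_Rintegral => x _; rewrite addrK mulrC.
  by rewrite scalerN opprK.
have E3 x : avg ('D_d phi) (- d) x = phi x - phi (x - d).
  have := avg_derive (- d) x C.
  have -> : 'D_(- d) phi = (fun x => (-1) * 'D_d phi x).
    apply/funext => y; rewrite -scaleN1r derive_scaledir//.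
    by have := Cinf_c_Ck 1 C; exact: Ck_derivable.
  move=> /(congr1 -%R); rewrite opprB => <-; rewrite /avg -[RHS]mulN1r -RintegralZl//.
    by apply: eq_Rintegral => t _; ring.
  have [M _ hM] := Cinf_c_bounded CD.
  apply: (@integrable_chi_bounded _ M).
    apply: measurable_funM; first exact: measurable_cst.
    apply: (measurableT_comp LD.1).
    exact: (measurableT_comp (measurable_line (- d)) (measurable_pairr x)).
  by move=> t; rewrite mulN1r normrN.
transitivity (\int[@leb3 R]_x (f (x + d) * phi x) - \int[@leb3 R]_x (f x * phi x)
    - \int[@leb3 R]_x (avg g d x * phi x)).
  have i1 := int3M Ls Lphi; have i2 := int3M Lf Lphi; have i3 := int3M Lavg Lphi.
  rewrite -Rint3B// -Rint3B//; last exact: int3B.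
  by apply: eq_Rintegral => x _; ring.
rewrite E1 E2.
have i2 := int3M Lf Lphi.
have i4 := int3M Lf (L2f_shift (- d) Lphi).
have -> : \int[@leb3 R]_x (avg ('D_d phi) (- d) x * f x) =
   \int[@leb3 R]_x (f x * phi x) - \int[@leb3 R]_x (f x * phi (x - d)).
  by rewrite -Rint3B//; apply: eq_Rintegral => x _; rewrite E3; ring.
ring.
Qed.

End WeakDerivative.

(** * Increments averaged over small cubes *)

Section CubeAverages.
Context {R : realType}.
Implicit Types (U V : set (@R3 R)) (f g w : @R3 R -> R) (d v x z : @R3 R)
  (G : 'I_3 -> @R3 R -> R).

Definition wgr U f G := forall i, wd U (ev i) f (G i).
Definition en G : R := \sum_(i < 3) n2 (G i).

Lemma en_ge0 G : 0 <= en G.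
Proof. by apply: sumr_ge0 => i _; exact: n2_ge0. Qed.

Definition dirg G d x : R :=
  component 0 d * G 0 x + (component 1 d * G 1 x + component 2%:R d * G 2%:R x).

Lemma component_le i d : `|component i d| <= `|d|.
Proof.
rewrite /component !prod_normE /= !le_max.
by case: ifP => _; rewrite ?lexx// ; case: ifP => _; rewrite lexx ?orbT.
Qed.

Lemma ev_decomp d : d = component 0 d *: ev 0 + (component 1 d *: ev 1 + component 2%:R d *: ev 2%:R).
Proof.
case: d => [[d1 d2] d3]; rewrite /component /ev /vec /=.
congr (_, _, _).
all: by rewrite /= /GRing.scale/= ?mulr1 ?mulr0 ?addr0 ?add0r.
Qed.

Lemma L2f_dirg G d : (forall i, L2f (G i)) -> L2f (dirg G d).
Proof. by move=> LG; apply: L2fD; [|apply: L2fD]; exact: L2fZ. Qed.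

Lemma wd_dirg U f G d : L2f f -> (forall i, L2f (G i)) -> wgr U f G ->
  wd U d f (dirg G d).
Proof.
move=> Lf LG wG; rewrite {1}[d]ev_decomp.
have LZ i : L2f (fun x => component i d * G i x) by exact: L2fZ.
by apply: wdD => //; [exact: L2fD|exact: wdZ|apply: wdD => //; exact: wdZ].
Qed.

(** The norm of d is the maximum norm, which bounds each component, and 3 is the Cauchy-Schwarz
    factor for three terms. *)
Lemma n2_dirg G d : (forall i, L2f (G i)) -> n2 (dirg G d) <= 3 * `|d| ^+ 2 * en G.
Proof.
move=> LG; have LZ i : L2f (fun x => component i d * G i x) by exact: L2fZ.
have [_ iD] := L2f_dirg d LG.
rewrite /en !big_ord_recl big_ord0 addr0 /n2.
set i0 : 'I_3 := ord0; set i1 : 'I_3 := lift _ _; set i2 : 'I_3 := lift _ _.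
have -> : i0 = 0 by apply: val_inj. have -> : i1 = 1 by apply: val_inj.
have -> : i2 = 2%:R by apply: val_inj.
have [[_ j0] [_ j1] [_ j2]] := And3 (LG 0) (LG 1) (LG 2%:R).
rewrite -Rint3D// -Rint3D//; last exact: int3D.
rewrite -Rint3Z; last by apply: int3D => //; exact: int3D.
apply: Rint3_le => //; first by apply: int3Z; apply: int3D => //; exact: int3D.
move=> x; rewrite /dirg.
have sq (i : 'I_3) : component i d ^+ 2 <= `|d| ^+ 2.
  by rewrite -real_normK ?num_real// lerXn2r ?nnegrE// component_le.
move: (sq 0) (sq 1) (sq 2%:R) => {sq}.
move: (component 0 d) (component 1 d) (component 2%:R d) (G 0 x) (G 1 x) (G 2%:R x) (`|d| ^+ 2).
move=> a b c p q r D h1 h2 h3.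
apply: (@le_trans _ _ (3 * (a ^+ 2 * p ^+ 2 + (b ^+ 2 * q ^+ 2 + c ^+ 2 * r ^+ 2)))).
  have := sqr_ge0 (a * p - b * q); have := sqr_ge0 (a * p - c * r); have := sqr_ge0 (b * q - c * r); nra.
rewrite -(mulrA 3 D) ler_pM2l// !(mulrDr D).
by apply: lerD; [|apply: lerD]; rewrite ler_wpM2r ?sqr_ge0.
Qed.

Lemma measurable_ind (A : set (@R3 R)) : measurable A -> measurable_fun setT (\1_A : @R3 R -> R).
Proof. by move=> mA; exact: measurable_indic. Qed.

Lemma integral_ind3 (A : set (@R3 R)) : measurable A ->
  (\int[@leb3 R]_x (\1_A x)%:E = @leb3 R A)%E.
Proof. by move=> mA; rewrite integral_indic// setIT. Qed.

Lemma indic_itv (A : set (@R3 R)) x : (0 : R) <= \1_A x <= (1 : R).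
Proof. by rewrite indicE; case: (x \in A); rewrite /= ?lexx ?ler01. Qed.

Lemma L2f_ind (A : set (@R3 R)) f : measurable A -> L2f f -> L2f (fun x => \1_A x * f x).
Proof.
move=> mA Lf; apply: (L2f_le _ _ Lf).
  by apply: measurable_funM; [exact: measurable_ind|exact: Lf.1].
move=> x; have /andP[h1 h2] := indic_itv A x.
by rewrite normrM ger0_norm// ler_piMl.
Qed.

Lemma diff_bound U V f G d : open V -> L2f f -> (forall i, L2f (G i)) -> wgr U f G ->
  (forall x t, V x -> 0 <= t <= 1 -> U (x + t *: d)) ->
  n2 (fun x => \1_V x * (f (x + d) - f x)) <= 3 * `|d| ^+ 2 * en G.
Proof.
move=> oV Lf LG wG VU.
have LD := L2f_dirg d LG.
have ae := wd_shift oV Lf LD (wd_dirg d Lf LG wG) VU.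
have [Lavg navg] := L2_avg d LD.
have Ls : L2f (fun x => f (x + d) - f x) by apply: L2fB => //; exact: L2f_shift.
have LI := L2f_ind (open_measurable3 oV) Ls.
apply: le_trans (n2_dirg d LG); apply: le_trans navg; rewrite /n2.
apply: int3_ae_le; [exact: int3_measurable LI.2|exact: Lavg.2|exact: LI.2|].
move: ae; apply: filterS => x h; rewrite indicE.
case: (boolP (x \in V)) => [|_]; last by rewrite mul0r expr0n sqr_ge0.
by rewrite inE => /h ->; rewrite mul1r.
Qed.

Lemma leb3_cbox (a b : @R3 R) : a.1.1 <= b.1.1 -> a.1.2 <= b.1.2 -> a.2 <= b.2 ->
  @leb3 R (cbox3 a b) = ((b.1.1 - a.1.1) * (b.1.2 - a.1.2) * (b.2 - a.2))%:E.
Proof.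
move=> h1 h2 h3.
have H (p q : R) : p <= q -> @leb R `[p, q]%classic = (q - p)%:E.
  move=> pq; rewrite /leb lebesgue_measure_itv/= lte_fin; case: ltP => // qp.
  by rewrite (@le_anti _ _ p q) ?pq ?qp// subrr.
have -> : @leb3 R (cbox3 a b) =
    (@leb R `[a.1.1, b.1.1] * @leb R `[a.1.2, b.1.2] * @leb R `[a.2, b.2])%E.
  rewrite [LHS](@product_measure1E _ _ _ _ _ leb2 (@leb R))//; last exact: measurableX.
  congr (_ * _)%E; exact: product_measure1E.
by rewrite !H// -!EFinM.
Qed.

Definition cube (r : R) : set (@R3 R) := cbox3 0 (r, r, r).

Lemma leb3_cube r : 0 <= r -> @leb3 R (cube r) = (r ^+ 3)%:E.
Proof. by move=> r0; rewrite leb3_cbox//= !subr0 -expr2 -exprSr. Qed.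

Lemma cube_norm r z : cube r z -> `|z| <= r.
Proof.
move=> [[]]; rewrite /= ?in_itv/= => /andP[? ?] /andP[? ?] /andP[? ?].
by rewrite !prod_normE /= !ge_max !ger0_norm//; repeat (apply/andP; split).
Qed.

Lemma cube_scale r z t : 0 <= t -> cube r z -> cube (t * r) (t *: z).
Proof.
move=> t0 [[]]; rewrite /= ?in_itv/= => /andP[? ?] /andP[? ?] /andP[? ?].
by split; [split|]; rewrite /= in_itv/=; apply/andP; split; rewrite ?mulr_ge0// ler_wpM2l.
Qed.

(* V is a piece of U on which U has the uniform cone property *)
Definition cone_piece U V (n : @R3 R) (eta : R) := [/\ open V, 0 < eta &
  forall x lam z, V x -> 0 <= lam <= 1 -> cube (lam * eta) z -> U (x + (lam *: n + z))].

Lemma measurable_add3 (a : @R3 R) : measurable_fun setT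
  (fun xz : @R3 R * @R3 R => xz.1 + (a + xz.2) : @R3 R).
Proof.
apply: measurable_fun_R3; apply: measurable_funD => /=.
- exact: (measurableT_comp measurable_coord11 measurable_fst).
- apply: measurable_funD => //; exact: (measurableT_comp measurable_coord11 measurable_snd).
- exact: (measurableT_comp measurable_coord12 measurable_fst).
- apply: measurable_funD => //; exact: (measurableT_comp measurable_coord12 measurable_snd).
- exact: (measurableT_comp measurable_coord2 measurable_fst).
- apply: measurable_funD => //; exact: (measurableT_comp measurable_coord2 measurable_snd).
Qed.

(** By Tonelli it is enough to bound the increment for each z, with d = lam n + z. The segment stays
    in U because t d = (t lam) n + t z with t z in the cube of side t lam eta: this is where the
    cone, and not a single cube, is used. *)
Lemma cube_energy U V n eta lam w G : cone_piece U V n eta -> 0 <= lam <= 1 ->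
  L2f w -> (forall i, L2f (G i)) -> wgr U w G ->
  (\int[@leb3 R]_x \int[@leb3 R]_z
     (\1_V x * (\1_(cube (lam * eta)) z * (w (x + (lam *: n + z)) - w x) ^+ 2))%:E <=
  (((lam * eta) ^+ 3) * (3 * (lam * (`|n| + eta)) ^+ 2 * en G))%:E)%E.
Proof.
move=> [oV eta0 VU] /andP[l0 l1] Lw LG wG.
have mV := open_measurable3 oV.
have r0 : 0 <= lam * eta by rewrite mulr_ge0// ltW.
pose F (xz : @R3 R * @R3 R) : \bar R :=
  (\1_V xz.1 * (\1_(cube (lam * eta)) xz.2 * (w (xz.1 + (lam *: n + xz.2)) - w xz.1) ^+ 2))%:E.
have mZ : measurable (cube (lam * eta)) by exact: measurable_cbox3.
have mF : measurable_fun setT F.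
  apply/measurable_EFinP; apply: measurable_funM.
    exact: (measurableT_comp (measurable_ind mV) measurable_fst).
  apply: measurable_funM.
    exact: (measurableT_comp (measurable_ind mZ) measurable_snd).
  apply: measurable_funX; apply: measurable_funB.
    exact: (measurableT_comp Lw.1 (measurable_add3 (lam *: n))).
  exact: (measurableT_comp Lw.1 measurable_fst).
have F0 xz : (0 <= F xz)%E.
  have /andP[h1 _] := indic_itv V xz.1; have /andP[h2 _] := indic_itv (cube (lam * eta)) xz.2.
  by rewrite lee_fin mulr_ge0// mulr_ge0// sqr_ge0.
have := @fubini_tonelli _ _ _ _ R (@leb3 R) (@leb3 R) F mF F0.
rewrite /F /= => ->.
apply: (@le_trans _ _ (\int[@leb3 R]_z (\1_(cube (lam * eta)) z * (3 * (lam * (`|n| + eta)) ^+ 2 * en G))%:E)%E); last first.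
  under eq_integral do rewrite EFinM.
  rewrite ge0_integralZr//.
  - by rewrite integral_ind3// leb3_cube// -EFinM.
  - by apply/measurable_EFinP; exact: measurable_ind.
  - by rewrite lee_fin mulr_ge0 ?en_ge0// mulr_ge0// sqr_ge0.
apply: ge0_le_integral => //.
- by move=> z _; apply: integral_ge0 => x _; exact: (F0 (x, z)).
- exact: (measurable_fun_fubini_tonelli_G (m1 := @leb3 R) F).
- by apply/measurable_EFinP; apply: measurable_funM => //; exact: measurable_ind.
move=> z _; rewrite indicE; case: (boolP (z \in _)) => [|_]; last first.
  under eq_integral do rewrite /= mul0r mulr0.
  by rewrite integral0 mul0r.
rewrite inE => Zz; set d := lam *: n + z.
have Ld : L2f (fun x => w (x + d) - w x) by apply: L2fB => //; exact: L2f_shift.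
have LI := L2f_ind mV Ld.
have -> : (\int[@leb3 R]_x (\1_V x * (1 * (w (x + d) - w x) ^+ 2))%:E =
    (n2 (fun x => \1_V x * (w (x + d) - w x)))%:E)%E.
  rewrite /n2 EFin_Rint3//; last exact: LI.2.
  apply: eq_integral => x _; congr EFin; rewrite mul1r exprMn; congr (_ * _).
  by rewrite indicE; case: (x \in V); rewrite ?expr1n ?expr0n.
have VUd x t : V x -> 0 <= t <= 1 -> U (x + t *: d).
  move=> Vx /andP[t0 t1]; rewrite /d scalerDr scalerA; apply: VU => //.
    by rewrite mulr_ge0//= mulr_ile1.
  by rewrite -mulrA; exact: cube_scale.
rewrite mul1r lee_fin; apply: (le_trans (diff_bound oV Lw LG wG VUd)).
rewrite ler_wpM2r ?en_ge0// ler_wpM2l// lerXn2r ?nnegrE//.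
  by rewrite mulr_ge0// addr_ge0// ltW.
rewrite /d (le_trans (ler_normD _ _))// normrZ (ger0_norm l0) mulrDr lerD2l.
exact: cube_norm.
Qed.

End CubeAverages.

(** * Faber-Krahn inequality on a piece with a cone *)

Section FaberKrahnPoincare.
Context {R : realType}.
Implicit Types (U V A B D W : set (@R3 R)) (f g w : @R3 R -> R) (d v x y z n : @R3 R)
  (G : 'I_3 -> @R3 R -> R).

Lemma leb3_shift_set A (a : @R3 R) : measurable A ->
  @leb3 R [set x | A (x + a)] = @leb3 R A.
Proof.
move=> mA.
have mAs : measurable [set x : @R3 R | A (x + a)].
  by have := measurable_shift3 a measurableT mA; rewrite setTI.
rewrite -!integral_ind3//.
have mI : measurable_fun setT (fun x => (\1_A x)%:E : \bar R).
  by apply/measurable_EFinP; exact: measurable_ind.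
rewrite -(ge0_integral_leb3_shift a mI).
  by apply: eq_integral => x _; congr (_%:E); rewrite !indicE.
by move=> x; rewrite lee_fin.
Qed.

Lemma measurable_pair3 x : measurable_fun setT (fun z : @R3 R => (x, z)).
Proof. by apply: measurable_fun_pair; [exact: measurable_cst|exact: measurable_id]. Qed.

Lemma n2_le_iterated (h : @R3 R -> R) (Phi : @R3 R * @R3 R -> \bar R) (K : R) : L2f h ->
  measurable_fun setT Phi -> (forall xz, 0 <= Phi xz)%E ->
  (forall x, (h x ^+ 2)%:E <= \int[@leb3 R]_z Phi (x, z))%E ->
  (\int[@leb3 R]_x \int[@leb3 R]_z Phi (x, z) <= K%:E)%E -> n2 h <= K.
Proof.
move=> Lh mPhi Phi0 le1 le2; rewrite -lee_fin /n2 EFin_Rint3; last exact: Lh.2.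
apply: le_trans le2; apply: ge0_le_integral => //.
- by move=> x _; rewrite lee_fin sqr_ge0.
- by apply/measurable_EFinP; exact: int3_measurable Lh.2.
- exact: (measurable_fun_fubini_tonelli_F (m2 := @leb3 R) Phi).
Qed.

Lemma measurable_cube_energy V r (a : @R3 R) w : measurable V -> measurable_fun setT w ->
  measurable_fun setT (fun xz : @R3 R * @R3 R =>
   (\1_V xz.1 * (\1_(cube r) xz.2 * (w (xz.1 + (a + xz.2)) - w xz.1) ^+ 2))%:E).
Proof.
move=> mV mw; have mZ : measurable (cube r) by exact: measurable_cbox3.
apply/measurable_EFinP; apply: measurable_funM.
  exact: (measurableT_comp (measurable_ind mV) measurable_fst).
apply: measurable_funM.
  exact: (measurableT_comp (measurable_ind mZ) measurable_snd).
apply: measurable_funX; apply: measurable_funB.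
  exact: (measurableT_comp mw (measurable_add3 a)).
exact: (measurableT_comp mw measurable_fst).
Qed.

(* At least half of the translates x + lam n + z leave the support of v. *)
Lemma faber_krahn U V n (eta lam : R) (v : @R3 R -> R) G : cone_piece U V n eta -> 0 < lam <= 1 ->
  L2f v -> (forall i, L2f (G i)) -> wgr U v G ->
  (@leb3 R [set x | v x != 0%R] <= ((lam * eta) ^+ 3 / 2)%:E)%E ->
  n2 (fun x => \1_V x * v x) <= 6 * (lam * (`|n| + eta)) ^+ 2 * en G.
Proof.
move=> cp /andP[l0 l1] Lv LG wG Av; have [oV eta0 VU] := cp.
have mV := open_measurable3 oV.
set r := lam * eta in Av *; have r0 : 0 < r by rewrite mulr_gt0.
have mZ : measurable (cube r) by exact: measurable_cbox3.
have lam01 : 0 <= lam <= 1 by rewrite ltW.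
have mA : measurable [set x | v x != 0].
  have -> : [set x | v x != 0] = v @^-1` (~` [set 0]).
    by apply/seteqP; split => x /= /eqP.
  rewrite -[X in measurable X]setTI; apply: Lv.1 => //.
  by apply: measurableC; exact: measurable_set1.
have mT0 x : measurable [set z | v (x + (lam *: n + z)) != 0].
  have -> : [set z | v (x + (lam *: n + z)) != 0] = [set z | [set x | v x != 0] (z + (x + lam *: n))].
    have E z : x + (lam *: n + z) = z + (x + lam *: n) by rewrite addrA addrC.
    by apply/seteqP; split => z /=; rewrite E.
  by have := measurable_shift3 (x + lam *: n) measurableT mA; rewrite setTI.
have mS x : measurable (cube r `&` [set z | v (x + (lam *: n + z)) = 0]).
  have -> : cube r `&` [set z | v (x + (lam *: n + z)) = 0] =
      cube r `\` [set z | v (x + (lam *: n + z)) != 0].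
    apply/seteqP; split => z [Zz] /= h; split => //=; first by rewrite h eqxx.
    by apply/eqP; apply: contra_notT h.
  exact: measurableD.
(* Of the volume r^3 of the cube at most r^3 / 2 is lost to the translated support of v; on the rest
   the increment equals - v x. *)
have half x : ((r ^+ 3 / 2)%:E <= @leb3 R (cube r `&` [set z | v (x + (lam *: n + z))%R = 0%R]))%E.
  set S := _ `&` _; set T := [set z | v (x + (lam *: n + z)) != 0].
  have eT : T = [set z | [set x | v x != 0] (z + (x + lam *: n))].
    have E z : x + (lam *: n + z) = z + (x + lam *: n) by rewrite addrA addrC.
    by apply/seteqP; split => z; rewrite /T /= E.
  have lT : (@leb3 R T <= (r ^+ 3 / 2)%:E)%E by rewrite eT leb3_shift_set.
  have mT : measurable T by exact: mT0.
  have eS : S = cube r `\` T.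
    apply/seteqP; split => z [Zz]; rewrite /T /= => h; split => //.
      by rewrite h eqxx.
    by apply/eqP; apply: contra_notT h.
  have mSx : measurable S by exact: mS.
  have : (@leb3 R (cube r) <= @leb3 R S + @leb3 R T)%E.
    have sub : cube r `<=` S `|` T.
      by move=> z Zz; have [h|h] := pselect (T z); [right|left; rewrite eS].
    apply: (@le_trans _ _ (@leb3 R (S `|` T))).
      by apply: le_measure => //; rewrite inE//; exact: measurableU.
    exact: measureU2.
  rewrite leb3_cube; last exact: ltW.
  move=> h; have := le_trans h (leeD2l _ lT).
  case: (@leb3 R S) => [s|_|].
  - by rewrite -EFinD !lee_fin => ?; lra.
  - by rewrite leey.
  - by rewrite addNye// leeNy_eq.
(* The root puts the volume r^3 / 2 of the good z inside the square, the form that [n2_le_iterated]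
   takes. Cancelling it at the end turns the factor 3 of [cube_energy] into 6. *)
pose h x := Num.sqrt (r ^+ 3 / 2) * (\1_V x * v x).
have r3 : 0 <= r ^+ 3 / 2 by rewrite divr_ge0// exprn_ge0// ltW.
have Lh : L2f h by apply: L2fZ; exact: L2f_ind.
have H : n2 h <= (lam * eta) ^+ 3 * (3 * (lam * (`|n| + eta)) ^+ 2 * en G).
  apply: (n2_le_iterated Lh (measurable_cube_energy r (lam *: n) mV Lv.1)) (cube_energy cp lam01 Lv LG wG).
    move=> xz; rewrite lee_fin; have /andP[h1 _] := indic_itv V xz.1; have /andP[h2 _] := indic_itv (cube r) xz.2.
    by rewrite mulr_ge0// mulr_ge0// sqr_ge0.
  move=> x /=; rewrite /h.
  apply: (@le_trans _ _ (\int[@leb3 R]_z ((\1_V x * v x ^+ 2) * \1_(cube r `&` [set z | v (x + (lam *: n + z))%R = 0%R]) z)%:E)%E).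
    have -> : (\int[@leb3 R]_z ((\1_V x * v x ^+ 2) * \1_(cube r `&` [set z | v (x + (lam *: n + z))%R = 0%R]) z)%:E
      = (\1_V x * v x ^+ 2)%:E * @leb3 R (cube r `&` [set z | v (x + (lam *: n + z))%R = 0%R]))%E.
      under eq_integral do rewrite EFinM.
      rewrite ge0_integralZl//.
      - by rewrite integral_ind3//; exact: mS.
      - by apply/measurable_EFinP; apply: measurable_ind; exact: mS.
      - by rewrite lee_fin mulr_ge0 ?sqr_ge0//; case/andP: (indic_itv V x).
    rewrite exprMn sqr_sqrtr// mulrC exprMn EFinM.
    have -> : (\1_V x : R) ^+ 2 = \1_V x.
      by rewrite indicE; case: (x \in V); rewrite ?expr1n ?expr0n.
    apply: lee_wpmul2l (half x).
    by rewrite lee_fin mulr_ge0 ?sqr_ge0//; case/andP: (indic_itv V x).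
  apply: ge0_le_integral => //.
  - by move=> z _; rewrite lee_fin; apply: mulr_ge0 => //; apply: mulr_ge0 => //; exact: sqr_ge0.
  - apply/measurable_EFinP; apply: measurable_funM => //; apply: measurable_ind; exact: mS.
  - exact: (measurableT_comp (measurable_cube_energy r (lam *: n) mV Lv.1) (measurable_pair3 x)).
  move=> z _; rewrite lee_fin -mulrA ler_wpM2l//.
  rewrite [\1_(_ `&` _) z]indicE; case: (boolP (z \in _)) => [|_].
    by rewrite inE => -[Zz /= ->]; rewrite mulr1 sub0r sqrrN indicE mem_set// mul1r.
  by rewrite mulr0; apply: mulr_ge0 => //; exact: sqr_ge0.
move: H; rewrite n2Z; last exact: L2f_ind.
rewrite sqr_sqrtr// -/r => H.
have r3' : 0 < r ^+ 3 / 2 by rewrite divr_gt0// exprn_gt0.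
rewrite -(ler_pM2l r3'); apply: (le_trans H); rewrite le_eqVlt; apply/orP; left; apply/eqP; by field.
Qed.

End FaberKrahnPoincare.

(** * Local Poincare inequalities and their gluing *)

Section LocalPoincare.
Context {R : realType}.
Implicit Types (U V A B D W : set (@R3 R)) (f g w : @R3 R -> R) (d v x y z n : @R3 R)
  (G : 'I_3 -> @R3 R -> R).

(** The constant c is left free, since prescribing the mean over A would obstruct the gluing in
    [PI_union]. The weak gradient is taken in U and not in A, because translates of points of A may
    leave A. *)
Definition PI U A := [/\ measurable A, (@leb3 R A < +oo)%E &
  exists2 C : R, 0 <= C & forall w G, L2f w -> (forall i, L2f (G i)) -> wgr U w G ->
    exists c : R, n2 (fun x => \1_A x * (w x - c)) <= C * en G].

Lemma indic_sq A x : (\1_A x : R) ^+ 2 = \1_A x.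
Proof. by rewrite indicE; case: (x \in A); rewrite ?expr1n ?expr0n. Qed.

Lemma int3_ind A : measurable A -> (@leb3 R A < +oo)%E -> int3 (\1_A : @R3 R -> R).
Proof.
move=> mA fA; apply/integrableP; split.
  by apply/measurable_EFinP; exact: measurable_ind.
under eq_integral do rewrite /= ger0_norm//.
by rewrite integral_ind3.
Qed.

Lemma Rint3_ind A : measurable A -> \int[@leb3 R]_x (\1_A x) = fine (@leb3 R A).
Proof. by move=> mA; rewrite /Rintegral integral_ind3. Qed.

Lemma L2f_ind_cst A (c : R) : measurable A -> (@leb3 R A < +oo)%E ->
  L2f (fun x => \1_A x * c).
Proof.
move=> mA fA; split; first by apply: measurable_funM => //; exact: measurable_ind.
have -> : (fun x : @R3 R => (\1_A x * c) ^+ 2) = (fun x => c ^+ 2 * \1_A x).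
  by apply/funext => x; rewrite exprMn indic_sq mulrC.
by apply: int3Z; exact: int3_ind.
Qed.

Lemma L2f_ind_sub A w (c : R) : measurable A -> (@leb3 R A < +oo)%E -> L2f w ->
  L2f (fun x => \1_A x * (w x - c)).
Proof.
move=> mA fA Lw.
have -> : (fun x => \1_A x * (w x - c)) = (fun x => \1_A x * w x - \1_A x * c).
  by apply/funext => x; rewrite mulrBr.
by apply: L2fB; [exact: L2f_ind|exact: L2f_ind_cst].
Qed.

Lemma measurable_pair_energy W D w : measurable W -> measurable D -> measurable_fun setT w ->
  measurable_fun setT (fun xy : @R3 R * @R3 R =>
    (\1_W xy.1 * (\1_D xy.2 * (w xy.2 - w xy.1) ^+ 2))%:E).
Proof.
move=> mW mD mw; apply/measurable_EFinP; apply: measurable_funM.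
  exact: (measurableT_comp (measurable_ind mW) measurable_fst).
apply: measurable_funM.
  exact: (measurableT_comp (measurable_ind mD) measurable_snd).
apply: measurable_funX; apply: measurable_funB.
  exact: (measurableT_comp mw measurable_snd).
exact: (measurableT_comp mw measurable_fst).
Qed.

(** With c the mean of w over D, the integral over D of (w y - w x)^2 is that of (w y - c)^2 plus (c
    - w x)^2 |D|; the first term is dropped. *)
Lemma mean_bound W D w (K : R) : measurable W -> measurable D -> (@leb3 R W < +oo)%E ->
  (@leb3 R D < +oo)%E -> (0 < @leb3 R D)%E -> L2f w ->
  (\int[@leb3 R]_x \int[@leb3 R]_y (\1_W x * (\1_D y * (w y - w x) ^+ 2))%:E <= K%:E)%E ->
  n2 (fun x => \1_W x * (w x - (\int[@leb3 R]_y (\1_D y * w y)) / fine (@leb3 R D)))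
    <= K / fine (@leb3 R D).
Proof.
move=> mW mD fW fD D0 Lw JK; set c := _ / _.
have m0 : 0 < fine (@leb3 R D) by rewrite fine_gt0// D0 fD.
set m := fine _ in m0 *.
have LW : L2f (fun x => \1_W x * (w x - c)) by exact: L2f_ind_sub.
rewrite ler_pdivlMr// mulrC.
have -> : m * n2 (fun x => \1_W x * (w x - c)) = n2 (fun x => Num.sqrt m * (\1_W x * (w x - c))).
  by rewrite n2Z// sqr_sqrtr// ltW.
apply: (n2_le_iterated (L2fZ _ LW) (measurable_pair_energy mW mD Lw.1)) JK.
  move=> xy; rewrite lee_fin; apply: mulr_ge0 => //; apply: mulr_ge0 => //; exact: sqr_ge0.
move=> x /=.
have Ls := L2f_ind_sub (w x) mD fD Lw; have Lc := L2f_ind_sub c mD fD Lw.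
have iD := int3_ind mD fD.
have i1 : int3 (fun y => \1_D y * (w y - c)).
  have [mLc iLc] := Lc.
  apply: (int3_le mLc _ (int3D iD iLc)) => y.
  rewrite -(real_normK (num_real (\1_D y * _))) indicE; case: (y \in D); rewrite /= ?mul0r ?normr0 ?expr0n ?addr0//.
  by rewrite mul1r; move: `|_| (normr_ge0 (w y - c)) => u u0; nra.
have mean0 : \int[@leb3 R]_y (\1_D y * (w y - c)) = 0.
  have iw : int3 (fun y => \1_D y * w y).
    have -> : (fun y => \1_D y * w y) = (fun y => \1_D y * (w y - c) + c * \1_D y).
      by apply/funext => y; ring.
    by apply: int3D => //; exact: int3Z.
  transitivity (\int[@leb3 R]_y (\1_D y * w y - c * \1_D y)).
    by apply: eq_Rintegral => y _; ring.
  rewrite Rint3B//; last exact: int3Z.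
  by rewrite Rint3Z// Rint3_ind// -/m /c divfK ?subrr// gt_eqF.
have E : (\int[@leb3 R]_y (\1_W x * (\1_D y * (w y - w x) ^+ 2))%:E =
    (\1_W x * n2 (fun y => \1_D y * (w y - w x)))%:E)%E.
  rewrite /n2 -Rint3Z; last exact: Ls.2.
  rewrite EFin_Rint3; last by apply: int3Z; exact: Ls.2.
  by apply: eq_integral => y _; rewrite exprMn indic_sq.
rewrite E lee_fin exprMn (sqr_sqrtr (ltW m0)) exprMn indic_sq [leLHS]mulrCA ler_wpM2l//.
have -> : n2 (fun y => \1_D y * (w y - w x)) =
    n2 (fun y => \1_D y * (w y - c)) + (c - w x) ^+ 2 * m.
  transitivity (\int[@leb3 R]_y (((\1_D y * (w y - c)) ^+ 2 +
      2 * (c - w x) * (\1_D y * (w y - c))) + (c - w x) ^+ 2 * \1_D y)).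
    apply: eq_Rintegral => y _; rewrite !exprMn !indic_sq; ring.
  have i2 := int3Z (2 * (c - w x)) i1; have i3 := int3Z ((c - w x) ^+ 2) iD.
  rewrite Rint3D//; last by apply: int3D => //; exact: Lc.2.
  rewrite Rint3D//; last exact: Lc.2.
  by rewrite Rint3Z// mean0 mulr0 addr0 Rint3Z// Rint3_ind.
have := n2_ge0 (fun y => \1_D y * (w y - c)).
by rewrite -[in m * _]sqrrN opprB mulrC => ?; rewrite lerDr.
Qed.

(** The substitution y = x + n + z turns a pair from W and D into a translate by an element of the
    cube, so this is [cube_energy] at lam = 1. *)
Lemma pair_bound U V W D n (eta : R) w G : cone_piece U V n eta -> measurable W -> measurable D ->
  W `<=` V -> (forall x y, W x -> D y -> cube eta (y - (x + n))) ->
  L2f w -> (forall i, L2f (G i)) -> wgr U w G ->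
  (\int[@leb3 R]_x \int[@leb3 R]_y (\1_W x * (\1_D y * (w y - w x) ^+ 2))%:E <=
   (eta ^+ 3 * (3 * (`|n| + eta) ^+ 2 * en G))%:E)%E.
Proof.
move=> cp mW mD WV WD Lw LG wG; have [oV eta0 _] := cp.
have l01 : 0 <= (1 : R) <= 1 by rewrite lexx ler01.
have := cube_energy cp l01 Lw LG wG; rewrite !mul1r; apply: le_trans.
have mV := open_measurable3 oV.
have mZ : measurable (cube eta) by exact: measurable_cbox3.
have pm := measurable_pair_energy mW mD Lw.1.
have cm := measurable_cube_energy eta (1 *: n) mV Lw.1.
apply: ge0_le_integral => //.
- move=> x _; apply: integral_ge0 => y _; rewrite lee_fin.
  by apply: mulr_ge0 => //; apply: mulr_ge0 => //; exact: sqr_ge0.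
- apply: (measurable_fun_fubini_tonelli_F (m2 := @leb3 R) _ pm) => xy.
  by rewrite lee_fin; apply: mulr_ge0 => //; apply: mulr_ge0 => //; exact: sqr_ge0.
- apply: (measurable_fun_fubini_tonelli_F (m2 := @leb3 R) _ cm) => xy.
  by rewrite lee_fin; apply: mulr_ge0 => //; apply: mulr_ge0 => //; exact: sqr_ge0.
move=> x _.
have pmx := measurableT_comp pm (measurable_pair3 x).
have cmx := measurableT_comp cm (measurable_pair3 x).
rewrite -(ge0_integral_leb3_shift (x + n) pmx); last first.
  by move=> y; rewrite lee_fin; apply: mulr_ge0 => //; apply: mulr_ge0 => //; exact: sqr_ge0.
apply: ge0_le_integral => //.
- by move=> y _; rewrite lee_fin; apply: mulr_ge0 => //; apply: mulr_ge0 => //; exact: sqr_ge0.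
- exact: (measurableT_comp pmx (measurable_shift3 (x + n))).
move=> z _; rewrite lee_fin /= scale1r.
rewrite [z + (x + n)]addrC -[x + n + z]addrA.
rewrite [\1_W x]indicE; case: (boolP (x \in W)) => [|_]; last first.
  by rewrite mul0r; apply: mulr_ge0 => //; apply: mulr_ge0 => //; exact: sqr_ge0.
rewrite inE => Wx; rewrite [\1_V x]indicE mem_set ?mul1r; last exact: WV.
rewrite [\1_D _]indicE; case: (boolP (_ \in D)) => [|_]; last first.
  by rewrite mul0r; apply: mulr_ge0 => //; exact: sqr_ge0.
rewrite inE => Dy; rewrite mul1r indicE mem_set ?mul1r//.
have := WD _ _ Wx Dy.
by have -> : x + (n + z) - (x + n) = z by rewrite [x + (n + z)]addrA [x + n + z]addrC addrK.
Qed.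

Lemma PI_mean U V W D n (eta : R) : cone_piece U V n eta -> measurable W -> measurable D ->
  (@leb3 R W < +oo)%E -> (@leb3 R D < +oo)%E -> (0 < @leb3 R D)%E ->
  W `<=` V -> (forall x y, W x -> D y -> cube eta (y - (x + n))) ->
  exists2 C : R, 0 <= C & forall w G, L2f w -> (forall i, L2f (G i)) -> wgr U w G ->
    n2 (fun x => \1_W x * (w x - (\int[@leb3 R]_y (\1_D y * w y)) / fine (@leb3 R D)))
      <= C * en G.
Proof.
move=> cp mW mD fW fD D0 WV WD; have [_ eta0 _] := cp.
have m0 : 0 < fine (@leb3 R D) by rewrite fine_gt0// D0 fD.
exists (eta ^+ 3 * (3 * (`|n| + eta) ^+ 2) / fine (@leb3 R D)).
  apply: divr_ge0; last exact: ltW.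
  apply: mulr_ge0; first by rewrite exprn_ge0// ltW.
  by rewrite mulr_ge0// sqr_ge0.
move=> w G Lw LG wG.
have := mean_bound mW mD fW fD D0 Lw (pair_bound cp mW mD WV WD Lw LG wG).
move=> /le_trans; apply; rewrite le_eqVlt; apply/orP; left; apply/eqP.
by rewrite !mulrA; ring.
Qed.

Lemma leb3_setU_lty A B : measurable A -> measurable B ->
  (@leb3 R A < +oo)%E -> (@leb3 R B < +oo)%E -> (@leb3 R (A `|` B) < +oo)%E.
Proof.
move=> mA mB fA fB; apply: (@le_lt_trans _ _ (@leb3 R A + @leb3 R B)%E).
  exact: (measureU2 (@leb3 R) mA mB).
exact: lte_add_pinfty fA fB.
Qed.

(** On the overlap both constants approximate w, whence (a - e)^2 m <= 2 (CA + CB) en G with m > 0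
    its measure; the oscillation on B may then be measured from a. *)
Lemma PI_union U A B : PI U A -> PI U B -> (0 < @leb3 R (A `&` B))%E -> PI U (A `|` B).
Proof.
move=> [mA fA [CA CA0 hA]] [mB fB [CB CB0 hB]] AB0.
have mAB : measurable (A `&` B) by exact: measurableI.
have fAB : (@leb3 R (A `&` B) < +oo)%E.
  by apply: le_lt_trans fA; apply: le_measure; rewrite ?inE.
have m0 : 0 < fine (@leb3 R (A `&` B)) by rewrite fine_gt0// AB0 fAB.
set m := fine _ in m0.
set b := fine (@leb3 R B).
have b0 : 0 <= b by exact: fine_ge0.
split; [exact: measurableU|exact: leb3_setU_lty|].
exists (CA + (2 * CB + 2 * b * ((2 * CA + 2 * CB) / m))).
  have h1 : 0 <= (2 * CA + 2 * CB) / m by apply: divr_ge0; [rewrite addr_ge0// mulr_ge0|exact: ltW].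
  apply: addr_ge0 => //; apply: addr_ge0; first by apply: mulr_ge0.
  by apply: mulr_ge0 => //; apply: mulr_ge0.
move=> w G Lw LG wG; have [a ha] := hA w G Lw LG wG; have [e he] := hB w G Lw LG wG.
exists a.
have LA := L2f_ind_sub a mA fA Lw; have LB := L2f_ind_sub e mB fB Lw.
have LAB := L2f_ind_sub a mB fB Lw.
have iAB := int3_ind mAB fAB; have iB := int3_ind mB fB.
have d1 : (a - e) ^+ 2 * m <= 2 * (CA * en G) + 2 * (CB * en G).
  rewrite /m -Rint3_ind// -Rint3Z//.
  apply: (@le_trans _ _ (2 * n2 (fun x => \1_A x * (w x - a)) + 2 * n2 (fun x => \1_B x * (w x - e)))).
    rewrite /n2 -Rint3Z; last exact: LA.2.
    rewrite -Rint3Z; last exact: LB.2.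
    have i1 := int3Z 2 LA.2; have i2 := int3Z 2 LB.2.
    rewrite -Rint3D//; apply: Rint3_le; [exact: int3Z|exact: int3D|move=> x].
    rewrite indicI !exprMn !indic_sq.
    rewrite /= !indicE; case: (x \in A); case: (x \in B); rewrite /= ?(mulr0, mul0r, mulr1, mul1r, addr0, add0r).
    - have := sqr_ge0 ((w x - a) + (w x - e)); nra.
    - by rewrite mulr_ge0// sqr_ge0.
    - by rewrite mulr_ge0// sqr_ge0.
    - by [].
  by rewrite lerD// ler_pM2l.
have d2 : n2 (fun x => \1_B x * (w x - a)) <= 2 * (CB * en G) + 2 * ((a - e) ^+ 2 * b).
  apply: (@le_trans _ _ (2 * n2 (fun x => \1_B x * (w x - e)) + 2 * ((a - e) ^+ 2 * b))); last first.
    by rewrite lerD2r ler_pM2l.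
  rewrite /n2 /b -(Rint3_ind mB).
  rewrite -(Rint3Z 2 LB.2).
  have i1 := int3Z 2 LB.2; have i2 := int3Z ((a - e) ^+ 2) iB; have i3 := int3Z 2 i2.
  rewrite -(Rint3Z ((a - e) ^+ 2) iB) -(Rint3Z 2 i2) -Rint3D//.
  apply: Rint3_le; [exact: LAB.2|exact: int3D|move=> x].
  rewrite !exprMn !indic_sq /= !indicE; case: (x \in B); rewrite /= ?(mulr0, mul0r, mulr1, mul1r, addr0, add0r)//.
  have := sqr_ge0 ((w x - e) + (a - e)); nra.
apply: (@le_trans _ _ (n2 (fun x => \1_A x * (w x - a)) + n2 (fun x => \1_B x * (w x - a)))).
  have [mu iu] : L2f (fun x => \1_(A `|` B) x * (w x - a)).
    by apply: L2f_ind_sub Lw; [exact: measurableU|exact: leb3_setU_lty].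
  rewrite /n2 -Rint3D; [|exact: LA.2|exact: LAB.2].
  apply: Rint3_le => //; first by apply: int3D; [exact: LA.2|exact: LAB.2].
  move=> x; rewrite !exprMn !indic_sq !indicE in_setU.
  case: (x \in A); case: (x \in B); rewrite /= ?(mulr0, mul0r, mulr1, mul1r, addr0, add0r)//.
  by rewrite lerDl sqr_ge0.
have e0 := en_ge0 G.
have d3 : (a - e) ^+ 2 <= (2 * CA + 2 * CB) / m * en G.
  by rewrite mulrAC ler_pdivlMr// (le_trans d1)// le_eqVlt; apply/orP; left; apply/eqP; ring.
have d4 : (a - e) ^+ 2 * b <= ((2 * CA + 2 * CB) / m * en G) * b by rewrite ler_wpM2r.
move: ((2 * CA + 2 * CB) / m) d3 d4 => k d3 d4; nra.
Qed.

End LocalPoincare.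

(** * Poincare inequality on the domain, by chaining and compactness *)

Section GlobalPoincare.
Context {R : realType}.
Implicit Types (U V A B D W : set (@R3 R)) (w : @R3 R -> R) (x y z n : @R3 R)
  (G : 'I_3 -> @R3 R -> R) (r rho eta : R).

Definition has_cone U := forall x0, closure U x0 -> exists r n eta,
  0 < r /\ cone_piece U (U `&` ball x0 r) n eta.

Definition diag r : @R3 R := (r, r, r).

Lemma ballP x r y : ball x r y <->
  [/\ `|x.1.1 - y.1.1| < r, `|x.1.2 - y.1.2| < r & `|x.2 - y.2| < r].
Proof. by split => [[[]]|[]]. Qed.

Lemma cubeP r z : cube r z <-> [/\ 0 <= z.1.1 <= r, 0 <= z.1.2 <= r & 0 <= z.2 <= r].
Proof. by split=> [[[]]|[h1 h2 h3]]; [|split; [split|]]; rewrite /= ?in_itv. Qed.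

Lemma leb3_ball_lty x r : (@leb3 R (ball x r) < +oo)%E.
Proof.
apply: (le_lt_trans _ (leb3_box_lty (x - diag r) (x + diag r))).
apply: le_measure; rewrite ?inE.
- by apply: open_measurable3; exact: ball_open.
- exact: measurable_cbox3.
- move=> y /ballP[h1 h2 h3]; move: h1 h2 h3; rewrite !ltr_distlC => /andP[/ltW ? /ltW ?] /andP[/ltW ? /ltW ?] /andP[/ltW ? /ltW ?].
  by split; [split|]; rewrite /= in_itv/=; apply/andP.
Qed.

Lemma leb3_ball_gt0 x r : 0 < r -> (0 < @leb3 R (ball x r))%E.
Proof.
move=> r0.
have : (0 < @leb3 R (cbox3 x (x + diag (r / 2))%R))%E.
  rewrite leb3_cbox /= ?lerDl ?divr_ge0 ?ltW// lte_fin.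
  by rewrite ![_ + _ - _]addrC !addrA !addNr !add0r !mulr_gt0// divr_gt0.
move=> /lt_le_trans; apply; apply: le_measure; rewrite ?inE.
- exact: measurable_cbox3.
- by apply: open_measurable3; exact: ball_open.
move=> y [[]]; rewrite /= ?in_itv/= => /andP[? ?] /andP[? ?] /andP[? ?].
by apply/ballP; rewrite !ltr_distlC; split; apply/andP; split; lra.
Qed.

Lemma nbhs_leb3_gt0 x A : measurable A -> nbhs x A -> (0 < @leb3 R A)%E.
Proof.
move=> mA /nbhs_ballP[r /= r0 rA]; apply: (lt_le_trans (leb3_ball_gt0 x r0)).
apply: le_measure; rewrite ?inE//; apply: open_measurable3; exact: ball_open.
Qed.

(** The translate of the cube by n is the cube of half side 2 rho / 3 centred at 0, so displaced
    points stay within rho / 3 + 2 rho / 3 of x0. It also contains every difference of two points of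
    the small ball, which [PI_ball_mean] exploits. *)
Lemma cone_interior U x0 rho : 0 < rho -> ball x0 rho `<=` U ->
  cone_piece U (ball x0 (rho / 3)) (diag (- (2 * rho / 3))) (4 * rho / 3).
Proof.
move=> r0 bU; split; [exact: ball_open|by rewrite divr_gt0// mulr_gt0|].
move=> x lam z /ballP[h1 h2 h3] /andP[l0 l1] /cubeP[k1 k2 k3]; apply: bU.
have q0 : 0 <= lam * rho by rewrite mulr_ge0// ltW.
have q1 : lam * rho <= rho by rewrite ler_piMl// ltW.
have H (a b c : R) : `|a - b| < rho / 3 -> 0 <= c <= lam * (4 * rho / 3) ->
    `|a - (b + (lam * - (2 * rho / 3) + c))| < rho.
  rewrite !ltr_norml => /andP[? ?] /andP[? ?]; apply/andP; split; nra.
by apply/ballP; split; apply: H.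
Qed.

Lemma PI_ball_mean U x0 rho : 0 < rho -> ball x0 rho `<=` U ->
  exists2 C : R, 0 <= C & forall w G, L2f w -> (forall i, L2f (G i)) -> wgr U w G ->
    n2 (fun x => \1_(ball x0 (rho / 3)) x * (w x - (\int[@leb3 R]_y (\1_(ball x0 (rho / 3)) y * w y)) / fine (@leb3 R (ball x0 (rho / 3)))))
      <= C * en G.
Proof.
move=> r0 bU; have mb : measurable (ball x0 (rho / 3)).
  by apply: open_measurable3; exact: ball_open.
have r3 : 0 < rho / 3 by rewrite divr_gt0.
apply: (PI_mean (cone_interior r0 bU)) => //; try exact: leb3_ball_lty.
  exact: leb3_ball_gt0.
have K (a s t : R) : `|a - s| < rho / 3 -> `|a - t| < rho / 3 ->
    0 <= t - (s + - (2 * rho / 3)) <= 4 * rho / 3.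
  by rewrite !ltr_distlC => /andP[? ?] /andP[? ?]; apply/andP; split; lra.
move=> x y /ballP[h1 h2 h3] /ballP[k1 k2 k3].
by apply/cubeP; split; rewrite /=; [exact: K h1 k1|exact: K h2 k2|exact: K h3 k3].
Qed.

Lemma PI_ball U x0 rho : 0 < rho -> ball x0 rho `<=` U -> PI U (ball x0 (rho / 3)).
Proof.
move=> r0 bU; have [C C0 hC] := PI_ball_mean r0 bU; split.
- by apply: open_measurable3; exact: ball_open.
- exact: leb3_ball_lty.
- by exists C => // w G Lw LG wG; eexists; exact: hC.
Qed.

(** The cone carries a small piece W of U at x0 over a ball D about the interior point y0. Both W
    and D are compared with the mean of w over D, so their inequalities add up even if W and D are
    disjoint. *)
Lemma PI_closure U x0 : open U -> has_cone U -> closure U x0 ->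
  exists2 r, 0 < r & exists E y0, [/\ PI U E, U `&` ball x0 r `<=` E, U y0 & nbhs y0 E].
Proof.
move=> oU hU cx0; have [r [n [eta [r0 cp]]]] := hU _ cx0; have [_ eta0 VU] := cp.
have eta4 : 0 < eta / 4 by rewrite divr_gt0.
(* With r1 and rho / 3 at most eta / 4, points x of W and y of D deviate from x0 and y0 by less than
   a quarter of eta, so y - (x + n) stays in the cube of side eta, whose centre is diag (eta /
   2). *)
pose r1 := Num.min r (eta / 4).
have r10 : 0 < r1 by rewrite lt_min r0.
have r1r : r1 <= r by rewrite ge_min lexx.
have r1e : r1 <= eta / 4 by rewrite ge_min lexx orbT.
exists r1 => //; pose W := U `&` ball x0 r1; pose y0 := x0 + n + diag (eta / 2).
(* Since x0 may lie on the boundary, y0 is reached from a nearby point x of U, and z makes up for x0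
   - x. *)
have Uy0 : U y0.
  have [x [Ux /ballP[]]] := cx0 _ (nbhsx_ballx x0 r1 r10).
  rewrite !ltr_distlC => /andP[? ?] /andP[? ?] /andP[? ?].
  have -> : y0 = x + (1 *: n + (x0 - x + diag (eta / 2))).
    rewrite /y0 scale1r [RHS]addrCA [x + (_ + diag _)]addrA [x + (x0 - x)]addrC subrK.
    by rewrite addrA [n + x0]addrC.
  apply: VU.
  - by split => //; apply/ballP; rewrite !ltr_distlC; split; apply/andP; split; lra.
  - by rewrite ler01 lexx.
  - by rewrite mul1r; apply/cubeP; split => /=; apply/andP; split; lra.
have [rho0 /= rho00 bU0] : nbhs_ball y0 U by apply/nbhs_ballP; move: oU; rewrite openE; exact.
pose rho := Num.min rho0 (3 * (eta / 4)).
have rho_gt0 : 0 < rho by rewrite lt_min rho00/= mulr_gt0.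
have bU : ball y0 rho `<=` U.
  by apply: subset_trans bU0; apply: le_ball; rewrite ge_min lexx.
have rho_le : rho / 3 <= eta / 4.
  by rewrite ler_pdivrMr// mulrC ge_min lexx orbT.
pose D : set (@R3 R) := ball y0 (rho / 3).
have [C1 C10 h1] := PI_ball_mean rho_gt0 bU; rewrite -/D in h1.
have mD : measurable D by apply: open_measurable3; exact: ball_open.
have mW : measurable W.
  by apply: open_measurable3; apply: openI => //; exact: ball_open.
have fD : (@leb3 R D < +oo)%E by exact: leb3_ball_lty.
have fW : (@leb3 R W < +oo)%E.
  apply: (le_lt_trans _ (leb3_ball_lty x0 r1)); apply: le_measure; rewrite ?inE//.
    by apply: open_measurable3; exact: ball_open.
  by move=> x [].
have D0 : (0 < @leb3 R D)%E by apply: leb3_ball_gt0; rewrite divr_gt0.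
have WV : W `<=` U `&` ball x0 r.
  by move=> x [Ux bx]; split => //; apply: le_ball bx; rewrite ge_min lexx.
have WD x y : W x -> D y -> cube eta (y - (x + n)).
  have K (e a b c : R) : `|e - a| < r1 -> `|e + c + eta / 2 - b| < rho / 3 ->
      0 <= b - (a + c) <= eta.
    by rewrite !ltr_distlC => /andP[? ?] /andP[? ?]; apply/andP; split; lra.
  move=> [_ /ballP[a1 a2 a3]] /ballP[b1 b2 b3].
  by apply/cubeP; split; [exact: K a1 b1|exact: K a2 b2|exact: K a3 b3].
have [C2 C20 h2] := PI_mean cp mW mD fW fD D0 WV WD.
exists (W `|` D), y0; split => //.
- split; [exact: measurableU|exact: leb3_setU_lty|].
  exists (C2 + C1); first exact: addr_ge0.
  move=> w G Lw LG wG; exists ((\int[@leb3 R]_y (\1_D y * w y)) / fine (@leb3 R D)).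
  have := lerD (h2 w G Lw LG wG) (h1 w G Lw LG wG); rewrite -mulrDl; apply: le_trans.
  set c := _ / _.
  have LW := L2f_ind_sub c mW fW Lw; have LD := L2f_ind_sub c mD fD Lw.
  rewrite /n2 -Rint3D; [|exact: LW.2|exact: LD.2].
  have [_ iU] : L2f (fun x => \1_(W `|` D) x * (w x - c)).
    by apply: L2f_ind_sub Lw; [exact: measurableU|exact: leb3_setU_lty].
  apply: Rint3_le => //; first by apply: int3D; [exact: LW.2|exact: LD.2].
  move=> x; rewrite !exprMn !indic_sq !indicE in_setU.
  case: (x \in W); case: (x \in D); rewrite /= ?(mulr0, mul0r, mulr1, mul1r, addr0, add0r)//.
  by rewrite lerDl sqr_ge0.
- have : nbhs y0 D by apply: nbhsx_ballx; rewrite divr_gt0.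
  by apply: filterS => x Dx; right.
Qed.

(** Asking for neighbourhoods, not for mere membership, makes two such sets overlap in positive
    measure at a common point, as [PI_union] requires. *)
Definition linked U x y := exists A, [/\ PI U A, nbhs x A & nbhs y A].

Lemma PI_glue U A B y : PI U A -> PI U B -> nbhs y A -> nbhs y B -> PI U (A `|` B).
Proof.
move=> PA PB yA yB; apply: PI_union => //; apply: (nbhs_leb3_gt0 (x := y)); last exact: filterI.
by apply: measurableI; [case: PA|case: PB].
Qed.

Lemma linked_trans U x y z : linked U x y -> linked U y z -> linked U x z.
Proof.
move=> [A [PA xA yA]] [B [PB yB zB]]; exists (A `|` B); split.
- exact: PI_glue PA PB yA yB.
- by apply: filterS xA => t; left.
- by apply: filterS zB => t; right.
Qed.

Lemma linked_open U x : open U -> U x -> exists2 r, 0 < r & forall y, ball x r y -> linked U x y.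
Proof.
move=> oU Ux.
have [rho /= rho0 bU] : nbhs_ball x U by apply/nbhs_ballP; move: oU; rewrite openE; exact.
have r3 : 0 < rho / 3 by rewrite divr_gt0.
exists (rho / 3) => // y by_; exists (ball x (rho / 3)); split.
- exact: PI_ball.
- exact: nbhsx_ballx.
- by apply: open_nbhs_nbhs; split => //; exact: ball_open.
Qed.

Lemma linked_sym U x y : linked U x y -> linked U y x.
Proof. by move=> [A [? ? ?]]; exists A. Qed.

(** The points linked to p form a set that is open and closed in U: [linked_open] shows that it and
    its complement in U are open. *)
Lemma linked_connected U p x : open U -> connected U -> U p -> U x -> linked U p x.
Proof.
move=> oU cU Up Ux.
pose B : set (@R3 R) := [set y | U y /\ linked U p y].
have lpp : linked U p p.
  by have [r r0 h] := linked_open oU Up; apply: h; exact: ballxx.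
suff BU : B = U by have [] : B x by rewrite BU.
apply: cU.
- by exists p.
- exists B; last by apply/seteqP; split => y; [move=> By; split => //; case: By|case].
  rewrite openE => y [Uy ly]; have [r r0 h] := linked_open oU Uy.
  have [rho /= rho0 bU] : nbhs_ball y U by apply/nbhs_ballP; move: oU; rewrite openE; exact.
  apply/nbhs_ballP; exists (Num.min r rho); first by rewrite /= lt_min r0.
  move=> z bz; split; first by apply: bU; apply: le_ball bz; rewrite ge_min lexx orbT.
  by apply: linked_trans ly (h _ _); apply: le_ball bz; rewrite ge_min lexx.
- exists (~` [set y | U y /\ ~ linked U p y]); last first.
    apply/seteqP; split => y; first by move=> [Uy ly]; split => // -[].
    by move=> [Uy /= h]; split => //; apply: contrapT => nl; apply: h.
  apply: open_closedC; rewrite openE => y [Uy ly]; have [r r0 h] := linked_open oU Uy.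
  have [rho /= rho0 bU] : nbhs_ball y U by apply/nbhs_ballP; move: oU; rewrite openE; exact.
  apply/nbhs_ballP; exists (Num.min r rho); first by rewrite /= lt_min r0.
  move=> z bz; split; first by apply: bU; apply: le_ball bz; rewrite ge_min lexx orbT.
  move=> lz; apply: ly; apply: (linked_trans lz); apply: linked_sym.
  by apply: h; apply: le_ball bz; rewrite ge_min lexx.
Qed.

Lemma PI_whole U : open U -> connected U -> compact (closure U) -> U !=set0 -> has_cone U ->
  exists2 A, PI U A & U `<=` A.
Proof.
move=> oU cU kU [p Up] hU.
(* The sets with a Poincare inequality containing a neighbourhood of p are
   directed by inclusion; compactness is applied along that filter. *)
pose good (E : set (@R3 R)) := PI U E /\ nbhs p E.
pose F (S : set (set (@R3 R))) := exists2 E0, good E0 & forall E, good E -> E0 `<=` E -> S E.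
have [A0 [PA0 pA0 _]] := linked_connected oU cU Up Up.
have FF : Filter F.
  split.
  - by exists A0.
  - move=> S T [E [PE pE] hE] [E' [PE' pE'] hE']; exists (E `|` E').
      by split; [exact: PI_glue PE PE' pE pE'|apply: filterS pE => t; left].
    move=> D gD sD; split.
      by apply: hE => // t Et; apply: sD; left.
    by apply: hE' => // t Et; apply: sD; right.
  - by move=> S T ST [E gE hE]; exists E => // D gD sD; apply: ST; exact: hE.
have /compact_near_coveringP nc := kU.
have [x cx|E0 [PE0 pE0] hE0] := nc _ F (fun E x => U x -> E x) FF; last first.
  have h := hE0 E0 (conj PE0 pE0) (fun _ h => h).
  by exists E0 => // x Ux; apply: h => //; exact: subset_closure.
have [r r0 [E [y0 [PE UE Uy0 yE]]]] := PI_closure oU hU cx.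
(* [E] covers U near x but need not be near p; a chain of overlapping sets from p to y0 joins the
   two. *)
have [A [PA pA yA]] := linked_connected oU cU Up Uy0.
exists (ball x r, [set D | good D /\ A `|` E `<=` D]).
  split; first exact: nbhsx_ballx.
  exists (A `|` E) => //; split; first exact: PI_glue PA PE yA yE.
  by apply: filterS pA => t; left.
by move=> [x' D] [/= bx' [gD sD]] Ux'; apply: sD; right; apply: UE.
Qed.

(** For w of mean zero over U, expanding the square gives |w - c|^2 = |w|^2 + c^2 |U| in L^2(U), so
    the unknown constant c of [PI] only increases the left side. *)
Lemma poincare U : open U -> connected U -> compact (closure U) -> U !=set0 -> has_cone U ->
  exists2 C : R, 0 <= C & forall w G, L2f w -> (forall i, L2f (G i)) -> wgr U w G ->
    \int[@leb3 R]_x (\1_U x * w x) = 0 -> n2 (fun x => \1_U x * w x) <= C * en G.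
Proof.
move=> oU cU kU U0 hU; have [A [mA fA [C C0 hC]] UA] := PI_whole oU cU kU U0 hU.
have mU := open_measurable3 oU.
have fU : (@leb3 R U < +oo)%E.
  by apply: (le_lt_trans _ fA); apply: le_measure; rewrite ?inE.
exists C => // w G Lw LG wG w0; have [c hc] := hC w G Lw LG wG.
apply: le_trans hc.
have LU := L2f_ind_sub c mU fU Lw; have LA := L2f_ind_sub c mA fA Lw.
apply: (@le_trans _ _ (n2 (fun x => \1_U x * (w x - c)))); last first.
  apply: (n2_le _ _ LA); first exact: LU.1.
  move=> x; rewrite !normrM ler_wpM2r// !indicE.
  by case: (boolP (x \in U)) => [|_]; [rewrite inE => /UA/mem_set ->|rewrite normr0].
have Lw1 := L2f_ind mU Lw.
have iU := int3_ind mU fU.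
have i1 : int3 (fun x => \1_U x * w x).
  have [m1 i2] := Lw1.
  apply: (int3_le m1 _ (int3D iU i2)) => y.
  rewrite -(real_normK (num_real (\1_U y * _))) indicE; case: (y \in U); rewrite /= ?mul0r ?normr0 ?expr0n ?addr0//.
  by rewrite mul1r; move: `|_| (normr_ge0 (w y)) => u u0; nra.
have -> : n2 (fun x => \1_U x * (w x - c)) =
    n2 (fun x => \1_U x * w x) + c ^+ 2 * fine (@leb3 R U).
  transitivity (\int[@leb3 R]_y (((\1_U y * w y) ^+ 2 +
      (- 2 * c) * (\1_U y * w y)) + c ^+ 2 * \1_U y)).
    by apply: eq_Rintegral => y _; rewrite !exprMn !indic_sq; ring.
  have i2 := int3Z (- 2 * c) i1; have i3 := int3Z (c ^+ 2) iU.
  rewrite Rint3D//; last by apply: int3D => //; exact: Lw1.2.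
  rewrite Rint3D//; last exact: Lw1.2.
  by rewrite (Rint3Z (- 2 * c) i1) w0 mulr0 addr0 (Rint3Z (c ^+ 2) iU) Rint3_ind.
by rewrite lerDl mulr_ge0 ?sqr_ge0// fine_ge0.
Qed.

End GlobalPoincare.

(** * From the regularity of the boundary to cones *)

Section ConeProperty.
Context {R : realType}.
Implicit Types (U V : set (@R3 R)) (x y z n : @R3 R) (r eta : R).

(** Balls are convex, so the mean value theorem applies on the segment from b to a. The increment is
    split along the two coordinate directions, whose derivatives are bounded near p0 by
    continuity. *)
Lemma C1_lipschitz (h : R * R -> R) (p0 : R * R) : Ck 1 setT h ->
  exists L delta : R, [/\ 0 <= L, 0 < delta & forall a b, ball p0 delta a -> ball p0 delta b ->
    `|h a - h b| <= L * `|a - b|].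
Proof.
move=> Ch.
have D (v : R * R) : \forall p \near p0, `|'D_v h p| <= `|'D_v h p0| + 1.
  have cv : continuous ('D_v h) by exact/(@Ck_continuous _ _ 0)/Ck_derive.
  have /cvgrPdist_le /(_ _ ltr01) := cv p0; apply: filterS => p.
  rewrite -lerBlDl; apply: le_trans; rewrite distrC; exact: lerB_dist.
pose e1 : R * R := (1, 0); pose e2 : R * R := (0, 1).
have [r /= r0 hr] : nbhs_ball p0 [set p | `|'D_e1 h p| <= `|'D_e1 h p0| + 1 /\ `|'D_e2 h p| <= `|'D_e2 h p0| + 1].
  by apply/nbhs_ballP; apply: filterI; exact: D.
pose L := (`|'D_e1 h p0| + 1) + (`|'D_e2 h p0| + 1).
exists L, r; split => //; first by rewrite !addr_ge0.
move=> a b ba bb.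
have dh (v y0 : R * R) : derivable h y0 v by exact: Ck_derivable Ch.
have [t t01] := derive_line_mvt b 1 (dh (a - b)).
have Eab : b + (a - b) = a by rewrite addrC subrK.
rewrite scale1r Eab mul1r mulr1 => ->.
have /hr [h1 h2] : ball p0 r (b + t *: (a - b)).
  have -> : b + t *: (a - b) = t *: a + (1 - t) *: b.
    by rewrite scalerBr scalerBl scale1r addrCA.
  have [t0 t1] := andP t01.
  rewrite -ball_normE /ball_/= in ba bb *.
  have -> : p0 - (t *: a + (1 - t) *: b) = t *: (p0 - a) + (1 - t) *: (p0 - b).
    by rewrite !scalerBr addrACA -scalerDl [t + _]addrC subrK scale1r opprD.
  apply: (le_lt_trans (ler_normD _ _)); rewrite !normrZ (ger0_norm t0) (@ger0_norm _ (1 - t)) ?subr_ge0//.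
  apply: (@le_lt_trans _ _ (Num.max `|p0 - a| `|p0 - b|)); last by rewrite gt_max ba bb.
  have m1 : `|p0 - a| <= Num.max `|p0 - a| `|p0 - b| by rewrite le_max lexx.
  have m2 : `|p0 - b| <= Num.max `|p0 - a| `|p0 - b| by rewrite le_max lexx orbT.
  move: m1 m2; move: (Num.max _ _) => m m1 m2; nra.
set y := b + _ in h1 h2 *.
have -> : 'D_(a - b) h y = (a - b).1 * 'D_e1 h y + (a - b).2 * 'D_e2 h y.
  rewrite -!derive_scaledir// -derive_adddir//; congr ('D_ _ h y).
  by case: (a - b) => u v; congr (_, _); rewrite /= /GRing.scale/= ?mulr1 ?mulr0 ?addr0 ?add0r.
apply: (le_trans (ler_normD _ _)); rewrite !normrM /L mulrDl.
have n1 : `|(a - b).1| <= `|a - b| by rewrite [leRHS]prod_normE le_max lexx.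
have n2 : `|(a - b).2| <= `|a - b| by rewrite [leRHS]prod_normE le_max lexx orbT.
by apply: lerD; rewrite mulrC ler_pM.
Qed.

Lemma cone_pieceS U V V' n eta : open V' -> V' `<=` V -> cone_piece U V n eta -> cone_piece U V' n eta.
Proof.
by move=> oV' VV' [oV e0 h]; split => // x lam z /VV'; exact: h.
Qed.

Definition lin (Q : 'M[R]_3) x (i : 'I_3) : R := \sum_(j < 3) Q i j * component j x.

Lemma componentD (j : 'I_3) x y : component j (x + y) = component j x + component j y.
Proof. by rewrite /component; case: ifP => // _; case: ifP. Qed.

Lemma componentZ (j : 'I_3) (c : R) x : component j (c *: x) = c * component j x.
Proof. by rewrite /component; case: ifP => // _; case: ifP. Qed.

Lemma linD Q x y i : lin Q (x + y) i = lin Q x i + lin Q y i.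
Proof. by rewrite /lin -big_split; apply: eq_bigr => j _; rewrite componentD mulrDr. Qed.

Lemma linZ Q (c : R) x i : lin Q (c *: x) i = c * lin Q x i.
Proof. by rewrite /lin mulr_sumr; apply: eq_bigr => j _; rewrite componentZ mulrCA. Qed.

Definition qn (Q : 'M[R]_3) : R := \sum_(i < 3) \sum_(j < 3) `|Q i j|.

Lemma lin_le Q x i : `|lin Q x i| <= qn Q * `|x|.
Proof.
apply: (le_trans (ler_norm_sum _ _ _)); rewrite /qn [in leRHS](bigD1 i)//= mulrDl mulr_suml.
apply: (@le_trans _ _ (\sum_(i0 < 3) `|Q i i0| * `|x|)).
  by apply: ler_sum => j _; rewrite normrM ler_wpM2l// component_le.
by rewrite lerDl mulr_ge0// sumr_ge0// => k _; rewrite sumr_ge0.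
Qed.

Lemma euclid_le x : euclid x <= 2 * `|x|.
Proof.
rewrite /euclid -[leRHS]ger0_norm ?mulr_ge0// -sqrtr_sqr ler_wsqrtr//.
rewrite exprMn.
apply: (@le_trans _ _ (\sum_(i < 3) `|x| ^+ 2)).
  apply: ler_sum => i _; rewrite -real_normK ?num_real// lerXn2r ?nnegrE//.
  exact: component_le.
rewrite sumr_const card_ord -[leLHS]mulr_natl ler_wpM2r ?sqr_ge0//; lra.
Qed.

(** Interior points are covered by [cone_interior]. At a boundary point, in the rotated coordinates,
    U lies above a graph that is Lipschitz nearby, and n points straight up. The displacement lam n
    raises a point by lam c, while z in the cube of side lam eta changes each rotated coordinate by
    at most q lam eta; (L + 1) q eta <= c then keeps the point above the graph. *)
Lemma class_C2_cone (beta : R) U : open U -> class_C2 beta U -> has_cone U.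
Proof.
move=> oU CU x0 cx0.
have [Ux0|nUx0] := pselect (U x0).
  have [rho /= rho0 bU] : nbhs_ball x0 U by apply/nbhs_ballP; move: oU; rewrite openE; exact.
  exists (rho / 3), (diag (- (2 * rho / 3))), (4 * rho / 3); split; first by rewrite divr_gt0.
  apply: cone_pieceS (cone_interior rho0 bU); last by move=> x [].
  by apply: openI => //; exact: ball_open.
have bx0 : boundary U x0 by split => // /interior_subset.
have [r0 [Q [h [r00 QQ [Ch _] hU]]]] := CU _ bx0.
have hU' x : euclid (x - x0) < r0 -> U x <-> h (lin Q x 0, lin Q x 1) < lin Q x 2%:R := hU x.
have [L [delta [L0 delta0 hL]]] := C1_lipschitz (lin Q x0 0, lin Q x0 1) (CkW Ch).
set q := qn Q.
have q0 : 0 <= q by rewrite /q /qn sumr_ge0// => i _; rewrite sumr_ge0.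
have q1 : 0 < q + 1 by rewrite ltr_wpDl.
(* Small enough that points within s of x0 in the maximum norm lie in the Euclidean ball of radius
   r0, by [euclid_le], and that their first two rotated coordinates lie where h is Lipschitz. *)
pose s := Num.min (r0 / 2) (delta / (q + 1)).
have s0 : 0 < s by rewrite lt_min !divr_gt0.
have sr : 2 * s <= r0 by rewrite mulrC -ler_pdivlMr// ge_min lexx.
have sd : q * s < delta.
  apply: (@lt_le_trans _ _ ((q + 1) * s)); first by rewrite ltr_pM2r// ltrDl.
  by rewrite mulrC -ler_pdivlMr// ge_min lexx orbT.
(* The norm of n is at most c q, hence at most s / 3. Together with s / 3 for x - x0 and s / 3 for
   z, the displaced point stays within s of x0. *)
pose c := s / (3 * (q + 1)).
have c0 : 0 < c by rewrite divr_gt0// mulr_gt0.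
have c1 : c * (3 * (q + 1)) = s by rewrite /c divfK// gt_eqF// mulr_gt0.
pose n : @R3 R := c *: vec (fun j => Q 2%:R j).
have cvec (f : 'I_3 -> R) j : component j (vec f) = f j.
  rewrite /component /vec; case: ifPn => [/eqP ->//|j0]; case: ifPn => [/eqP ->//|j1] /=.
  congr f; apply: val_inj; case: j j0 j1 => -[|[|[|]]] //.
have nn : `|n| <= c * q.
  rewrite /n normrZ (gtr0_norm c0) ler_pM2l//.
  have H j : `|Q 2%:R j| <= q.
    rewrite /q /qn (bigD1 2%:R)//= (bigD1 j)//= -addrA lerDl addr_ge0// ?sumr_ge0// => i _.
    by rewrite sumr_ge0.
  by rewrite !prod_normE /= !ge_max !H.
(* n is c times the third row of Q, and the rows of Q are orthonormal. *)
have Qn i : lin Q n i = c * (i == 2%:R)%:R.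
  rewrite /n linZ; congr (c * _); rewrite /lin.
  have := congr1 (fun M : 'M[R]_3 => M i 2%:R) QQ; rewrite !mxE => <-.
  by apply: eq_bigr => j _; rewrite cvec mxE.
(* The first bound keeps z below s / 3; the second makes the rise lam c outweigh both the vertical
   part of z and L times its horizontal part. *)
pose eta := Num.min (s / 3) (c / ((L + 1) * (q + 1))).
have L1 : 0 < L + 1 by rewrite ltr_wpDl.
have eta0 : 0 < eta by rewrite lt_min !divr_gt0// mulr_gt0.
have eta1 : eta <= s / 3 by rewrite ge_min lexx.
have eta2 : eta * ((L + 1) * (q + 1)) <= c.
  by rewrite -ler_pdivlMr ?mulr_gt0// ge_min lexx orbT.
exists (s / 3), n, eta; split; first by rewrite divr_gt0.
split => //; first by apply: openI => //; exact: ball_open.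
move=> x lam z [Ux bx] /andP[l0 l1] cz; set x' := x + _.
have nx : `|x - x0| < s / 3 by move: bx; rewrite -ball_normE /ball_/= distrC.
have nz : `|z| <= lam * eta by exact: cube_norm.
have nx' : `|x' - x0| < s.
  have -> : x' - x0 = (x - x0) + (lam *: n + z) by rewrite /x' addrAC.
  have h1 : `|lam *: n| <= s / 3.
    rewrite normrZ ger0_norm// (le_trans (_ : _ <= 1 * `|n|))//; first by rewrite ler_wpM2r.
    rewrite mul1r (le_trans nn)//; nra.
  have h2 : `|z| <= s / 3.
    apply: (le_trans nz); apply: le_trans eta1; rewrite -[leRHS]mul1r ler_wpM2r// ltW//.
  apply: (le_lt_trans (ler_normD _ _)); have := ler_normD (lam *: n) z.
  lra.
have nxs : `|x - x0| < s by apply: lt_le_trans nx _; rewrite ler_pdivrMr// ler_peMr ?ltW//; lra.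
have E w : `|w - x0| < s -> euclid (w - x0) < r0.
  move=> ws; apply: (le_lt_trans (euclid_le _)); apply: lt_le_trans sr.
  by rewrite ltr_pM2l.
have B w : `|w - x0| < s -> ball (lin Q x0 0, lin Q x0 1) delta (lin Q w 0, lin Q w 1).
  move=> ws; have H i : `|lin Q x0 i - lin Q w i| < delta.
    have -> : lin Q x0 i - lin Q w i = - lin Q (w - x0) i.
      have -> : lin Q (w - x0) i = lin Q w i + (-1) * lin Q x0 i by rewrite -linZ scaleN1r -linD.
      by ring.
    rewrite normrN; apply: (le_lt_trans (lin_le _ _ _)); apply: le_lt_trans sd.
    by rewrite ler_wpM2l// ltW.
  by split; exact: H.
apply/(hU' _ (E _ nx')).
have := (hU' _ (E _ nxs)).1 Ux.
have := hL _ _ (B _ nx') (B _ nxs).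
have Ex' i : lin Q x' i = lin Q x i + (lam * (c * (i == 2%:R)%:R) + lin Q z i).
  by rewrite /x' !linD linZ Qn.
have lz i : `|lin Q z i| <= q * (lam * eta).
  by apply: (le_trans (lin_le _ _ _)); rewrite ler_wpM2l.
have -> : `|(lin Q x' 0, lin Q x' 1) - (lin Q x 0, lin Q x 1)| = Num.max `|lin Q z 0| `|lin Q z 1|.
  have e0 : lin Q x' 0 - lin Q x 0 = lin Q z 0 by rewrite Ex' /= !mulr0; ring.
  have e1 : lin Q x' 1 - lin Q x 1 = lin Q z 1 by rewrite Ex' /= !mulr0; ring.
  by rewrite prod_normE /= e0 e1.
have : Num.max `|lin Q z 0| `|lin Q z 1| <= q * (lam * eta) by rewrite ge_max !lz.
rewrite [lin Q x' 2%:R]Ex' eqxx mulr1.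
have := lz 2%:R; rewrite ler_norml => /andP[hz _].
move: (Num.max _ _) => m hm /ler_normlP[_ hh] hx.
have hm2 : L * m <= L * (q * (lam * eta)) by rewrite ler_wpM2l.
have le0 : 0 <= lam * eta by rewrite mulr_ge0// ltW.
have k1 : lam * (eta * ((L + 1) * (q + 1))) <= lam * c by rewrite ler_wpM2l.
have k2 : (L + 1) * (q * (lam * eta)) <= lam * (eta * ((L + 1) * (q + 1))).
  rewrite [leRHS](_ : _ = (L + 1) * (q * (lam * eta)) + (L + 1) * (lam * eta)); last by ring.
  by rewrite lerDl mulr_ge0// ltW.
lra.
Qed.

End ConeProperty.

(** * Faber-Krahn inequality on the domain *)

Section GlobalFaberKrahn.
Context {R : realType}.
Implicit Types (U S : set (@R3 R)) (x : @R3 R) (G : 'I_3 -> @R3 R -> R) (lam : R).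

Definition FKs U S := measurable S /\ exists c0 C : R, [/\ 0 < c0, 0 <= C &
  forall lam (v : @R3 R -> R) G, 0 < lam <= 1 -> L2f v -> (forall i, L2f (G i)) -> wgr U v G ->
    (@leb3 R [set x | v x != 0%R] <= (c0 * lam ^+ 3)%:E)%E ->
    n2 (fun x => \1_S x * v x) <= C * lam ^+ 2 * en G].

Lemma FKs_union U S T : FKs U S -> FKs U T -> FKs U (S `|` T).
Proof.
move=> [mS [c [C [c0 C0 hS]]]] [mT [c' [C' [c0' C0' hT]]]]; split; first exact: measurableU.
exists (Num.min c c'), (C + C'); split; [by rewrite lt_min c0|exact: addr_ge0|].
move=> lam v G l01 Lv LG wG hv.
have l3 : 0 <= lam ^+ 3 by rewrite exprn_ge0//; case/andP: l01 => /ltW.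
have h1 : n2 (fun x => \1_S x * v x) <= C * lam ^+ 2 * en G.
  apply: hS => //; apply: (le_trans hv); rewrite lee_fin ler_wpM2r// ge_min lexx//.
have h2 : n2 (fun x => \1_T x * v x) <= C' * lam ^+ 2 * en G.
  apply: hT => //; apply: (le_trans hv); rewrite lee_fin ler_wpM2r// ge_min lexx orbT//.
rewrite !mulrDl; apply: le_trans (lerD h1 h2).
have LS := L2f_ind mS Lv; have LT := L2f_ind mT Lv.
have LU := L2f_ind (measurableU _ _ mS mT) Lv.
rewrite /n2 -Rint3D; [|exact: LS.2|exact: LT.2].
apply: Rint3_le; [exact: LU.2|by apply: int3D; [exact: LS.2|exact: LT.2]|move=> x].
rewrite !exprMn !indic_sq !indicE in_setU.
case: (x \in S); case: (x \in T); rewrite /= ?(mulr0, mul0r, mulr1, mul1r, addr0, add0r)//.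
by rewrite lerDl sqr_ge0.
Qed.

(** The estimates add up over finite unions, so compactness of the closure alone leads from the
    local inequality to the global one; in contrast to Poincare's inequality, no constants have to
    be compared along a chain. *)
Lemma faber_krahn_whole U : open U -> compact (closure U) -> has_cone U ->
  exists c0 C : R, [/\ 0 < c0, 0 <= C &
  forall lam (v : @R3 R -> R) G, 0 < lam <= 1 -> L2f v -> (forall i, L2f (G i)) -> wgr U v G ->
    (@leb3 R [set x | v x != 0%R] <= (c0 * lam ^+ 3)%:E)%E ->
    n2 (fun x => \1_U x * v x) <= C * lam ^+ 2 * en G].
Proof.
move=> oU kU hU.
pose F (S : set (set (@R3 R))) := exists2 E0, FKs U E0 & forall E, FKs U E -> E0 `<=` E -> S E.
have FF : Filter F.
  split.
  - exists set0 => //; split => //; exists 1, 0; split => //.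
    move=> lam v G _ _ _ _ _; rewrite !mul0r /n2.
    under eq_Rintegral do rewrite indicE in_set0 mul0r expr0n.
    by rewrite /Rintegral integral0.
  - move=> S T [E gE hE] [E' gE' hE']; exists (E `|` E'); first exact: FKs_union.
    move=> D gD sD; split.
      by apply: hE => // t Et; apply: sD; left.
    by apply: hE' => // t Et; apply: sD; right.
  - by move=> S T ST [E gE hE]; exists E => // D gD sD; apply: ST; exact: hE.
have /compact_near_coveringP nc := kU.
have [x cx|E0 gE0 hE0] := nc _ F (fun E x => U x -> E x) FF; last first.
  have h := hE0 E0 gE0 (fun _ h => h).
  have [mE [c [C [c0 C0 hE]]]] := gE0; exists c, C; split => //.
  move=> lam v G l01 Lv LG wG hv; apply: le_trans (hE lam v G l01 Lv LG wG hv).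
  have LE := L2f_ind mE Lv; have LU := L2f_ind (open_measurable3 oU) Lv.
  apply: (n2_le _ _ LE); first exact: LU.1.
  move=> x; rewrite !normrM ler_wpM2r// !indicE.
  case: (boolP (x \in U)) => [|_]; last by rewrite normr0.
  rewrite inE => Ux; rewrite mem_set//; apply: h => //; exact: subset_closure.
have [r [n [eta [r0 cp]]]] := hU x cx; have [oV eta0 _] := cp.
exists (ball x r, [set D | FKs U D /\ U `&` ball x r `<=` D]).
  split; first exact: nbhsx_ballx.
  exists (U `&` ball x r); last by move=> E gE sE; split.
  split; first exact: open_measurable3.
  exists (eta ^+ 3 / 2), (6 * (`|n| + eta) ^+ 2); split.
  - by rewrite divr_gt0// exprn_gt0.
  - by rewrite mulr_ge0// sqr_ge0.
  move=> lam v G l01 Lv LG wG hv.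
  have hv' : (@leb3 R [set x | v x != 0%R] <= ((lam * eta) ^+ 3 / 2)%:E)%E.
    by apply: (le_trans hv); rewrite lee_fin exprMn le_eqVlt; apply/orP; left; apply/eqP; ring.
  apply: (le_trans (faber_krahn cp l01 Lv LG wG hv')).
  by rewrite exprMn le_eqVlt; apply/orP; left; apply/eqP; ring.
by move=> [x' D] [/= bx' [gD sD]] Ux'; apply: sD.
Qed.

End GlobalFaberKrahn.

(** * Chain rule for weak derivatives *)

Section ChainRule.
Context {R : realType}.
Implicit Types (U V : set (@R3 R)) (f g z : @R3 R -> R) (d v x y : @R3 R) (phi : @R3 R -> R).

(** By [avg_test] the difference is the average over t, with the weight [chi] of total mass 1, of
    the differences bounded in the hypothesis. *)
Lemma avg_test_close g z d (B : R) : L2f g -> L2f z ->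
  (forall t, 0 <= t <= 1 ->
    `|\int[@leb3 R]_y (g y * z (y - t *: d)) - \int[@leb3 R]_y (g y * z y)| <= B) ->
  `|\int[@leb3 R]_x (avg g d x * z x) - \int[@leb3 R]_x (g x * z x)| <= B.
Proof.
move=> Lg Lz hB; have [-> i1] := avg_test d Lg Lz.
set c := \int[@leb3 R]_x (g x * z x).
have B0 : 0 <= B by apply: le_trans (hB 0 _) => //; rewrite lexx ler01.
have ic : (@leb R).-integrable setT (EFin \o (fun t => chi t * c)).
  exact: integrableZr integrable_chi.
have iB : (@leb R).-integrable setT (EFin \o (fun t => chi t * B)).
  exact: integrableZr integrable_chi.
rewrite -[c in X in `|X|]Rint_chi_cst -RintegralB//.
have iD : (@leb R).-integrable setT (EFin \o (fun t => chi t * \int[@leb3 R]_y (g y * z (y - t *: d)) - chi t * c)).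
  exact: (integrableB measurableT i1 ic).
apply: (le_trans (le_normr_Rintegral _ iD)) => //.
rewrite -[leRHS]Rint_chi_cst; apply: le_Rintegral => //.
  exact: (integrable_norm (D := setT)).
move=> t _; rewrite -mulrBr normrM (ger0_norm (chi_ge0 t)) /chi indicE.
case: (boolP (t \in _)) => [|_]; last by rewrite !mul0r.
by rewrite inE/= in_itv/= => /hB; rewrite !mul1r.
Qed.

Lemma abs_le_sqr (a b : R) : 0 <= b -> a ^+ 2 <= b ^+ 2 -> `|a| <= b.
Proof. by move=> b0; rewrite -(real_normK (num_real a)) ler_sqr ?nnegrE. Qed.

Lemma n2_shift_test U phi d : Cinf_c U phi ->
  n2 (fun x => phi (x + d) - phi x) <= n2 ('D_d phi).
Proof.
move=> C; have [_ h] := L2_avg d (Cinf_c_L2f (Cinf_c_derive d C)).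
apply: le_trans h; rewrite le_eqVlt; apply/orP; left; apply/eqP; congr n2; apply/funext => x.
by rewrite (avg_derive d x C).
Qed.

Lemma n2_shift_dir U phi v (c : R) : Cinf_c U phi ->
  n2 (fun x => phi (x + c *: v) - phi x) <= c ^+ 2 * n2 ('D_v phi).
Proof.
move=> C; apply: (le_trans (n2_shift_test (c *: v) C)).
rewrite -n2Z; last exact: Cinf_c_L2f (Cinf_c_derive v C).
rewrite le_eqVlt; apply/orP; left; apply/eqP; congr n2; apply/funext => x.
apply: derive_scaledir; by have [_ /(_ v)[+ _]] := Cinf_c_Ck 1 C; apply.
Qed.

Lemma cs_sqrt f g (c K : R) : L2f f -> L2f g -> 0 <= c -> n2 f <= c ^+ 2 * K ->
  `|\int[@leb3 R]_x (f x * g x)| <= c * Num.sqrt (K * n2 g).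
Proof.
move=> Lf Lg c0 hf; apply: abs_le_sqr; first by rewrite mulr_ge0// sqrtr_ge0.
have [c00|cn] := eqVneq c 0.
  rewrite c00 mul0r expr0n/=; apply: (le_trans (L2f_cauchy_schwarz Lf Lg)).
  by move: hf; rewrite c00 expr0n mul0r => hf; rewrite mulr_le0_ge0 ?n2_ge0.
have K0 : 0 <= K.
  by move: (le_trans (n2_ge0 f) hf); rewrite pmulr_rge0// exprn_gt0// lt_def cn.
rewrite exprMn sqr_sqrtr ?mulr_ge0 ?n2_ge0//.
apply: (le_trans (L2f_cauchy_schwarz Lf Lg)); rewrite mulrA.
by rewrite ler_wpM2r ?n2_ge0.
Qed.

Lemma Rint3_ae_eq f g : int3 f -> int3 g -> {ae leb3, forall x, f x = g x} ->
  \int[@leb3 R]_x f x = \int[@leb3 R]_x g x.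
Proof.
move=> i1 i2 h; apply/eqP; rewrite eq_le; apply/andP; split.
  apply: int3_ae_le => //; first exact: int3_measurable i1.
  by move: h; apply: filterS => x ->.
apply: int3_ae_le => //; first exact: int3_measurable i2.
by move: h; apply: filterS => x ->.
Qed.

Lemma Rint3_abs_le f g : int3 f -> int3 g -> (forall x, `|f x| <= g x) ->
  `|\int[@leb3 R]_x f x| <= \int[@leb3 R]_x g x.
Proof.
move=> i1 i2 h; apply: (le_trans (le_normr_Rintegral _ i1)) => //.
by apply: Rint3_le => //; exact: int3_norm.
Qed.

Lemma compact_margin U (K : set (@R3 R)) : open U -> compact K -> K `<=` U ->
  exists2 r : R, 0 < r & forall x, K x -> ball x r `<=` U.
Proof.
move=> oU /compact_near_coveringP kK KU.
have F : Filter ((0 : R)^'+) by exact: at_right_proper_filter.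
have [x Kx|r /= r0 hr] := kK _ _ (fun (r : R) x => ball x r `<=` U) F; last first.
  exists (r / 2); first by rewrite divr_gt0.
  apply: hr; rewrite /= ?divr_gt0// sub0r normrN gtr0_norm ?divr_gt0//.
  by rewrite ltr_pdivrMr// mulr_natr mulr2n ltrDl.
have [e /= e0 eU] : nbhs_ball x U by apply/nbhs_ballP; move: oU; rewrite openE; apply; exact: KU.
have e2 : 0 < e / 2 by rewrite divr_gt0.
exists (ball x (e / 2), `]-oo, (e / 2)[%classic).
  split; first exact: nbhsx_ballx.
  by apply: nbhs_right_lt.
move=> [y s] [/= by_ ]; rewrite in_itv/= => se z bz; apply: eU.
rewrite [e]splitr; apply: ball_triangle by_ _.
by apply: le_ball bz; exact: ltW.
Qed.

(* The increment of F(f) along h v, tested against phi, is expanded in two ways: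
   by moving the translation to phi, and by Taylor's formula for F. Both are
   accurate up to O(h^2), whence the identity after division by h. *)
Lemma wd_comp U v f g (F F1 : R -> R) (L : R) : open U ->
  measurable_fun setT F -> measurable_fun setT F1 -> 0 <= L ->
  (forall s, `|F s| <= `|s|) -> (forall s, `|F1 s| <= 1) ->
  (forall a b, `|F1 a - F1 b| <= L * `|a - b|) ->
  (forall a b, `|F b - F a - F1 a * (b - a)| <= L * (b - a) ^+ 2) ->
  L2f f -> L2f g -> wd U v f g -> wd U v (fun x => F (f x)) (fun x => F1 (f x) * g x).
Proof.
move=> oU mF mF1 L0 Fs F1s F1L FT Lf Lg wg phi C.
have LF : L2f (fun x => F (f x)) by apply: (L2f_le _ _ Lf) => //; exact: measurableT_comp mF Lf.1.
have bddL2 (b : @R3 R -> R) w : measurable_fun setT b -> (forall x, `|b x| <= 1) -> L2f w ->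
    L2f (fun x => b x * w x).
  move=> mb hb Lw; apply: (L2f_le _ _ Lw); first exact: measurable_funM Lw.1.
  by move=> x; rewrite normrM ler_piMl.
have mF1f : measurable_fun setT (fun x => F1 (f x)) by exact: measurableT_comp mF1 Lf.1.
have LG : L2f (fun x => F1 (f x) * g x) by exact: bddL2.
have Lphi := Cinf_c_L2f C.
have CD := Cinf_c_derive v C; have LD := Cinf_c_L2f CD.
have LDD := Cinf_c_L2f (Cinf_c_derive v CD).
pose zeta x := F1 (f x) * phi x.
have Lz : L2f zeta by exact: bddL2.
have [M M0 hM] := Cinf_c_bounded C.
have [_ [kK KU]] := C 0; set K := closure _ in kK KU.
have [r r0 rU] := compact_margin oU kK KU.
(* A neighbourhood of the support of phi whose points can be moved by less than r / 2 inside U, as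
   [wd_shift] asks. *)
pose V := \bigcup_(x in K) ball x (r / 2).
have oV : open V by apply: bigcup_open => x _; exact: ball_open.
have phiV x : ~ V x -> phi x = 0.
  move=> nV; apply/eqP; apply: contra_notT nV => nV; exists x; last by apply: ballxx; rewrite divr_gt0.
  exact: subset_closure.
have VU x w t : V x -> `|w| < r / 2 -> 0 <= t <= 1 -> U (x + t *: w).
  move=> [y Ky bx] wr /andP[t0 t1]; apply: (rU y Ky); rewrite [r]splitr; apply: ball_triangle bx _.
  rewrite -ball_normE /ball_/= opprD addrA subrr sub0r normrN normrZ ger0_norm//.
  by apply: le_lt_trans wr; rewrite ler_piMl.
have diff e c : `|e| < r / 2 -> e = c *: v ->
    {ae leb3, forall x, V x -> f (x + e) - f x = avg (fun x => c * g x) e x} /\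
    n2 (fun x => \1_V x * (f (x + e) - f x)) <= c ^+ 2 * n2 g.
  move=> er ec; have Lcg := L2fZ c Lg.
  have wcg : wd U e f (fun x => c * g x) by rewrite ec; exact: wdZ.
  have ae := wd_shift oV Lf Lcg wcg (fun x t Vx t01 => VU x e t Vx er t01); split => //.
  have [Lavg navg] := L2_avg e Lcg.
  have LI : L2f (fun x => \1_V x * (f (x + e) - f x)).
    by apply: L2f_ind; [exact: open_measurable3|apply: L2fB => //; exact: L2f_shift].
  rewrite -n2Z//; apply: le_trans navg; rewrite /n2.
  apply: int3_ae_le; [exact: int3_measurable LI.2|exact: Lavg.2|exact: LI.2|].
  move: ae; apply: filterS => x hx; rewrite indicE.
  case: (boolP (x \in V)) => [|_]; last by rewrite mul0r expr0n sqr_ge0.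
  by rewrite inE => /hx ->; rewrite mul1r.
(* Rates of the three errors in [key]: Ca for moving the translation onto phi, Cb for Taylor's
   formula, Cc for replacing the increment of f by h g. Kz h^2 bounds the squared norm of an
   increment of zeta, and X is the defect of the identity to be proved. *)
pose Ca := Num.sqrt (n2 ('D_v ('D_v phi)) * n2 (fun x => F (f x))).
pose Cb := L * M * n2 g.
pose Kz := 2 * n2 ('D_v phi) + 2 * (L ^+ 2 * M ^+ 2 * n2 g).
pose Cc := Num.sqrt (Kz * n2 g).
pose X := \int[@leb3 R]_x (F (f x) * 'D_v phi x) + \int[@leb3 R]_x (g x * zeta x).
have mV : measurable V by exact: open_measurable3.
have key h : 0 < h -> h * `|v| < r / 2 -> `|h * X| <= h * (h * (Ca + Cb + Cc)).
  move=> h0 hv; pose d := h *: v.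
  have normc c : `|c| <= h -> `|c *: v| < r / 2.
    by move=> ch; apply: le_lt_trans hv; rewrite normrZ ler_wpM2r.
  have LFd : L2f (fun x => F (f (x + d))) := L2f_shift d LF.
  have i1 : int3 (fun x => F (f (x + d)) * phi x) by exact: int3M.
  have i2 : int3 (fun x => F (f x) * phi x) by exact: int3M.
  pose A := \int[@leb3 R]_x ((F (f (x + d)) - F (f x)) * phi x).
  have Aa : `|A - - h * \int[@leb3 R]_x (F (f x) * 'D_v phi x)| <= h * (h * Ca).
    have Lps : L2f (fun x => - h * 'D_v phi x) by exact: L2fZ.
    have -> : A = \int[@leb3 R]_x (avg (fun x => - h * 'D_v phi x) (- d) x * F (f x)).
      rewrite /A; under eq_Rintegral do rewrite mulrBl.
      rewrite Rint3B//.
      have Lpd : L2f (fun x => phi (x + (- d))) := L2f_shift _ Lphi.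
      have i3 : int3 (fun x => F (f x) * phi (x + (- d))) by exact: int3M.
      have -> : \int[@leb3 R]_x (F (f (x + d)) * phi x) =
          \int[@leb3 R]_x (F (f x) * phi (x + (- d))).
        rewrite -(Rint3_shift d i3); apply: eq_Rintegral => x _; by rewrite addrK.
      rewrite -Rint3B//; apply: eq_Rintegral => x _; rewrite -mulrBr mulrC; congr (_ * _).
      rewrite -(avg_derive (- d) x C); congr (avg _ _ _); apply/funext => y.
      rewrite /d -scaleNr; apply: derive_scaledir.
      by have [_ /(_ v)[+ _]] := Cinf_c_Ck 1 C; apply.
    have -> : - h * \int[@leb3 R]_x (F (f x) * 'D_v phi x) =
        \int[@leb3 R]_x ((- h * 'D_v phi x) * F (f x)).
      rewrite -Rint3Z; last exact: int3M.
      by apply: eq_Rintegral => x _; ring.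
    apply: avg_test_close => // t /andP[t0 t1].
    have LFt : L2f (fun x => F (f (x + t *: d))) := L2f_shift _ LF.
    have Lpt : L2f (fun x => 'D_v phi (x + - (t *: d))) := L2f_shift _ LD.
    have iP : int3 (fun y => - h * 'D_v phi (y + - (t *: d)) * F (f y)).
      exact: int3M (L2fZ (- h) Lpt) LF.
    have -> : \int[@leb3 R]_y (- h * 'D_v phi y * F (f (y - t *: - d))) =
        \int[@leb3 R]_y (- h * 'D_v phi (y + - (t *: d)) * F (f y)).
      rewrite -(Rint3_shift (t *: d) iP).
      by apply: eq_Rintegral => x _; rewrite addrK scalerN opprK.
    rewrite -Rint3B; [|exact: iP|exact: int3M].
    under eq_Rintegral => x _.
      have -> : - h * 'D_v phi (x + - (t *: d)) * F (f x) - - h * 'D_v phi x * F (f x) =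
        - h * (('D_v phi (x + - (t *: d)) - 'D_v phi x) * F (f x)) by ring.
      over.
    rewrite /= Rint3Z; last by apply: int3M => //; exact: L2fB.
    rewrite normrM normrN (ger0_norm (ltW h0)) ler_pM2l//.
    apply: cs_sqrt => //; [exact: L2fB|exact: ltW|].
    rewrite /d scalerA -scaleNr; apply: (le_trans (n2_shift_dir v (- (t * h)) CD)).
    rewrite ler_wpM2r ?n2_ge0// sqrrN lerXn2r ?nnegrE ?mulr_ge0 ?(ltW h0)//.
    by rewrite ler_piMl// ltW.
  have d_lt : `|d| < r / 2 by apply: normc; rewrite gtr0_norm.
  have [aed n2d] := diff d h d_lt erefl.
  set D := (fun x => \1_V x * (f (x + d) - f x)) in n2d.
  have LfB : L2f (fun x => f (x + d) - f x) by apply: L2fB => //; exact: L2f_shift.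
  have LDd : L2f D by exact: L2f_ind.
  have Ab : `|A - \int[@leb3 R]_x (zeta x * D x)| <= h * (h * Cb).
    have iA : int3 (fun x => (F (f (x + d)) - F (f x)) * phi x) by apply: int3M => //; exact: L2fB.
    have izD : int3 (fun x => zeta x * D x) by exact: int3M.
    rewrite -Rint3B//.
    have -> : h * (h * Cb) = L * M * (h ^+ 2 * n2 g) by rewrite /Cb; ring.
    apply: (@le_trans _ _ (L * M * n2 D)); last by rewrite ler_wpM2l// mulr_ge0.
    rewrite /n2 -Rint3Z; last exact: LDd.2.
    apply: Rint3_abs_le; [exact: int3B|exact: int3Z LDd.2|move=> x].
    rewrite /zeta /D indicE; case: (boolP (x \in V)) => xV; last first.
      rewrite phiV ?mulr0 ?mul0r ?subr0 ?normr0 ?expr0n ?mulr0//.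
      by move=> Vx; move: xV; rewrite mem_set.
    rewrite !mul1r.
    have -> : (F (f (x + d)) - F (f x)) * phi x - F1 (f x) * phi x * (f (x + d) - f x) =
      (F (f (x + d)) - F (f x) - F1 (f x) * (f (x + d) - f x)) * phi x by ring.
    rewrite normrM mulrAC; apply: ler_pM => //.
  have Ac : `|\int[@leb3 R]_x (zeta x * D x) - h * \int[@leb3 R]_x (g x * zeta x)| <= h * (h * Cc).
    have Lhg := L2fZ h Lg.
    have [Lav _] := L2_avg d Lhg.
    have -> : \int[@leb3 R]_x (zeta x * D x) = \int[@leb3 R]_x (avg (fun x => h * g x) d x * zeta x).
      apply: Rint3_ae_eq; [exact: int3M|exact: int3M|].
      move: aed; apply: filterS => x hx; rewrite mulrC /D indicE.
      case: (boolP (x \in V)) => xV; first by rewrite mul1r hx//; exact: set_mem.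
      rewrite /zeta phiV ?mulr0//.
      by move=> Vx; move: xV; rewrite mem_set.
    rewrite -Rint3Z; last exact: int3M.
    under [X in _ - X]eq_Rintegral do rewrite mulrA.
    apply: avg_test_close => // t /andP[t0 t1].
    pose c := - (t * h); pose e := c *: v.
    have th : `|c| <= h.
      by rewrite normrN ger0_norm ?mulr_ge0 ?ler_piMl// ltW.
    have ee : - (t *: d) = e by rewrite /e /c /d scalerA scaleNr.
    rewrite ee.
    have [_ n2e] := diff e c (normc c th) erefl.
    have LfBe : L2f (fun x => f (x + e) - f x) by apply: L2fB => //; exact: L2f_shift.
    have LDe : L2f (fun x => \1_V x * (f (x + e) - f x)) by exact: L2f_ind.
    have Lze : L2f (fun x => zeta (x + e)) := L2f_shift e Lz.
    rewrite -Rint3B; [|exact: int3M|exact: int3M].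
    under eq_Rintegral => x _.
      have -> : h * g x * zeta (x + e) - h * g x * zeta x = h * ((zeta (x + e) - zeta x) * g x) by ring.
      over.
    rewrite /= Rint3Z; last by apply: int3M => //; exact: L2fB.
    rewrite normrM (ger0_norm (ltW h0)) ler_pM2l//.
    apply: cs_sqrt => //; [exact: L2fB|exact: ltW|].
    pose z1 x := F1 (f (x + e)) * (phi (x + e) - phi x).
    pose z2 x := (F1 (f (x + e)) - F1 (f x)) * phi x.
    have LpB : L2f (fun x => phi (x + e) - phi x) by apply: L2fB => //; exact: L2f_shift.
    have mF1e : measurable_fun setT (fun x => F1 (f (x + e))).
      exact: measurableT_comp mF1 (L2f_shift e Lf).1.
    have Lz1 : L2f z1 by exact: bddL2.
    have Lz2 : L2f z2.
      have -> : z2 = fun x => F1 (f (x + e)) * phi x - F1 (f x) * phi x by apply/funext => x; rewrite /z2 mulrBl.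
      by apply: L2fB; exact: bddL2.
    have -> : (fun x => zeta (x + e) - zeta x) = (fun x => z1 x + z2 x).
      by apply/funext => x; rewrite /zeta /z1 /z2; ring.
    apply: (le_trans (n2D Lz1 Lz2)).
    have ch2 : c ^+ 2 <= h ^+ 2.
      by rewrite /c sqrrN lerXn2r ?nnegrE ?mulr_ge0 ?(ltW h0)// ler_piMl// ltW.
    have -> : h ^+ 2 * Kz = 2 * (h ^+ 2 * n2 ('D_v phi)) + 2 * ((L * M) ^+ 2 * (h ^+ 2 * n2 g)).
      by rewrite /Kz; ring.
    apply: lerD; rewrite ler_pM2l//.
      apply: (@le_trans _ _ (n2 (fun x => phi (x + e) - phi x))).
        by apply: n2_le LpB; [exact: Lz1.1|move=> x; rewrite /z1 normrM ler_piMl].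
      apply: (le_trans (n2_shift_dir v c C)).
      by rewrite ler_wpM2r// n2_ge0.
    apply: (@le_trans _ _ ((L * M) ^+ 2 * n2 (fun x => \1_V x * (f (x + e) - f x)))); last first.
      apply: ler_wpM2l; first exact: sqr_ge0.
      apply: (le_trans n2e).
      by rewrite ler_wpM2r// n2_ge0.
    rewrite -n2Z//; apply: n2_le; [exact: Lz2.1| |exact: L2fZ].
    move=> x; rewrite /z2 indicE; case: (boolP (x \in V)) => xV; last first.
      rewrite phiV ?mulr0 ?normr0//.
      by move=> Vx; move: xV; rewrite mem_set.
    rewrite mul1r !normrM (ger0_norm L0) (ger0_norm M0) mulrAC; apply: ler_pM => //.
  have -> : h * X = (A - - h * \int[@leb3 R]_x (F (f x) * 'D_v phi x)) -
      (A - \int[@leb3 R]_x (zeta x * D x)) -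
      (\int[@leb3 R]_x (zeta x * D x) - h * \int[@leb3 R]_x (g x * zeta x)).
    by rewrite /X; ring.
  rewrite !mulrDr; apply: (le_trans (ler_normB _ _)); apply: lerD => //.
  by apply: (le_trans (ler_normB _ _)); apply: lerD.
suff X0 : X = 0.
  move/eqP: X0; rewrite /X addr_eq0 => /eqP ->; congr (- _).
  by apply: eq_Rintegral => x _; rewrite /zeta; ring.
apply/eqP; rewrite -normr_eq0; apply/eqP/le_anti; rewrite normr_ge0 andbT.
pose S := Ca + Cb + Cc.
have S0 : 0 <= S.
  by rewrite !addr_ge0 ?sqrtr_ge0// !mulr_ge0// n2_ge0.
apply/ler_addgt0Pr => e e0; rewrite add0r.
pose h := Num.min (r / 2 / (`|v| + 1)) (e / (S + 1)).
have v1 : 0 < `|v| + 1 by rewrite ltr_wpDl.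
have S1 : 0 < S + 1 by rewrite ltr_wpDl.
have h0 : 0 < h by rewrite lt_min !divr_gt0.
have hv : h * `|v| < r / 2.
  apply: (@lt_le_trans _ _ (h * (`|v| + 1))); first by rewrite ltr_pM2l// ltrDl.
  by rewrite -ler_pdivlMr// ge_min lexx.
have := key h h0 hv; rewrite normrM gtr0_norm// ler_pM2l// => hX.
apply: (le_trans hX); apply: (@le_trans _ _ (h * (S + 1))).
  by rewrite ler_pM2l// lerDl.
by rewrite -ler_pdivlMr// ge_min lexx orbT.
Qed.

End ChainRule.

(** * Bounds almost everywhere from the norm of L^oo *)

Section EssentialBound.
Context d (T : measurableType d) (R : realType) (mu : {measure set T -> \bar R}).

Lemma Lfun_measurable p (f : T -> R) : f \in Lfun mu p -> measurable_fun setT f.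
Proof. by rewrite inE => /andP[+ _]; rewrite inE. Qed.

Lemma Lfun_oo_bound (f : T -> R) : f \in Lfun mu +oo%E ->
  exists2 M, 0 <= M & {ae mu, forall x, `|f x| <= M}.
Proof.
rewrite inE => /andP[_]; rewrite inE/= /finite_norm unlock /=.
case: ifPn => [m0|]; last first.
  (* If the whole space is null the norm is 0 by convention, and the exceptional set may be
     everything. *)
  rewrite -leNgt => m0 _; exists 0 => //; exists setT; split => //.
  by apply/eqP; rewrite -measure_le0.
move=> sl; pose M := fine (ess_sup mu (abse \o (EFin \o f))).
have s0 : (0 <= ess_sup mu (abse \o (EFin \o f)))%E.
  by apply: ess_sup_gee => //; apply: aeW => x /=; rewrite lee_fin normr_ge0.
exists M; first exact: fine_ge0.
have := ess_sup_ge mu (abse \o (EFin \o f)).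
have FF : Filter (almost_everywhere mu) by exact: ae_filter_ringOfSetsType.
apply: filterS.
move=> x /=; by rewrite -[X in (_ <= X)%E]fineK ?ge0_fin_numE// lee_fin.
Qed.

End EssentialBound.

(** * Lipschitz continuity of the viscosity *)

Section LipschitzRepresentative.
Context {R : realType}.
Implicit Types (a b x y z e : R) (m f : R -> R).

Let mu := @leb R.

(** A zero integral would make the bump vanish almost everywhere, but it is positive on ]a, b[,
    which has positive measure. *)
Lemma bump1_integral_gt0 a b : a < b ->
  mu.-integrable setT (EFin \o bump1 a b) /\ 0 < \int[mu]_x bump1 a b x.
Proof.
move=> ab; have mb : measurable_fun setT (bump1 a b).
  by apply: continuous_measurable_fun; exact: Ck_continuous (Ck_bump1 0 a b).
have out x : ~ `[a, b]%classic x -> bump1 a b x = 0.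
  move=> nx; apply/eqP; apply: contra_notT nx => nx.
  have /andP[b0 _] := bump1_itv a b x.
  have : 0 < bump1 a b x by rewrite lt_def nx.
  by rewrite bump1_gt0 /= in_itv/= => /andP[/ltW -> /ltW ->].
have ib : mu.-integrable setT (EFin \o bump1 a b).
  have i1 : mu.-integrable setT (EFin \o (\1_`[a, b]%classic : R -> R)).
    exact: (@integrable_indic_itv R a b true false).
  apply: (le_integrable measurableT _ _ i1); first exact/measurable_EFinP.
  move=> x _ /=; rewrite lee_fin indicE ger0_norm; last by case/andP: (bump1_itv a b x).
  case: (boolP (x \in _)) => xab; first by rewrite normr1; apply: ltW; case/andP: (bump1_itv a b x).
  by rewrite out ?normr0// => h; move: xab; rewrite mem_set.
split => //; rewrite lt_def Rintegral_ge0 ?andbT; last first.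
  by move=> x _; case/andP: (bump1_itv a b x).
apply/eqP => h0.
have h1 : (\int[mu]_(x in setT) `|(bump1 a b x)%:E| = 0)%E.
  under eq_integral => x _ do rewrite gee0_abs ?lee_fin ?(proj1 (andP (bump1_itv a b x)))//.
  by apply/eqP; rewrite -[X in X == _]fineK ?integrable_fin_num// eqe; apply/eqP.
have := (ae_eq_integral_abs mu measurableT (measurable_int _ ib)).1 h1.
move=> [N [mN N0 hN]].
have hle : (mu `]a, b[%classic <= mu N)%E.
  apply: le_measure; rewrite ?inE//.
  move=> x; rewrite /= in_itv/= => xab; apply: hN => /= /(_ I) [] h.
  by move: xab; rewrite -bump1_gt0 h ltxx.
have := eq_ind _ (fun t => (mu `]a, b[%classic <= t)%E) hle _ N0.
rewrite /mu /leb lebesgue_measure_itv/= lte_fin ab => h.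
by move: h; rewrite lee_fin subr_le0 leNgt ab.
Qed.

Lemma integrable_measurable f : mu.-integrable setT (EFin \o f) -> measurable_fun setT f.
Proof. by move=> fi; apply/measurable_EFinP; exact: measurable_int fi. Qed.

Lemma integrable_bounded_mul f m c e : mu.-integrable setT (EFin \o f) -> measurable_fun setT m ->
  (forall x, 0 <= f x) -> (forall x, f x != 0 -> `|m x - c| <= e) ->
  mu.-integrable setT (EFin \o (fun x => m x * f x)) /\
  `|\int[mu]_x (m x * f x) - c * \int[mu]_x f x| <= e * \int[mu]_x f x.
Proof.
move=> fi mm f0 hm.
have mf := integrable_measurable fi.
have bd x : `|(m x - c) * f x| <= e * f x.
  rewrite normrM (ger0_norm (f0 x)); have [->|/hm h] := eqVneq (f x) 0; first by rewrite !mulr0.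
  by rewrite ler_wpM2r.
have ic : mu.-integrable setT (EFin \o (fun x => c * f x)) by exact: (integrableZl measurableT c fi).
have ie : mu.-integrable setT (EFin \o (fun x => e * f x)) by exact: (integrableZl measurableT e fi).
have i1 : mu.-integrable setT (EFin \o (fun x => (m x - c) * f x)).
  apply: (le_integrable measurableT _ _ ie).
    by apply/measurable_EFinP; apply: measurable_funM => //; exact: measurable_funB.
  by move=> x _ /=; rewrite lee_fin; apply: (le_trans (bd x)); exact: ler_norm.
have E : (fun x => m x * f x) = (fun x => (m x - c) * f x + c * f x) by apply/funext => x; ring.
have i2 : mu.-integrable setT (EFin \o (fun x => m x * f x)).
  by rewrite E; exact: (integrableD measurableT i1 ic).
split => //.
rewrite -(RintegralZl c measurableT fi) -(RintegralZl e measurableT fi) -(RintegralB measurableT i2 ic).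
under [X in `|X|]eq_Rintegral do rewrite -mulrBl.
apply: (le_trans (le_normr_Rintegral measurableT i1)).
by apply: le_Rintegral => //; exact: (integrable_norm (D := setT)).
Qed.

(** An approximate Dirac mass and its primitive, a smooth Heaviside function. *)
Lemma smooth_step a b : a < b -> exists psi Psi : R -> R,
  [/\ forall n, Ck n setT psi /\ Ck n setT Psi, forall x, 'D_1 Psi x = psi x,
    mu.-integrable setT (EFin \o psi) /\ \int[mu]_x psi x = 1,
    forall x, 0 <= psi x /\ (psi x != 0 -> a < x < b) &
    forall x, [/\ 0 <= Psi x <= 1, x <= a -> Psi x = 0 & b <= x -> Psi x = 1]].
Proof.
move=> ab; have [ib c0] := bump1_integral_gt0 ab; set c := Rintegral _ _ _ in c0.
pose psi x := c^-1 * bump1 a b x.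
have Cpsi n : Ck n setT psi by apply: CkM; [exact: Ck_cst|exact: Ck_bump1].
have ipsi : mu.-integrable setT (EFin \o psi) by exact: (integrableZl measurableT c^-1 ib).
have psi0 x : 0 <= psi x by rewrite mulr_ge0 ?invr_ge0 ?(ltW c0)//; case/andP: (bump1_itv a b x).
have psi_out x : psi x != 0 -> a < x < b.
  rewrite -bump1_gt0 lt_def; case/andP: (bump1_itv a b x) => -> _; rewrite andbT.
  by apply: contra => /eqP; rewrite /psi => ->; rewrite mulr0.
have int1 : \int[mu]_x psi x = 1 by rewrite RintegralZl// mulVf// gt_eqF.
have ires (D : set R) : measurable D -> mu.-integrable setT (EFin \o (psi \_ D)).
  move=> mD; apply: (le_integrable measurableT _ _ ipsi).
    have -> : psi \_ D = (fun x => \1_D x * psi x).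
      by apply/funext => x; rewrite patchE indicE; case: ifP => _; rewrite ?mul1r ?mul0r.
    apply/measurable_EFinP; apply: measurable_funM; first exact: measurable_indic.
    exact: (integrable_measurable ipsi).
  move=> x _ /=; rewrite lee_fin patchE; case: ifP => // _; by rewrite normr0.
pose Psi x := \int[mu]_(t in `]-oo, x]) psi t.
have dP x : derivable Psi x 1 /\ derive1 Psi x = psi x.
  apply: (@continuous_FTC1 R psi -oo%O x (x + 1)).
  - by rewrite ltrDl.
  - apply: (integrableS measurableT) => //; exact: subsetT.
  - by rewrite ltNyr.
  - exact: Ck_continuous (Cpsi 0) x.
have DP : derive1 Psi = psi by apply/funext => x; exact: (dP x).2.
have CPS n : Ck n.+1 setT Psi by apply: Ck1S; [move=> x; exact: (dP x).1|rewrite DP].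
exists psi, Psi; split => //.
- by move=> n; split => //; exact: CkW.
- by move=> x; rewrite -derive1E DP.
- by move=> x; split => //; exact: psi_out.
move=> x.
have mx : measurable (`]-oo, x]%classic : set R) by [].
have -> : Psi x = \int[mu]_t (psi \_ `]-oo, x]) t by exact: Rintegral_mkcond.
split.
- apply/andP; split; first by apply: Rintegral_ge0 => t _; rewrite patchE; case: ifP.
  rewrite -int1; apply: le_Rintegral => //; first exact: ires.
  by move=> t _; rewrite patchE; case: ifP.
- move=> xa; have -> : psi \_ `]-oo, x] = cst 0.
    apply/funext => t; rewrite patchE; case: ifP => //; rewrite inE/= in_itv/= => tx.
    apply/eqP; apply: contraT => /psi_out /andP[+ _].
    by rewrite ltNge (le_trans tx xa).
  by rewrite Rintegral_cst// mul0r.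
- move=> bx; rewrite -int1; apply: eq_Rintegral => t _; rewrite patchE; case: ifPn => //.
  rewrite notin_setE/= in_itv/= => /negP; rewrite -ltNge => xt.
  apply/esym/eqP; apply: contraT => /psi_out /andP[_].
  by rewrite ltNge (le_trans bx (ltW xt)).
Qed.

Lemma dist01_le1 a b : 0 <= a <= 1 -> 0 <= b <= 1 -> `|a - b| <= 1.
Proof. by move=> /andP[? ?] /andP[? ?]; rewrite ler_norml; apply/andP; split; lra. Qed.

(* The test function increases from 0 to 1 near x and decreases back near y; its
   derivative concentrates at x and y, and its support has length close to y - x. *)
Lemma W1inf_line_lipschitz m : inW1inf_line m ->
  exists2 L, 0 <= L & forall x y, `|m x - m y| <= L * `|x - y|.
Proof.
move=> [cm _ [m' /[dup] /Lfun_measurable mm' /Lfun_oo_bound [L L0 hL] wm]].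
have mm : measurable_fun setT m by exact: continuous_measurable_fun.
exists L => //.
suff H x y : x <= y -> `|m x - m y| <= L * (y - x).
  move=> x y; have [xy|/ltW yx] := leP x y; first by rewrite [X in _ * X]distrC [X in _ * X]ger0_norm ?subr_ge0//; exact: H.
  by rewrite distrC [X in _ * X]ger0_norm ?subr_ge0//; exact: H.
move=> xy; apply/ler_addgt0Pr => e e0.
(* The total error has 2 e' from the continuity of m at x and y, and 2 L r <= 2 L e' from the excess
   length of the support. *)
pose e' := e / (2 + 2 * L).
have k0 : 0 < 2 + 2 * L by rewrite ltr_wpDr// mulr_ge0.
have e'0 : 0 < e' by rewrite divr_gt0.
have near_c z : exists2 r, 0 < r & forall t, `|t - z| < r -> `|m t - m z| <= e'.
  have /cvgrPdist_le /(_ e' e'0) /nbhs_ballP [r /= r0 hr] := cm z; exists r => // t tz.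
  by rewrite distrC; apply: hr; rewrite /ball/= distrC.
have [rx rx0 hx] := near_c x; have [ry ry0 hy] := near_c y.
pose r := Num.min e' (Num.min rx ry).
have r0 : 0 < r by rewrite !lt_min e'0 rx0.
have [re rrx rry] : [/\ r <= e', r <= rx & r <= ry] by rewrite !ge_min !lexx ?orbT.
have step z : z - r < z + r by rewrite ltrBlDr -addrA ltrDl addr_gt0.
have [p1 [P1 [C1 D1 [i1 I1] h1 H1]]] := smooth_step (step x).
have [p2 [P2 [C2 D2 [i2 I2] h2 H2]]] := smooth_step (step y).
(* The two steps overlap when y - x < 2 r; as a difference of two numbers in [0, 1], Phi is bounded
   by 1 all the same. *)
pose Phi z := P1 z + (-1) * P2 z.
have CPhi n : Ck n setT Phi by apply: CkD; [exact: (C1 n).2|apply: CkM; [exact: Ck_cst|exact: (C2 n).2]].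
have out z : ~ `[x - r, y + r]%classic z -> Phi z = 0.
  move=> nz; have : z < x - r \/ y + r < z.
    by have [|zx] := ltP z (x - r); [left|have [|zy] := ltP (y + r) z; [right|case: nz; rewrite /= in_itv/= zx]].
  have [_ l1 u1] := H1 z; have [_ l2 u2] := H2 z; rewrite /Phi; case=> zz.
    by rewrite l1 ?l2 ?mulr0 ?addr0//; [lra|exact: ltW].
  by rewrite u1 ?u2 ?mulr1 ?subrr//; [exact: ltW|lra].
have CcPhi : Cinf_c setT Phi.
  move=> n; split => //; split => //.
  apply: (@subclosed_compact _ _ `[x - r, y + r]%classic); [exact: closed_closure|exact: segment_compact|].
  have /closure_id -> : closed `[x - r, y + r]%classic by exact: itv_closed.
  by apply: closure_subset => z /eqP; apply: contra_notP => /out.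
have E := wm Phi CcPhi.
have DPhi z : 'D_1 Phi z = p1 z - p2 z.
  have dP1 : derivable P1 z 1 by apply: Ck_derivable; exact: (C1 1%N).2.
  have dP2 : derivable P2 z 1 by apply: Ck_derivable; exact: (C2 1%N).2.
  have -> : Phi = P1 \- P2 by apply/funext => t; rewrite /Phi mulN1r.
  by rewrite -D1 -D2; exact: deriveB dP1 dP2.
have hxp z : p1 z != 0 -> `|m z - m x| <= e'.
  move=> /(h1 z).2 xz; apply: hx; apply: lt_le_trans rrx.
  by rewrite ltr_distlC; case/andP: xz; lra.
have hyp z : p2 z != 0 -> `|m z - m y| <= e'.
  move=> /(h2 z).2 xz; apply: hy; apply: lt_le_trans rry.
  by rewrite ltr_distlC; case/andP: xz; lra.
have [j1 e1] := integrable_bounded_mul i1 mm (fun z => (h1 z).1) hxp.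
have [j2 e2] := integrable_bounded_mul i2 mm (fun z => (h2 z).1) hyp.
rewrite I1 !mulr1 in e1; rewrite I2 !mulr1 in e2.
have E' : \int[mu]_s (m s * p1 s) - \int[mu]_s (m s * p2 s) = - \int[mu]_s (m' s * Phi s).
  rewrite -E -(RintegralB measurableT j1 j2); apply: eq_Rintegral => z _.
  by rewrite DPhi mulrBr.
have bR : `|\int[mu]_s (m' s * Phi s)| <= L * (y - x + 2 * r).
  pose B := (fun z => L * \1_`[x - r, y + r] z) : R -> R.
  have ii : mu.-integrable setT (EFin \o (\1_`[x - r, y + r]%classic : R -> R)).
    exact: (@integrable_indic_itv R (x - r) (y + r) true false).
  have iB : mu.-integrable setT (EFin \o B) by exact: (integrableZl measurableT L ii).
  have mPhi : measurable_fun setT Phi.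
    by apply: continuous_measurable_fun; exact: Ck_continuous (CPhi 0%N).
  have Phi1 z : `|Phi z| <= \1_`[x - r, y + r] z.
    rewrite indicE; case: (boolP (z \in _)) => zi; last first.
      by rewrite out ?normr0// => h; move: zi; rewrite mem_set.
    by rewrite /Phi mulN1r; have [? _ _] := H1 z; have [? _ _] := H2 z; exact: dist01_le1.
  have aeB : {ae mu, forall z, `|m' z * Phi z| <= B z}.
    move: hL; apply: filterS => z hz; rewrite normrM /B; exact: ler_pM.
  have ip : mu.-integrable setT (EFin \o (fun s => m' s * Phi s)).
    apply/integrableP; split; first by apply/measurable_EFinP; exact: measurable_funM.
    apply: (@le_lt_trans _ _ (\int[mu]_x (B x)%:E)%E); last first.
      have /integrableP[_] := iB; apply: le_lt_trans.
      rewrite le_eqVlt; apply/orP; left; apply/eqP; apply: eq_integral => z _ /=.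
      by rewrite ger0_norm// mulr_ge0.
    apply: ae_ge0_le_integral => //.
    - by apply/measurable_EFinP; apply: measurableT_comp => //; exact: measurable_funM.
    - by move=> z _; rewrite lee_fin mulr_ge0.
    - exact: measurable_int iB.
    - by move: aeB; apply: filterS => z hz _; rewrite lee_fin.
  apply: (le_trans (le_normr_Rintegral measurableT ip)).
  have -> : L * (y - x + 2 * r) = \int[mu]_z B z.
    rewrite (RintegralZl L measurableT ii); congr (_ * _).
    rewrite /Rintegral integral_indic// setIT.
    transitivity (fine (@lebesgue_measure R `[x - r, y + r]%classic)); last by [].
    rewrite lebesgue_measure_itv/=.
    have -> : ((x - r)%:E < (y + r)%:E)%E by rewrite lte_fin (lt_le_trans (step x))// lerD2r.
    by rewrite -EFinB/=; ring.
  rewrite /Rintegral fine_le//.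
  - by apply: integrable_fin_num => //; exact: (integrable_norm (D := setT)).
  - exact: integrable_fin_num.
  apply: ae_ge0_le_integral => //.
  - by apply/measurable_EFinP; apply: measurableT_comp => //; exact: measurable_funM.
  - by move=> z _; rewrite lee_fin mulr_ge0.
  - exact: measurable_int iB.
  - by move: aeB; apply: filterS => z hz _; rewrite lee_fin.
have Lr : L * (2 * r) <= L * (2 * e') by rewrite ler_wpM2l// ler_pM2l.
have ee : e' * (2 + 2 * L) = e by rewrite /e' divfK// gt_eqF.
have -> : m x - m y = - (\int[mu]_s (m s * p1 s) - m x) + (\int[mu]_s (m s * p2 s) - m y)
   + (\int[mu]_s (m s * p1 s) - \int[mu]_s (m s * p2 s)) by ring.
rewrite E'; apply: (le_trans (ler_normD _ _)).
apply: (le_trans (lerD (ler_normD _ _) (lexx _))); rewrite !normrN.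
apply: (le_trans (lerD (lerD e1 e2) bR)).
have aux (l t : R) : L * (2 * r) <= t -> e' + e' + L * (l + 2 * r) <= L * l + (e' + e' + t).
  by rewrite mulrDr => h; lra.
rewrite -ee; apply: (le_trans (aux _ _ Lr)).
by rewrite le_eqVlt; apply/orP; left; apply/eqP; ring.
Qed.

End LipschitzRepresentative.

(** * Measurability and volume of the holes *)

Section Holes.
Context {R : realType}.
Implicit Types (U A : set (@R3 R)) (eps : R) (x y : @R3 R).

Lemma measurable_holes U A eps : measurable (holes U A eps).
Proof.
(* The indices are passed to finite functions, which form a countable type, so that the union is a
   countable one. *)
pose D (q : {ffun 'I_3 -> int}) : set (@R3 R) :=
  if `[< inner_cells U eps q >] then closure (small_hole A eps q) else set0.
have -> : holes U A eps = \bigcup_q D q.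
  apply/seteqP; split => [x [k kU kx]|x [q _]].
    have kE : (finfun k : 'I_3 -> int) = k by apply/funext => i; rewrite ffunE.
    by exists (finfun k) => //; rewrite /D kE; case: asboolP.
  by rewrite /D; case: asboolP => // qU qx; exists (q : 'I_3 -> int).
apply: countable_bigcupT_measurable; first exact: countableP.
move=> q; rewrite /D; case: asboolP => _; last exact: measurable0.
rewrite -[closure _]setCK; apply: measurableC; apply: open_measurable3.
by rewrite openC; exact: closed_closure.
Qed.

Lemma component_norm x i : `|component i x| <= euclid x.
Proof.
rewrite -sqrtr_sqr /euclid ler_wsqrtr// (bigD1 i)//= lerDl sumr_ge0// => j _; exact: sqr_ge0.
Qed.

Lemma component_node (k : 'I_3 -> int) i : component i (@node R k) = (k i)%:~R.
Proof. 
rewrite /component /node /vec /=; case: i => [[|[|[|//]]] i3] /=; congr ((k _)%:~R); exact/val_inj.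
Qed.

(** The intervals are centred at the multiples of eps from -n eps to n eps and have length eps^3 /
    4, twice the radius bound eps^3 / 8 of a hole. The product of three slabs contains all holes,
    which bounds their volume without counting or separating them. *)
Definition slab (n : nat) eps : set R :=
  \big[setU/set0]_(j < n.*2.+1)
    `[eps * (j%:Z - n%:Z)%:~R - eps ^+ 3 / 8, eps * (j%:Z - n%:Z)%:~R + eps ^+ 3 / 8]%classic.

Lemma slab_measurable n eps : measurable (slab n eps).
Proof. by apply: bigsetU_measurable => j _; exact: measurable_itv. Qed.

Lemma slab_leb n eps : 0 < eps -> (@leb R (slab n eps) <= (n.*2.+1%:R * (eps ^+ 3 / 4))%:E)%E.
Proof.
move=> e0; have e3 : 0 < eps ^+ 3 by rewrite exprn_gt0.
pose I (j : nat) : set R :=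
  `[eps * (j%:Z - n%:Z)%:~R - eps ^+ 3 / 8, eps * (j%:Z - n%:Z)%:~R + eps ^+ 3 / 8]%classic.
have lI j : @leb R (I j) = (eps ^+ 3 / 4)%:E.
  transitivity (@lebesgue_measure R (I j)); first by [].
  rewrite lebesgue_measure_itv/= lte_fin.
  have -> : eps * (j%:Z - n%:Z)%:~R - eps ^+ 3 / 8 < eps * (j%:Z - n%:Z)%:~R + eps ^+ 3 / 8.
    by move: e3; move: (eps * _) (eps ^+ 3) => a b b0; lra.
  by rewrite -EFinB; congr (_%:E); field.
have mI j : (j < n.*2.+1)%N -> measurable (I j) by move=> _; exact: measurable_itv.
have := @Boole_inequality _ _ _ (@leb R) I n.*2.+1 mI; move/le_trans; apply.
rewrite (eq_bigr (fun=> (eps ^+ 3 / 4)%:E)); last by move=> j _; exact: lI.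
by rewrite sumEFin lee_fin sumr_const card_ord mulr_natl.
Qed.

Lemma continuous_component i : continuous (fun x : @R3 R => component i x).
Proof.
have c1 : continuous (fun x : @R3 R => x.1) by move=> x; exact: cvg_fst.
have c2 : continuous (fun x : @R3 R => x.2) by move=> x; exact: cvg_snd.
have c11 : continuous (fun x : @R3 R => x.1.1).
  by move=> x; apply: continuous_comp; [exact: c1|exact: cvg_fst].
have c12 : continuous (fun x : @R3 R => x.1.2).
  by move=> x; apply: continuous_comp; [exact: c1|exact: cvg_snd].
by rewrite /component; case: (i == 0) => //; case: (i == 1).
Qed.

Lemma holes_slab U A eps (M : R) n : 0 < eps -> (forall x, U x -> `|x| <= M) -> M <= eps * n%:R ->
  (forall y, A y -> euclid y < 8^-1) ->
  holes U A eps `<=` (slab n eps `*` slab n eps) `*` slab n eps.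
Proof.
move=> e0 UM Mn A8 x [k kU kx].
have ek i : `|eps * (k i)%:~R| <= eps * n%:R.
  (* The node is the centre y = 0 of its cell, and the cell lies in U by [inner_cells]. *)
  have Uk : U (eps *: node k).
    have [_ sub] := kU; apply: sub; apply: subset_closure; exists 0; last by rewrite addr0.
    apply: subset_closure => i'; rewrite /component !if_same; apply/andP; split; rewrite ?oppr_lt0 invr_gt0 ltr0n//.
  apply: (le_trans _ Mn); apply: (le_trans _ (UM _ Uk)).
  by rewrite -component_node -componentZ component_le.
have near_k i : eps * (k i)%:~R - eps ^+ 3 / 8 <= component i x <= eps * (k i)%:~R + eps ^+ 3 / 8.
  pose B : set (@R3 R) := (fun x => component i x) @^-1`
    `[eps * (k i)%:~R - eps ^+ 3 / 8, eps * (k i)%:~R + eps ^+ 3 / 8]%classic.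
  have cB : closed B.
    by apply: closed_comp; [move=> z _; exact: continuous_component|exact: itv_closed].
  suff /(_ x kx) : closure (small_hole A eps k) `<=` B by rewrite /B /= in_itv.
  rewrite [X in _ `<=` X](iffLR (closure_id B) cB); apply: closure_subset.
  move=> _ [y Ay <-]; rewrite /B /= in_itv/= componentD !componentZ component_node.
  have := le_lt_trans (component_norm y i) (A8 y Ay); rewrite ltr_norml => /andP[h1 h2].
  have e3 : 0 < eps ^+ 3 by rewrite exprn_gt0.
  move: (eps * _) (eps ^+ 3) (component i y) e3 h1 h2 => a b c b0 h1 h2.
  by apply/andP; split; nra.
have inS i : slab n eps (component i x).
  have : `|k i| <= n%:Z.
    by move: (ek i); rewrite normrM gtr0_norm// ler_pM2l// -intr_norm -[n%:R]/(n%:Z%:~R) ler_int.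
  rewrite ler_norml => /andP[k1 k2].
  pose j := absz (k i + n%:Z).
  have jE : j%:Z = k i + n%:Z by rewrite /j gez0_abs//; lia.
  have jn : (j < n.*2.+1)%N by rewrite -ltz_nat jE; lia.
  rewrite /slab (bigD1 (Ordinal jn))//; left.
  by rewrite /= -/j jE addrK in_itv/=; exact: near_k.
split; [split|]; [exact: (inS 0)|exact: (inS 1)|exact: (inS 2%:R)].
Qed.

(** A slab consists of O(1 / eps) intervals of length eps^3 / 4, hence has measure O(eps^2); the
    product of three slabs gives eps^6. *)
Lemma holes_measure U A : bounded_set U -> (forall y, A y -> euclid y < 8^-1) ->
  exists2 c, 0 <= c & forall eps, 0 < eps <= 1 -> (@leb3 R (holes U A eps) <= (c * eps ^+ 6)%:E)%E.
Proof.
move=> [M0 [_ hM]] A8; pose M := `|M0| + 1.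
have UM x : U x -> `|x| <= M.
  by move=> Ux; apply: (hM M) => //; rewrite /M ltr_pwDr// ler_norm.
have M0' : 0 <= M by rewrite addr_ge0.
exists ((2 * M + 3) ^+ 3 / 64); first by rewrite divr_ge0// exprn_ge0// addr_ge0// mulr_ge0.
move=> eps /andP[e0 e1].
(* Large enough for M <= eps n, and for eps <= 1 small enough for (2 n + 1) eps <= 2 M + 3. *)
pose n := (Num.truncn (M / eps)).+1.
have me : 0 <= M / eps by rewrite divr_ge0// ltW.
have /andP[n1 n2] := truncn_itv me.
have Mn : M <= eps * n%:R by rewrite mulrC -ler_pdivrMr// ltW.
have sub := holes_slab e0 UM Mn A8.
have mS := slab_measurable n eps; set S := slab n eps in sub mS.
have sS := slab_leb n e0; rewrite -/S in sS.
apply: (@le_trans _ _ (@leb3 R ((S `*` S) `*` S))).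
  by apply: le_measure; rewrite ?inE//; [exact: measurable_holes|apply: measurableX => //; exact: measurableX].
have -> : @leb3 R ((S `*` S) `*` S) = (@leb R S * @leb R S * @leb R S)%E.
  rewrite [LHS](@product_measure1E _ _ _ _ _ leb2 (@leb R))//; last exact: measurableX.
  congr (_ * _)%E; exact: product_measure1E.
have fS : @leb R S \is a fin_num.
  by rewrite ge0_fin_numE//; apply: le_lt_trans sS _; exact: ltry.
rewrite -(fineK fS) -!EFinM lee_fin.
have s0 : 0 <= fine (@leb R S) by exact: fine_ge0.
have sE : fine (@leb R S) <= (2 * M + 3) / 4 * eps ^+ 2.
  rewrite -lee_fin fineK//; apply: (le_trans sS); rewrite lee_fin.
  have h : n.*2.+1%:R * eps <= 2 * M + 3.
    have : n%:R * eps <= M + eps.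
      rewrite /n -natr1 mulrDl mul1r lerD2r -ler_pdivlMr//.
    have -> : n.*2.+1%:R = 2 * n%:R + 1 :> R by rewrite -natr1 -muln2 natrM; ring.
    by move: (n%:R : R) => a; nra.
  have -> : n.*2.+1%:R * (eps ^+ 3 / 4) = n.*2.+1%:R * eps / 4 * eps ^+ 2 by ring.
  by rewrite ler_wpM2r ?sqr_ge0// ler_pM2r// invr_gt0 ltr0n.
have -> : (2 * M + 3) ^+ 3 / 64 * eps ^+ 6 = ((2 * M + 3) / 4 * eps ^+ 2) ^+ 3 by field.
rewrite -expr2 -exprSr.
by rewrite lerXn2r ?nnegrE// (le_trans s0).
Qed.

End Holes.

(** * Truncations with Lipschitz derivative *)

Section Truncation.
Context {R : realType}.
Implicit Types (a b p s k d : R).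

Definition clamp p : R := if p <= 0 then 0 else if p <= 1 then p else 1.
(** The primitive of [clamp] vanishing at 0: a positive part rounded off on [0, 1], so that it
    satisfies the Taylor hypothesis of [wd_comp], which the positive part itself violates. *)
Definition clamp_prim p : R := if p <= 0 then 0 else if p <= 1 then p ^+ 2 / 2 else p - 2^-1.

Lemma clamp_itv p : 0 <= clamp p <= 1.
Proof. by rewrite /clamp; case: (leP p 0) => h; [|case: (leP p 1) => h']; apply/andP; split; lra. Qed.

Lemma clamp_lipschitz a b : `|clamp a - clamp b| <= `|a - b|.
Proof.
rewrite ler_norml; have h1 := ler_norm (a - b); have h2 := ler_norm (- (a - b)); rewrite normrN in h2.
move: `|a - b| h1 h2 => n h1 h2; rewrite /clamp.
by case: (leP a 0) => ?; case: (leP b 0) => ?; try case: (leP a 1) => ?; try case: (leP b 1) => ?; apply/andP; split; lra.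
Qed.

Lemma clamp_prim_taylor a b : `|clamp_prim b - clamp_prim a - clamp a * (b - a)| <= (b - a) ^+ 2.
Proof.
have sq := sqr_ge0 (b - a); rewrite ler_norml /clamp_prim /clamp.
by case: (leP a 0) => ?; case: (leP b 0) => ?; try case: (leP a 1) => ?; try case: (leP b 1) => ?;
   apply/andP; split; nra.
Qed.

Lemma clamp_prim_itv p : 0 <= clamp_prim p <= Num.max p 0.
Proof.
rewrite /clamp_prim le_max.
by case: (leP p 0) => ?; try case: (leP p 1) => ?; rewrite ?lexx ?orbT//; apply/andP; split; try (apply/orP; left); nra.
Qed.

Lemma clamp_prim_lipschitz a b : `|clamp_prim a - clamp_prim b| <= `|a - b|.
Proof.
rewrite ler_norml; have h1 := ler_norm (a - b); have h2 := ler_norm (- (a - b)); rewrite normrN in h2.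
move: `|a - b| h1 h2 => n h1 h2; rewrite /clamp_prim.
by case: (leP a 0) => ?; case: (leP b 0) => ?; try case: (leP a 1) => ?; try case: (leP b 1) => ?; apply/andP; split; nra.
Qed.

Lemma lipschitz1_measurable (f : R -> R) : (forall a b, `|f a - f b| <= `|a - b|) -> measurable_fun setT f.
Proof.
move=> hf; apply: continuous_measurable_fun => x; apply/cvgrPdist_le => e e0; near=> y.
apply: (le_trans (hf _ _)); near: y; exact: cvgr_dist_le e0.
Unshelve. all: by end_near. Qed.

(** The positive part of s - k, rounded off over a width d; the outer factor d keeps the slope in
    [0, 1]. *)
Definition trunc k d s : R := d * clamp_prim (d^-1 * (s - k)).
Definition trunc' k d s : R := clamp (d^-1 * (s - k)).

Lemma measurable_affine k d : measurable_fun setT (fun s : R => d^-1 * (s - k)).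
Proof. by apply: measurable_funM => //; exact: measurable_funB. Qed.

Lemma measurable_trunc k d : measurable_fun setT (trunc k d).
Proof.
apply: measurable_funM => //; apply: measurableT_comp (measurable_affine k d).
exact: lipschitz1_measurable clamp_prim_lipschitz.
Qed.

Lemma measurable_trunc' k d : measurable_fun setT (trunc' k d).
Proof.
apply: measurableT_comp (measurable_affine k d).
exact: lipschitz1_measurable clamp_lipschitz.
Qed.

Lemma trunc_ge0 k d s : 0 < d -> 0 <= trunc k d s.
Proof. by move=> d0; rewrite mulr_ge0 ?(ltW d0)//; case/andP: (clamp_prim_itv (d^-1 * (s - k))). Qed.

Lemma trunc_le k d s : 0 <= k -> 0 < d -> `|trunc k d s| <= `|s|.
Proof.
move=> k0 d0; rewrite ger0_norm ?trunc_ge0//.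
have /andP[_ h] := clamp_prim_itv (d^-1 * (s - k)).
apply: (@le_trans _ _ (d * Num.max (d^-1 * (s - k)) 0)); first by rewrite ler_pM2l.
rewrite maxr_pMr ?(ltW d0)// mulr0 mulrA divff ?gt_eqF// mul1r ge_max normr_ge0 andbT.
by apply: le_trans (ler_norm s); rewrite lerBlDr lerDl.
Qed.

Lemma trunc'_itv k d s : 0 <= trunc' k d s <= 1. Proof. exact: clamp_itv. Qed.

Lemma trunc'_lipschitz k d a b : 0 < d -> `|trunc' k d a - trunc' k d b| <= d^-1 * `|a - b|.
Proof.
move=> d0; apply: (le_trans (clamp_lipschitz _ _)).
have -> : d^-1 * (a - k) - d^-1 * (b - k) = d^-1 * (a - b) by ring.
by rewrite normrM gtr0_norm ?invr_gt0.
Qed.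

Lemma trunc_taylor k d a b : 0 < d ->
  `|trunc k d b - trunc k d a - trunc' k d a * (b - a)| <= d^-1 * (b - a) ^+ 2.
Proof.
move=> d0; have dn : d != 0 by rewrite gt_eqF.
have := clamp_prim_taylor (d^-1 * (a - k)) (d^-1 * (b - k)).
rewrite -(ler_pM2l d0) -[X in X * `|_|](gtr0_norm d0) -normrM.
have -> : d * (d^-1 * (b - k) - d^-1 * (a - k)) ^+ 2 = d^-1 * (b - a) ^+ 2 by field.
congr (`|_| <= _); rewrite /trunc /trunc'; move: (clamp _) (clamp_prim _) (clamp_prim _) => c p q.
by field.
Qed.

Lemma trunc_out k d s : 0 < d -> s <= k -> trunc k d s = 0 /\ trunc' k d s = 0.
Proof.
move=> d0 sk; have h : d^-1 * (s - k) <= 0 by rewrite mulr_ge0_le0 ?invr_ge0 ?(ltW d0)// subr_le0.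
by rewrite /trunc /trunc' /clamp /clamp_prim h mulr0.
Qed.

Lemma trunc_big k d s : 0 < d -> k + d < s -> d / 2 <= trunc k d s.
Proof.
move=> d0 ks; rewrite /trunc ler_pM2l// /clamp_prim.
have h : 1 < d^-1 * (s - k) by rewrite mulrC ltr_pdivlMr// mul1r ltrBrDl.
move: (d^-1 * _) h => p h; case: (leP p 0) => ?; [|case: (leP p 1) => ?]; lra.
Qed.

End Truncation.

(** * Energy estimate and iteration over level sets *)

Section EnergyEstimate.
Context {R : realType}.
Implicit Types (U H : set (@R3 R)) (kap w F phi m : @R3 R -> R) (G b Gp : 'I_3 -> @R3 R -> R)
  (km M f s eps lam k h c : R) (x : @R3 R).

(** The weak form of -div (kap grad w) = F - div b in U with the natural boundary condition: test
    functions need not vanish on the boundary of U, they are only extended by zero. In the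
    application H is the union of the holes and b the flux defect. *)
Record difference_problem U H km M kap w F G b : Prop := {
  dp_kap : measurable_fun setT kap /\ exists kM, forall x, km <= kap x <= kM;
  dp_w : L2f w;
  dp_G : forall i, L2f (G i);
  dp_F : L2f F;
  dp_b : forall i, L2f (b i) /\ forall x, `|b i x| <= M * \1_H x;
  dp_out : forall x, ~ U x -> w x = 0 /\ forall i, G i x = 0;
  dp_grad : wgr U w G;
  dp_eq : forall phi Gp, L2f phi -> (forall i, L2f (Gp i)) -> wgr U phi Gp ->
    (forall x, ~ U x -> phi x = 0 /\ forall i, Gp i x = 0) ->
    \int[@leb3 R]_x (kap x * \sum_(i < 3) G i x * Gp i x) =
    \int[@leb3 R]_x (F x * phi x) + \sum_(i < 3) \int[@leb3 R]_x (b i x * Gp i x) }.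

Lemma wd_scale U v (c : R) (p q : @R3 R -> R) : L2f p -> L2f q -> wd U v p q ->
  wd U v (fun x => c * p x) (fun x => c * q x).
Proof.
move=> Lp Lq h phi C; have Lphi := Cinf_c_L2f C; have LD := Cinf_c_L2f (Cinf_c_derive v C).
under eq_Rintegral do rewrite -mulrA.
under [in RHS]eq_Rintegral do rewrite -mulrA.
rewrite (Rint3Z c (int3M Lp LD)) (Rint3Z c (int3M Lq Lphi)) -mulrN; congr (_ * _); exact: h.
Qed.

(** Serves to turn the upper bound for solutions into a lower one. *)
Lemma difference_problemN U H km M kap w F G b : difference_problem U H km M kap w F G b ->
  difference_problem U H km M kap (fun x => -1 * w x) (fun x => -1 * F x)
    (fun i x => -1 * G i x) (fun i x => -1 * b i x).
Proof.
move=> [hk hw hG hF hb ho hg he]; split => //.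
- exact: L2fZ.
- by move=> i; exact: L2fZ.
- exact: L2fZ.
- move=> i; have [Lb Mb] := hb i; split; first exact: L2fZ.
  by move=> x; rewrite mulN1r normrN.
- by move=> x /ho[-> h]; split => [|i]; rewrite ?h mulr0.
- by move=> i; exact: wd_scale hw (hG i) (hg i).
move=> phi Gp Lp LG wg out.
have wgN : wgr U (fun x => -1 * phi x) (fun i x => -1 * Gp i x).
  by move=> i; exact: wd_scale Lp (LG i) (wg i).
have outN x : ~ U x -> -1 * phi x = 0 /\ forall i, -1 * Gp i x = 0.
  by move=> /out[-> h]; split => [|i]; rewrite ?h mulr0.
have := he _ _ (L2fZ (-1) Lp) (fun i => L2fZ (-1) (LG i)) wgN outN.
under eq_Rintegral => x _.
  under eq_bigr do rewrite mulrCA mulrA.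
  over.
under [in RHS]eq_Rintegral do rewrite mulrCA mulrA.
move=> ->; congr (_ + _); apply: eq_bigr => i _; apply: eq_Rintegral => x _.
by rewrite mulrCA mulrA.
Qed.

Lemma sum_int3 (g : 'I_3 -> @R3 R -> R) : (forall i, int3 (g i)) ->
  int3 (fun x => \sum_(i < 3) g i x) /\
  \int[@leb3 R]_x (\sum_(i < 3) g i x) = \sum_(i < 3) \int[@leb3 R]_x g i x.
Proof.
move=> ig; pose i1 : 'I_3 := lift ord0 ord0; pose i2 : 'I_3 := lift ord0 (lift ord0 ord0).
have E (h : 'I_3 -> R) : \sum_(i < 3) h i = h ord0 + (h i1 + h i2).
  by rewrite !big_ord_recl big_ord0 addr0.
have E' : (fun x => \sum_(i < 3) g i x) = (fun x => g ord0 x + (g i1 x + g i2 x)).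
  by apply/funext => x; exact: E.
rewrite E'; have i12 := int3D (ig i1) (ig i2).
by split; [exact: int3D (ig ord0) i12|rewrite E (Rint3D (ig ord0) i12) (Rint3D (ig i1) (ig i2))].
Qed.

Lemma cs_le (p q : @R3 R -> R) (a c : R) : L2f p -> L2f q -> 0 <= a -> 0 <= c ->
  n2 p <= a ^+ 2 -> n2 q <= c ^+ 2 -> `|\int[@leb3 R]_x (p x * q x)| <= a * c.
Proof.
move=> Lp Lq a0 c0 pa qc; apply: abs_le_sqr; first exact: mulr_ge0.
apply: (le_trans (L2f_cauchy_schwarz Lp Lq)); rewrite exprMn.
by apply: ler_pM => //; exact: n2_ge0.
Qed.

(** For a test function with gradient m G and 0 <= m <= 1, kap G . Gp = kap m |G|^2 >= kap |Gp|^2,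
    so that w itself (m = 1) and its truncations are treated at once. With E the root of en Gp, the
    equation gives km E^2 <= (f s + 3 B) E. The field b' may differ from b where Gp vanishes, which
    lets the smallness of a level set enter. *)
Lemma energy_bound U H km M kap w F G b phi Gp m f s (B : R) (b' : 'I_3 -> @R3 R -> R) :
  difference_problem U H km M kap w F G b -> 0 < km -> 0 <= f -> 0 <= s -> 0 <= B ->
  n2 F <= f ^+ 2 -> L2f phi -> (forall i, L2f (Gp i)) -> wgr U phi Gp ->
  (forall x, ~ U x -> phi x = 0) -> (forall x, 0 <= m x <= 1) ->
  (forall i x, Gp i x = m x * G i x) -> n2 phi <= s ^+ 2 * en Gp ->
  (forall i, [/\ L2f (b' i), n2 (b' i) <= B ^+ 2 & forall x, b i x * Gp i x = b' i x * Gp i x]) ->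
  en Gp <= ((f * s + 3 * B) / km) ^+ 2.
Proof.
move=> [[mk [kM hk]] Lw LG LF _ ho hg he] km0 f0 s0 B0 nF Lp LGp wgp out m01 GpE np hb.
have Gout x : ~ U x -> phi x = 0 /\ forall i, Gp i x = 0.
  by move=> nx; split => [|i]; [exact: out|rewrite GpE (ho x nx).2 mulr0].
have := he phi Gp Lp LGp wgp Gout.
pose E := Num.sqrt (en Gp).
have E0 : 0 <= E by exact: sqrtr_ge0.
have EE : E ^+ 2 = en Gp by rewrite sqr_sqrtr ?en_ge0.
have kM0 : 0 <= kM by case/andP: (hk 0) => h1 h2; apply: (le_trans (ltW km0)); exact: (le_trans h1).
have LkG i : L2f (fun x => kap x * G i x).
  apply: (L2f_le _ _ (L2fZ kM (LG i))); first by apply: measurable_funM => //; exact: (LG i).1.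
  move=> x; rewrite !normrM (ger0_norm kM0) ler_wpM2r//.
  by case/andP: (hk x) => h1 h2; rewrite ger0_norm// (le_trans (ltW km0)).
have ik i : int3 (fun x => kap x * G i x * Gp i x) by exact: int3M.
have [isum sumE] := sum_int3 ik.
have [isq sqE] := sum_int3 (fun i => (LGp i).2).
have lower : km * en Gp <= \int[@leb3 R]_x (kap x * \sum_(i < 3) G i x * Gp i x).
  rewrite /en /n2 -sqE -Rint3Z//.
  under [leRHS]eq_Rintegral => x _.
    rewrite mulr_sumr; under eq_bigr do rewrite mulrA.
    over.
  apply: Rint3_le => //; first exact: int3Z.
  move=> x; rewrite mulr_sumr; apply: ler_sum => i _; rewrite GpE.
  have /andP[m0 m1] := m01 x; have /andP[h1 _] := hk x.
  have -> : kap x * G i x * (m x * G i x) = kap x * m x * G i x ^+ 2 by ring.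
  rewrite exprMn mulrA ler_wpM2r ?sqr_ge0//; apply: ler_pM => //; [exact: ltW|exact: sqr_ge0|].
  by rewrite expr2 ler_piMl.
have nGp i : n2 (Gp i) <= E ^+ 2.
  rewrite EE /en (bigD1 i)//= lerDl; apply: sumr_ge0 => j _; exact: n2_ge0.
have upper1 : \int[@leb3 R]_x (F x * phi x) <= f * (s * E).
  apply: (le_trans (ler_norm _)); apply: cs_le => //; first exact: mulr_ge0.
  by rewrite exprMn EE.
have upper2 : \sum_(i < 3) \int[@leb3 R]_x (b i x * Gp i x) <= 3 * (B * E).
  apply: (@le_trans _ _ (\sum_(i < 3) (B * E))); last by rewrite sumr_const card_ord mulr_natl.
  apply: ler_sum => i _; have [Lb nb bE] := hb i.
  under eq_Rintegral do rewrite bE.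
  by apply: (le_trans (ler_norm _)); exact: cs_le.
move=> eqE; rewrite eqE -EE in lower.
have key : km * E ^+ 2 <= (f * s + 3 * B) * E.
  apply: (le_trans lower); apply: (le_trans (lerD upper1 upper2)).
  by rewrite le_eqVlt; apply/orP; left; apply/eqP; ring.
rewrite -EE; have [->|En] := eqVneq E 0; first by rewrite expr0n sqr_ge0.
have Ep : 0 < E by rewrite lt_def En.
rewrite lerXn2r ?nnegrE//; first by rewrite divr_ge0 ?addr_ge0 ?mulr_ge0// ltW.
rewrite ler_pdivlMr// -(ler_pM2r Ep); apply: le_trans key.
by rewrite le_eqVlt; apply/orP; left; apply/eqP; ring.
Qed.

Lemma n2_support (p : @R3 R -> R) (A : set (@R3 R)) (a c : R) : measurable A -> 0 <= c ->
  (forall x, `|p x| <= a * \1_A x) -> (@leb3 R A <= c%:E)%E -> measurable_fun setT p ->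
  L2f p /\ n2 p <= a ^+ 2 * c.
Proof.
move=> mA c0 hp Ac mp.
have Afin : (@leb3 R A < +oo)%E by apply: le_lt_trans Ac _; exact: ltry.
have LA : L2f (fun x => a * \1_A x).
  by apply: L2fZ; have := L2f_ind_cst 1 mA Afin; under eq_fun do rewrite mulr1.
have hp' x : `|p x| <= `|a * \1_A x| by apply: (le_trans (hp x)); exact: ler_norm.
split; first exact: L2f_le LA.
apply: (le_trans (n2_le mp hp' LA)).
have L1 : L2f (\1_A : @R3 R -> R).
  by have := L2f_ind_cst 1 mA Afin; under eq_fun do rewrite mulr1.
rewrite (n2Z a L1) ler_wpM2l ?sqr_ge0// /n2.
under eq_Rintegral do rewrite indic_sq.
rewrite Rint3_ind// -lee_fin fineK//; by rewrite ge0_fin_numE.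
Qed.

Definition super w k : set (@R3 R) := [set x | k < w x].

Lemma measurable_super w k : measurable_fun setT w -> measurable (super w k).
Proof.
move=> mw; have := mw measurableT _ (measurable_itv `]k, +oo[%R); rewrite setTI.
by congr measurable; apply/seteqP; split => x; rewrite /super /= in_itv/= andbT.
Qed.

Lemma markov_n2 (p : @R3 R -> R) (A : set (@R3 R)) (d E : R) : measurable A -> (@leb3 R A < +oo)%E ->
  0 < d -> L2f p -> (forall x, A x -> d <= `|p x|) -> n2 p <= E -> (@leb3 R A <= (E / d ^+ 2)%:E)%E.
Proof.
move=> mA Afin d0 Lp hp nE.
have iA := int3_ind mA Afin.
rewrite -[leLHS]fineK ?ge0_fin_numE// lee_fin ler_pdivlMr ?exprn_gt0//.
apply: le_trans nE; rewrite mulrC -Rint3_ind// -(Rint3Z _ iA).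
apply: Rint3_le; [exact: int3Z|exact: Lp.2|move=> x].
rewrite indicE; case: (boolP (x \in A)) => [|_]; last by rewrite mulr0 sqr_ge0.
rewrite inE mulr1 -(real_normK (num_real (p x))) => /hp h.
by rewrite lerXn2r ?nnegrE ?(ltW d0).
Qed.

(* Truncation at level k with width h - k, so that the truncated function is at
   least (h - k) / 2 above level h. The bound on the hole term distinguishes
   lam <= eps^2 from lam > eps^2: |H `&` {w > k}| <= min(c eps^6, c0 lam^3) <= (c1 eps lam)^2. *)
Lemma level_step U H km M kap w F G b f s c0 (C c c1 : R) eps lam k h : open U ->
  difference_problem U H km M kap w F G b -> measurable H ->
  (forall lam (v : @R3 R -> R) G, 0 < lam <= 1 -> L2f v -> (forall i, L2f (G i)) -> wgr U v G ->
    (@leb3 R [set x | v x != 0%R] <= (c0 * lam ^+ 3)%:E)%E ->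
    n2 (fun x => \1_U x * v x) <= C * lam ^+ 2 * en G) ->
  0 < km -> 0 <= M -> 0 <= f -> 0 <= s -> 0 <= c -> 0 <= c0 -> 0 <= c1 -> C <= s ^+ 2 ->
  c <= c1 ^+ 2 -> c0 <= c1 ^+ 2 -> 0 < eps ->
  (@leb3 R H <= (c * eps ^+ 6)%:E)%E -> n2 F <= f ^+ 2 ->
  0 < lam <= 1 -> 0 <= k < h -> (@leb3 R (super w k) <= (c0 * lam ^+ 3)%:E)%E ->
  (@leb3 R (super w h) <=
    (4 * (s * ((f * s + 3 * (M * c1 * eps)) / km)) ^+ 2 * lam ^+ 4 / (h - k) ^+ 2)%:E)%E.
Proof.
move=> oU dp mH FK km0 M0 f0 s0 cge c00 c10 Cs cc c0c e0 Hc nF l01 /andP[k0 kh] Ak.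
have [l0 l1] := andP l01.
have [_ Lw LG _ hb ho hg _] := dp.
pose d := h - k; have d0 : 0 < d by rewrite subr_gt0.
pose v x := trunc k d (w x); pose m x := trunc' k d (w x); pose Gv i x := m x * G i x.
have mm : measurable_fun setT m by exact: measurableT_comp (measurable_trunc' k d) Lw.1.
have Lv : L2f v.
  apply: (L2f_le _ _ Lw); first exact: measurableT_comp (measurable_trunc k d) Lw.1.
  by move=> x; exact: trunc_le.
have m01 x : 0 <= m x <= 1 by exact: trunc'_itv.
have LGv i : L2f (Gv i).
  apply: (L2f_le _ _ (LG i)); first by apply: measurable_funM => //; exact: (LG i).1.
  move=> x; rewrite normrM; have /andP[h1 h2] := m01 x; by rewrite (ger0_norm h1) ler_piMl.
have wgv : wgr U v Gv.
  move=> i; apply: (wd_comp oU (measurable_trunc k d) (measurable_trunc' k d) (L := d^-1)).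
  - by rewrite invr_ge0 ltW.
  - by move=> t; exact: trunc_le.
  - by move=> t; have /andP[h1 h2] := trunc'_itv k d t; rewrite ger0_norm.
  - by move=> a b'; exact: trunc'_lipschitz.
  - by move=> a b'; exact: trunc_taylor.
  - exact: Lw.
  - exact: LG.
  - exact: hg.
have mw := Lw.1; have mAk := measurable_super k mw; have mAh := measurable_super h mw.
have v0 x : ~ super w k x -> v x = 0 /\ m x = 0.
  by move=> /negP; rewrite -leNgt => wk; exact: trunc_out.
have vout x : ~ U x -> v x = 0.
  by move=> /ho[wx _]; apply: (proj1 (trunc_out d0 _)); rewrite wx.
have vA : (@leb3 R [set x | v x != 0%R] <= (c0 * lam ^+ 3)%:E)%E.
  apply: le_trans Ak; apply: le_measure; rewrite ?inE//.
    have := Lv.1 measurableT _ (measurableC (measurable_set1 0)); rewrite setTI.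
    by congr measurable; apply/seteqP; split => x; rewrite /= => /eqP.
  by move=> x /= /eqP vx; apply: contra_notP vx => /v0[].
have nv : n2 v <= (s * lam) ^+ 2 * en Gv.
  have -> : n2 v = n2 (fun x => \1_U x * v x).
    congr n2; apply/funext => x; rewrite indicE; case: (boolP (x \in U)) => xU; first by rewrite mul1r.
    by rewrite mul0r vout// => Ux; move: xU; rewrite mem_set.
  apply: (le_trans (FK lam v Gv l01 Lv LGv wgv vA)).
  by rewrite exprMn ler_wpM2r ?en_ge0// ler_wpM2r ?sqr_ge0.
pose B := M * c1 * eps * lam.
have eng : en Gv <= ((f * (s * lam) + 3 * B) / km) ^+ 2.
  apply: (energy_bound (b' := fun i x => \1_(super w k) x * b i x) dp km0 f0 _ _ nF Lv LGv wgv vout m01) => //.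
  - by rewrite mulr_ge0// ltW.
  - by rewrite !mulr_ge0// ltW.
  move=> i; have [Lb Mb] := hb i.
  have mHA : measurable (H `&` super w k) by exact: measurableI.
  have HA : (@leb3 R (H `&` super w k) <= (c1 ^+ 2 * eps ^+ 2 * lam ^+ 2)%:E)%E.
    have [le|gt] := leP lam (eps ^+ 2).
      apply: (@le_trans _ _ (@leb3 R (super w k))).
        by apply: le_measure; rewrite ?inE//; exact: subIsetr.
      apply: (le_trans Ak); rewrite lee_fin exprS mulrA; apply: ler_wpM2r; first exact: sqr_ge0.
      by apply: ler_pM => //; exact: ltW.
    apply: (@le_trans _ _ (@leb3 R H)).
      by apply: le_measure; rewrite ?inE//; exact: subIsetl.
    apply: (le_trans Hc); rewrite lee_fin -mulrA; apply: ler_pM => //.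
      by rewrite exprn_ge0// ltW.
    rewrite (exprD _ 2 4) ler_wpM2l ?sqr_ge0// (exprM _ 2 2).
    by rewrite lerXn2r ?nnegrE ?sqr_ge0 ?(ltW l0)// ltW.
  have mb' : measurable_fun setT (fun x => \1_(super w k) x * b i x).
    by apply: measurable_funM; [exact: measurable_ind|exact: Lb.1].
  have hb' x : `|\1_(super w k) x * b i x| <= M * \1_(H `&` super w k) x.
    have := Mb x; rewrite !indicE in_setI.
    by case: (x \in super w k); case: (x \in H); rewrite /= ?mul1r ?mul0r ?mulr0 ?normr0 ?mulr1.
  have hc : 0 <= c1 ^+ 2 * eps ^+ 2 * lam ^+ 2 by rewrite -!exprMn sqr_ge0.
  have [Lb' nb'] := n2_support mHA hc hb' HA mb'.
  split => //.
    apply: (le_trans nb'); rewrite /B !exprMn le_eqVlt; apply/orP; left; apply/eqP; ring.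
  move=> x; rewrite /Gv indicE; case: (boolP (x \in super w k)) => xk; first by rewrite mul1r.
  by rewrite (v0 x _).2 ?mul0r ?mulr0// => Ux; move: xk; rewrite mem_set.
(* Two powers of lam come from Faber-Krahn and two from the energy bound, whose root is linear in
   lam. *)
have nvK : n2 v <= (s * ((f * s + 3 * (M * c1 * eps)) / km)) ^+ 2 * lam ^+ 4.
  apply: (le_trans nv); apply: (le_trans (ler_wpM2l (sqr_ge0 _) eng)).
  rewrite /B le_eqVlt; apply/orP; left; apply/eqP; field; exact: lt0r_neq0.
have Ahfin : (@leb3 R (super w h) < +oo)%E.
  apply: le_lt_trans (ltry (c0 * lam ^+ 3)); apply: le_trans Ak.
  by apply: le_measure; rewrite ?inE// => x; rewrite /super /=; exact: lt_trans.
have d2 : 0 < d / 2 by rewrite divr_gt0.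
have hv x : super w h x -> d / 2 <= `|v x|.
  move=> hx; apply: le_trans (ler_norm _); apply: trunc_big => //.
  by rewrite /d addrC subrK.
apply: (le_trans (markov_n2 mAh Ahfin d2 Lv hv nvK)).
by rewrite lee_fin le_eqVlt; apply/orP; left; apply/eqP; rewrite -/d; field; rewrite !lt0r_neq0.
Qed.

(* De Giorgi iteration with lam_n = 4^-n and k_(n+1) - k_n = d 2^-n. *)
Lemma level_iteration (a : R -> \bar R) (c0 Q k0 d : R) : 0 < c0 -> 0 <= Q -> 0 <= k0 -> 0 < d ->
  (forall k h, k <= h -> (a h <= a k)%E) ->
  (forall k h lam, 0 <= k < h -> 0 < lam <= 1 -> (a k <= (c0 * lam ^+ 3)%:E)%E ->
    (a h <= (Q * lam ^+ 4 / (h - k)%R ^+ 2)%:E)%E) ->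
  64 * Q <= c0 * d ^+ 2 -> (a k0 <= c0%:E)%E -> (a (k0 + 2 * d)%R <= 0)%E.
Proof.
move=> c00 Q0 k00 d0 mono step hQ start.
pose z n : R := (2^-1) ^+ n.
pose kn n := k0 + 2 * d * (1 - z n).
have z0 n : 0 < z n by rewrite exprn_gt0// invr_gt0.
have z1 n : z n <= 1 by rewrite exprn_ile1// ?invr_ge0// invf_le1// ler1n.
have zS n : z n.+1 = z n / 2 by rewrite /z exprSr.
have H n : (a (kn n) <= (c0 * (z n ^+ 2) ^+ 3)%:E)%E.
  elim: n => [|n IH].
    by rewrite /kn /z expr0 subrr mulr0 addr0 !expr1n mulr1.
  have zn := z0 n; have z1n := z1 n.
  have kk : 0 <= kn n < kn n.+1.
    rewrite /kn zS; apply/andP; split; first by rewrite addr_ge0// mulr_ge0 ?mulr_ge0 ?(ltW d0)// subr_ge0.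
    by rewrite ltrD2l ltr_pM2l ?mulr_gt0//; lra.
  have l01 : 0 < z n ^+ 2 <= 1 by rewrite exprn_gt0// exprn_ile1// ltW.
  apply: (le_trans (step _ _ _ kk l01 IH)); rewrite lee_fin.
  have -> : kn n.+1 - kn n = d * z n by rewrite /kn zS; field.
  (* Both sides scale like z^6: lam^4 / (h - k)^2 is z^8 / (d z)^2, and the target is c0 (z / 2)^6.
     The factor 2^6 is the 64 of [hQ]. *)
  have -> : Q * (z n ^+ 2) ^+ 4 / (d * z n) ^+ 2 = Q / d ^+ 2 * z n ^+ 6.
    by field; rewrite !lt0r_neq0.
  have -> : c0 * (z n.+1 ^+ 2) ^+ 3 = c0 / 64 * z n ^+ 6 by rewrite zS; field.
  apply: ler_wpM2r; first by rewrite exprn_ge0// ltW.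
  by rewrite ler_pdivrMr ?exprn_gt0// mulrAC ler_pdivlMr// mulrC.
have H' n : (a (k0 + 2 * d)%R <= (c0 * (z n ^+ 2) ^+ 3)%:E)%E.
  apply: le_trans (H n); apply: mono; rewrite lerD2l ler_piMr ?mulr_ge0 ?(ltW d0)//.
  by rewrite lerBlDr lerDl ltW.
apply/lee_addgt0Pr => e e0; rewrite add0e.
have : z n @[n --> \oo] --> 0 by apply: cvg_expr; rewrite ger0_norm ?invr_ge0// invf_lt1// ltr1n.
move=> /cvgr0Pnorm_le /(_ (e / c0) (divr_gt0 e0 c00)) [N _ hN].
apply: (le_trans (H' N)); rewrite lee_fin.
have zN : z N <= e / c0 by have := hN N (leqnn _); rewrite ger0_norm// ltW.
apply: (@le_trans _ _ (c0 * z N)); last by rewrite mulrC -ler_pdivlMr.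
rewrite ler_pM2l// -exprM ler_iXnr//; exact: ltW.
Qed.

End EnergyEstimate.

(** * H^1 and uniform bounds for the difference problem *)

Section DifferenceEstimate.
Context {R : realType}.
Implicit Types (U H : set (@R3 R)) (kap w F : @R3 R -> R) (G b : 'I_3 -> @R3 R -> R)
  (km M c f eps : R) (x : @R3 R).

(** Avoids the square root of c0: the level constants carry the factor c0^-1 + 1, whose square times
    c0 is at least 1. *)
Lemma inv_plus1_sqr (c0 t : R) : 0 < c0 -> 0 <= t -> t <= c0 * (c0^-1 + 1) ^+ 2 * t.
Proof.
move=> c00 t0; rewrite ler_peMl//.
have -> : c0 * (c0^-1 + 1) ^+ 2 = c0^-1 + 2 + c0 by field; exact: lt0r_neq0.
have : 0 < c0^-1 by rewrite invr_gt0.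
lra.
Qed.

Lemma mul_sum_le (a b f t : R) : 0 <= a -> 0 <= b -> 0 <= f -> 0 <= t ->
  f * a + 3 * (b * t) <= (a + 3 * b) * (f + t).
Proof.
move=> a0 b0 f0 t0; have := mulr_ge0 a0 t0; have := mulr_ge0 b0 f0.
by rewrite !mulrDr !mulrDl; lra.
Qed.

(** The L^2 part is [energy_bound] with w as its own test function, closed by Poincare's inequality;
    the uniform part is [level_iteration], run for w and for - w. The constant is assembled from U,
    km, M and c before eps and the problem are given. *)
Lemma difference_estimate U km M c : open U -> connected U -> compact (closure U) -> U !=set0 ->
  has_cone U -> 0 < km -> 0 <= M -> 0 <= c ->
  exists2 C, 0 < C & forall eps H kap w F G b f, 0 < eps <= 1 -> measurable H ->
    (@leb3 R H <= (c * eps ^+ 6)%:E)%E -> difference_problem U H km M kap w F G b ->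
    \int[@leb3 R]_x w x = 0 -> 0 <= f -> n2 F <= f ^+ 2 ->
    n2 w + en G <= (C * (f + eps ^+ 3)) ^+ 2 /\
    {ae leb3, forall x, `|w x| <= C * (f + eps)}.
Proof.
move=> oU cU kU U0 coneU km0 M0 cge.
have [CP CP0 hP] := poincare oU cU kU U0 coneU.
have [c0 [CF [c00 CF0 hF]]] := faber_krahn_whole oU kU coneU.
(* The energy estimates ask for squared constants; t + 1 is used as an upper bound for the root of
   t, hence the added 1 in the constants below. *)
have le_sq (t : R) : 0 <= t -> t <= (t + 1) ^+ 2 by move=> t0; nra.
pose s1 := CP + 1; pose s := CF + 1; pose c' := c + 1; pose c1 := c + c0 + 1.
have s10 : 0 < s1 by rewrite ltr_wpDl.
have s0 : 0 < s by rewrite ltr_wpDl.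
have c'0 : 0 < c' by rewrite ltr_wpDl.
have c10 : 0 < c1 by rewrite ltr_wpDl// addr_ge0// ltW.
have cc1 : c <= c1 ^+ 2.
  by apply: (le_trans _ (le_sq _ (addr_ge0 cge (ltW c00)))); rewrite lerDl ltW.
have c0c1 : c0 <= c1 ^+ 2.
  by apply: (le_trans _ (le_sq _ (addr_ge0 cge (ltW c00)))); rewrite lerDr.
pose A1 := (s1 + 3 * (M * c')) / km.
pose A2 := s * ((s + 3 * (M * c1)) / km) + 1.
have A10 : 0 < A1 by rewrite divr_gt0// ltr_wpDr// !mulr_ge0// ltW.
have A20 : 0 < A2 by rewrite ltr_wpDl// mulr_ge0 ?(ltW s0)// divr_ge0 ?(ltW km0)// addr_ge0 ?(ltW s0)// !mulr_ge0// ltW.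
pose q := c0^-1 + 1; have q0 : 0 < q by rewrite addr_gt0// invr_gt0.
pose D := A2 * (16 * q); pose A3 := (s1 * A1) * q.
have D0 : 0 < D by apply: mulr_gt0 A20 _; exact: mulr_gt0.
have A30 : 0 < A3 by apply: mulr_gt0 q0; exact: mulr_gt0.
(* The first summand serves the H^1 bound, since n2 w + en G <= (s1^2 + 1) en G; the second is the
   final level k0 + 2 d of the iteration divided by f + eps. *)
exists ((1 + s1) * A1 + (A3 + 2 * D)); first by apply: addr_gt0; [apply: mulr_gt0 => //; exact: addr_gt0|apply: addr_gt0 => //; exact: mulr_gt0].
move=> eps H kap w F G b f /andP[e0 e1] mH Hc dp w0 f0 nF.
have e30 : 0 < eps ^+ 3 by rewrite exprn_gt0.
have e31 : eps ^+ 3 <= eps by rewrite ler_iXnr// ltW.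
have [_ Lw LG LF hb ho hg _] := dp.
have nw : n2 w <= s1 ^+ 2 * en G.
  have E : (fun x => \1_U x * w x) = w.
    apply/funext => x; rewrite indicE; case: (boolP (x \in U)) => xU; first by rewrite mul1r.
    by rewrite mul0r (ho x _).1// => Ux; move: xU; rewrite mem_set.
  have := hP w G Lw LG hg; rewrite E => /(_ w0) h; apply: (le_trans h).
  by rewrite ler_wpM2r ?en_ge0//; exact: le_sq.
have nG : en G <= (A1 * (f + eps ^+ 3)) ^+ 2.
  have h : en G <= ((f * s1 + 3 * (M * c' * eps ^+ 3)) / km) ^+ 2.
    apply: (energy_bound (m := fun=> 1) (b' := b) dp km0 f0 (ltW s10) _ nF Lw LG hg).
    - exact: mulr_ge0 (mulr_ge0 M0 (ltW c'0)) (ltW e30).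
    - by move=> x /ho[].
    - by move=> x; rewrite ler01 lexx.
    - by move=> i x; rewrite mul1r.
    - exact: nw.
    move=> i; have [Lb Mb] := hb i.
    have hc : 0 <= c * eps ^+ 6 by rewrite mulr_ge0// exprn_ge0// ltW.
    have [_ nb] := n2_support mH hc Mb Hc Lb.1.
    split => //; apply: (le_trans nb).
    have -> : (M * c' * eps ^+ 3) ^+ 2 = M ^+ 2 * (c' ^+ 2 * eps ^+ 6) by ring.
    apply: ler_wpM2l; first exact: sqr_ge0.
    by apply: ler_wpM2r; [rewrite exprn_ge0// ltW|exact: le_sq].
  apply: (le_trans h); rewrite lerXn2r ?nnegrE//.
  - apply: divr_ge0 (ltW km0); apply: addr_ge0; first exact: mulr_ge0 f0 (ltW s10).
    by apply: mulr_ge0 => //; exact: mulr_ge0 (mulr_ge0 M0 (ltW c'0)) (ltW e30).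
  - exact: mulr_ge0 (ltW A10) (addr_ge0 f0 (ltW e30)).
  rewrite /A1 [leRHS]mulrAC ler_pM2r ?invr_gt0//.
  exact: mul_sum_le (ltW s10) (mulr_ge0 M0 (ltW c'0)) f0 (ltW e30).
have fe3 : 0 <= f + eps ^+ 3 := addr_ge0 f0 (ltW e30).
have fe : 0 < f + eps by rewrite ltr_wpDl.
have sA : 0 <= (1 + s1) * A1 := mulr_ge0 (addr_ge0 ler01 (ltW s10)) (ltW A10).
have AD : 0 <= A3 + 2 * D := addr_ge0 (ltW A30) (mulr_ge0 (ler0n _ 2) (ltW D0)).
split.
  apply: (@le_trans _ _ (((1 + s1) * A1 * (f + eps ^+ 3)) ^+ 2)).
    apply: (@le_trans _ _ ((s1 ^+ 2 + 1) * en G)); first by rewrite mulrDl mul1r lerD2r.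
    rewrite -mulrA exprMn; apply: ler_pM => //; first by rewrite addr_ge0// sqr_ge0.
      exact: en_ge0.
    by nra.
  rewrite lerXn2r ?nnegrE//; [exact: mulr_ge0 sA fe3|exact: mulr_ge0 (addr_ge0 sA AD) fe3|].
  by rewrite ler_wpM2r// lerDl.
have Ufin : (@leb3 R U < +oo)%E.
  have [a [b' ab]] := compact_cbox kU.
  apply: le_lt_trans (leb3_box_lty a b'); apply: le_measure; rewrite ?inE//.
  - exact: open_measurable3.
  - exact: measurable_cbox3.
  - by move=> x Ux; apply: ab; exact: subset_closure.
have side w' F' G' b' : difference_problem U H km M kap w' F' G' b' -> n2 F' <= f ^+ 2 -> n2 w' = n2 w ->
    {ae leb3, forall x, w' x <= (A3 + 2 * D) * (f + eps)}.
  move=> dp' nF' nw'.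
  have [_ Lw' _ _ _ ho' _ _] := dp'.
  pose k0 := A3 * (f + eps); have k00 : 0 < k0 by rewrite mulr_gt0.
  pose d := D * (f + eps); have d0 : 0 < d by rewrite mulr_gt0.
  have step k h lam : 0 <= k < h -> 0 < lam <= 1 -> (@leb3 R (super w' k) <= (c0 * lam ^+ 3)%:E)%E ->
      (@leb3 R (super w' h) <= (4 * (A2 * (f + eps)) ^+ 2 * lam ^+ 4 / (h - k) ^+ 2)%:E)%E.
    move=> kh l01 hk.
    have := level_step oU dp' mH hF km0 M0 f0 (ltW s0) cge (ltW c00) (ltW c10) (le_sq _ CF0) cc1 c0c1 e0 Hc nF' l01 kh hk.
    move/le_trans; apply; rewrite lee_fin.
    apply: ler_wpM2r; first by rewrite invr_ge0 sqr_ge0.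
    apply: ler_wpM2r; first by rewrite exprn_ge0//; case/andP: l01 => /ltW.
    rewrite ler_pM2l// lerXn2r ?nnegrE//.
    - apply: mulr_ge0 (ltW s0) _; apply: divr_ge0 (ltW km0); apply: addr_ge0 (mulr_ge0 f0 (ltW s0)) _.
      by apply: mulr_ge0 => //; exact: mulr_ge0 (mulr_ge0 M0 (ltW c10)) (ltW e0).
    - exact: mulr_ge0 (ltW A20) (ltW fe).
    apply: (@le_trans _ _ (s * ((s + 3 * (M * c1)) / km) * (f + eps))); last first.
      by rewrite ler_wpM2r ?(ltW fe)// lerDl.
    rewrite -[X in _ <= X]mulrA ler_pM2l// [leRHS]mulrAC ler_pM2r ?invr_gt0//.
    exact: mul_sum_le (ltW s0) (mulr_ge0 M0 (ltW c10)) f0 (ltW e0).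
  have mono k h : k <= h -> (@leb3 R (super w' h) <= @leb3 R (super w' k))%E.
    move=> kh; apply: le_measure; rewrite ?inE; [exact: measurable_super Lw'.1|exact: measurable_super Lw'.1|].
    by move=> x; rewrite /super /=; exact: le_lt_trans.
  (* Chebyshev's inequality with the L^2 bound for w gives |{w > k0}| <= (s1 A1 (f + eps))^2 / k0^2,
     and the factor q in [A3] makes this at most c0. *)
  have start : (@leb3 R (super w' k0) <= c0%:E)%E.
    have ms := measurable_super k0 Lw'.1.
    have sfin : (@leb3 R (super w' k0) < +oo)%E.
      apply: le_lt_trans Ufin; apply: le_measure; rewrite ?inE//; first exact: open_measurable3.
      move=> x; rewrite /super /= => kx; apply: contrapT => /ho'[wx _].
      by move: kx; rewrite wx ltNge (ltW k00).
    have hp x : super w' k0 x -> k0 <= `|w' x|.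
      by rewrite /super /= => /ltW h; exact: (le_trans h (ler_norm _)).
    apply: (le_trans (markov_n2 ms sfin k00 Lw' hp (lexx _))).
    rewrite lee_fin ler_pdivrMr ?exprn_gt0// nw'; apply: (le_trans nw).
    apply: (@le_trans _ _ ((s1 * A1 * (f + eps)) ^+ 2)).
      rewrite -[s1 * A1 * _]mulrA [leRHS]exprMn; apply: ler_wpM2l; first exact: sqr_ge0.
      apply: (le_trans nG); rewrite lerXn2r ?nnegrE//; [exact: mulr_ge0 (ltW A10) fe3|exact: mulr_ge0 (ltW A10) (ltW fe)|].
      by rewrite ler_pM2l// lerD2l.
    apply: (le_trans (inv_plus1_sqr c00 (sqr_ge0 _))).
    by rewrite /k0 /A3 /q le_eqVlt; apply/orP; left; apply/eqP; ring.
  have hQ : 64 * (4 * (A2 * (f + eps)) ^+ 2) <= c0 * d ^+ 2.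
    have -> : c0 * d ^+ 2 = c0 * (c0^-1 + 1) ^+ 2 * (256 * (A2 * (f + eps)) ^+ 2) by rewrite /d /D /q; ring.
    have -> : 64 * (4 * (A2 * (f + eps)) ^+ 2) = 256 * (A2 * (f + eps)) ^+ 2 by ring.
    exact: inv_plus1_sqr c00 (mulr_ge0 (ler0n _ 256) (sqr_ge0 _)).
  have Q0 : 0 <= 4 * (A2 * (f + eps)) ^+ 2 := mulr_ge0 (ler0n _ 4) (sqr_ge0 _).
  have := level_iteration c00 Q0 (ltW k00) d0 mono step hQ start.
  move=> h; exists (super w' (k0 + 2 * d)); split.
  - exact: measurable_super Lw'.1.
  - by apply/eqP; rewrite -measure_le0.
  - move=> x /= /negP; rewrite -ltNge /super /=; congr (_ < _).
    by rewrite /k0 /d; ring.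
have nFN : n2 (fun x => -1 * F x) <= f ^+ 2 by rewrite n2Z// sqrrN expr1n mul1r.
have nwN : n2 (fun x => -1 * w x) = n2 w by rewrite n2Z// sqrrN expr1n mul1r.
have := side _ _ _ _ (difference_problemN dp) nFN nwN.
have := side _ _ _ _ dp nF erefl.
apply: filterS2 => x h1 h2.
rewrite ler_norml; apply/andP; split.
  rewrite lerNl -mulN1r; apply: (le_trans h2); by rewrite ler_wpM2r ?(ltW fe)// lerDr.
apply: (le_trans h1); by rewrite ler_wpM2r ?(ltW fe)// lerDr.
Qed.

End DifferenceEstimate.

(** * From the function spaces on the domain to extensions by zero *)

Section Conversions.
Context {R : realType}.
Implicit Types (U K : set (@R3 R)) (f g : @R3 R -> R) (G : 'I_3 -> @R3 R -> R) (x : @R3 R).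

Lemma Lnorm2E f : L2f f -> ('N[@leb3 R]_2%:E [EFin \o f] = (Num.sqrt (n2 f))%:E)%E.
Proof.
move=> Lf; rewrite unlock /=.
transitivity ((\int[@leb3 R]_x (f x ^+ 2)%:E) `^ 2^-1)%E.
  congr (_ `^ _)%E; apply: eq_integral => x _.
  by rewrite /= powR_mulrn// real_normK ?num_real.
by rewrite -(EFin_Rint3 Lf.2) poweR_EFin powR12_sqrt// n2_ge0.
Qed.

Lemma Lfun2P f : f \in Lfun (@leb3 R) 2%:E <-> L2f f.
Proof.
split => [h|Lf].
  by split; [exact: Lfun_measurable h|exact: Lfun2_integrable_sqr].
rewrite inE; apply/andP; split; rewrite inE; first exact: Lf.1.
by have := ltry (Num.sqrt (n2 f)); rewrite -(Lnorm2E Lf).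
Qed.

Lemma patch_ind U f : f \_ U = (fun x => \1_U x * f x).
Proof. by apply/funext => x; rewrite patchE indicE; case: ifP => _; rewrite ?mul1r ?mul0r. Qed.

Lemma patch_out U f x : ~ U x -> (f \_ U) x = 0.
Proof. by move=> nU; rewrite patchE memNset. Qed.

Lemma patch_in U f x : U x -> (f \_ U) x = f x.
Proof. by move=> nU; rewrite patchE mem_set. Qed.

Lemma patch_id U f : (forall x, ~ U x -> f x = 0) -> f \_ U = f.
Proof.
move=> h; apply/funext => x; rewrite patchE; case: ifPn => // /negP xU; rewrite h// => Ux.
by apply: xU; rewrite mem_set.
Qed.

Lemma Rint3_patch U f g : \int[@leb3 R]_(x in U) (f x * g x) = \int[@leb3 R]_x ((f \_ U) x * g x).
Proof.
rewrite Rintegral_mkcond; apply: eq_Rintegral => x _; rewrite !patchE.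
by case: ifP => // _; rewrite mul0r.
Qed.

Lemma wderiv_wd U v f g : wderiv U v f g -> wd U v (f \_ U) (g \_ U).
Proof. by move=> [_ _ h] phi C; rewrite -!Rint3_patch; exact: h. Qed.

Lemma L2f_L1loc U f : L2f (f \_ U) -> L1loc U f.
Proof.
move=> Lf K kK KU; rewrite /inLp; apply/Lfun1_integrable.
have mK : measurable K.
  rewrite -[K]setCK; apply: measurableC; apply: open_measurable3; rewrite openC.
  by apply: compact_closed => //; exact: norm_hausdorff.
have fK : (@leb3 R K < +oo)%E.
  have [a [b ab]] := compact_cbox kK.
  apply: le_lt_trans (leb3_box_lty a b); apply: le_measure; rewrite ?inE//.
  exact: measurable_cbox3.
have L1 : L2f (\1_K : @R3 R -> R).
  by have := L2f_ind_cst 1 mK fK; under eq_fun do rewrite mulr1.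
have -> : f \_ K = (fun x => \1_K x * (f \_ U) x).
  apply/funext => x; rewrite patchE indicE; case: (boolP (x \in K)) => xK; last by rewrite mul0r.
  by rewrite patch_in ?mul1r//; apply: KU; exact: set_mem.
exact: (int3M L1 Lf).
Qed.

Lemma wd_wderiv U v f g : L2f (f \_ U) -> L2f (g \_ U) -> wd U v (f \_ U) (g \_ U) -> wderiv U v f g.
Proof.
move=> Lf Lg h; split; [exact: L2f_L1loc|exact: L2f_L1loc|].
by move=> phi C; rewrite (Rint3_patch U f ('D_v phi)) (Rint3_patch U g phi); exact: h.
Qed.

Lemma inH1_L2f U f G : inH1 U f G -> [/\ L2f (f \_ U), forall i, L2f (G i \_ U) &
  wgr U (f \_ U) (fun i => G i \_ U)].
Proof.
move=> [/Lfun2P Lf LG wG]; split => // [i|i]; first exact/Lfun2P/LG.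
exact: wderiv_wd.
Qed.

Lemma inH1_of U f G : L2f f -> (forall i, L2f (G i)) -> wgr U f G ->
  (forall x, ~ U x -> f x = 0 /\ forall i, G i x = 0) -> inH1 U f G.
Proof.
move=> Lf LG wG out.
have fE : f \_ U = f by apply: patch_id => x /out[].
have GE i : G i \_ U = G i by apply: patch_id => x /out[].
split; first by rewrite /inLp fE; exact/Lfun2P.
  by move=> i; rewrite /inLp GE; exact/Lfun2P.
move=> i; apply: wd_wderiv; rewrite ?fE ?GE//; exact: wG.
Qed.

Lemma int3_ae_dom f g : measurable_fun setT f -> int3 g -> {ae leb3, forall x, `|f x| <= g x} -> int3 f.
Proof.
move=> mf ig fg; apply/integrableP; split; first exact/measurable_EFinP.
have ign := int3_norm ig.
apply: (@le_lt_trans _ _ (\int[@leb3 R]_x (`|g x|)%:E)%E); last first.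
  by rewrite -(EFin_Rint3 ign) ltry.
apply: ae_ge0_le_integral => //.
- by apply/measurable_EFinP; exact: measurableT_comp.
- by apply/measurable_EFinP; exact: int3_measurable ign.
- by move: fg; apply: filterS => x h _; rewrite lee_fin (le_trans h)// ler_norm.
Qed.

Lemma Loo_L2f U f : measurable U -> (@leb3 R U < +oo)%E -> inLp +oo%E U f ->
  L2f (f \_ U) /\ exists2 M, 0 <= M & {ae leb3, forall x, `|(f \_ U) x| <= M}.
Proof.
move=> mU fU Lf; have [M M0 hM] := Lfun_oo_bound Lf; have mf := Lfun_measurable Lf.
split; last by exists M.
split => //.
have i1 : int3 (fun x => M ^+ 2 * \1_U x) by apply: int3Z; exact: int3_ind.
apply: int3_ae_dom i1 _; first exact: measurable_funX.
move: hM; apply: filterS => x hx; rewrite normrX patch_ind indicE.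
case: (boolP (x \in U)) => xU; last by rewrite mul0r normr0 expr0n mulr0.
move: hx; rewrite patch_in ?mul1r ?mulr1; last exact: set_mem.
by move=> hx; rewrite lerXn2r ?nnegrE.
Qed.

Definition clip (M s : R) : R := Num.max (- M) (Num.min M s).

Lemma clip_le (M s : R) : 0 <= M -> `|clip M s| <= M.
Proof.
move=> M0; rewrite ler_norml /clip; apply/andP; split; first by rewrite le_max lexx.
by rewrite ge_max ge_min lexx andbT; lra.
Qed.

Lemma clip_id (M s : R) : `|s| <= M -> clip M s = s.
Proof. by rewrite ler_norml => /andP[h1 h2]; rewrite /clip min_r// max_r. Qed.

Lemma measurable_clip M f : measurable_fun setT f -> measurable_fun setT (fun x => clip M (f x)).
Proof. by move=> mf; apply: measurable_maxr => //; exact: measurable_minr. Qed.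

Lemma Linf_le U f (M : R) : 0 <= M -> {ae leb3, forall x, `|(f \_ U) x| <= M} ->
  (Linfnorm U f <= M%:E)%E.
Proof.
move=> M0 h; rewrite /Linfnorm unlock; case: ifPn => [_|_]; last by rewrite lee_fin.
by apply/ess_supP; move: h; apply: filterS => x /=; rewrite lee_fin.
Qed.

(** The product measure of N is the integral over t of the measures of its sections, so almost every
    section is null. *)
Lemma ae_slice (T : R) U (Q : R -> @R3 R -> Prop) :
  {ae leb4, forall y, cylinder T U y -> Q y.1 y.2} ->
  {ae leb, forall t, 0 < t < T -> {ae leb3, forall x, U x -> Q t x}}.
Proof.
move=> [N [mN N0 hN]].
have m4 : (\int[@leb R]_t (@leb3 R \o xsection N) t = 0)%E by exact: N0.
have mx : measurable_fun setT (@leb3 R \o xsection N) by exact: measurable_fun_xsection.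
have m4' : (\int[@leb R]_(t in setT) `|(@leb3 R \o xsection N) t| = 0)%E.
  by rewrite -[RHS]m4; apply: eq_integral => t _; rewrite gee0_abs.
have := (ae_eq_integral_abs _ measurableT mx).1 m4'.
apply: filterS => t /(_ I) /= Nt t0T; exists (xsection N t); split => //.
  exact: measurable_xsection.
move=> x /= nQ; rewrite /xsection /= inE; apply: hN => /= h; apply: nQ => Ux.
by apply: h; split => //=; rewrite in_itv.
Qed.

End Conversions.

(** * Norms, products and coefficients at a fixed time *)

Section Slice.
Context {R : realType}.
Local Notation R3 := (@R3 R).
Implicit Types (U : set R3) (x : R3).

Lemma Lnorm_sqrt (S : R3 -> R) : int3 S -> (forall x, 0 <= S x) ->
  ('N[@leb3 R]_2%:E [EFin \o (fun x => Num.sqrt (S x))] = (Num.sqrt (\int[@leb3 R]_x S x))%:E)%E.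
Proof.
move=> iS S0; have sq : (fun x => Num.sqrt (S x) ^+ 2) = S by apply/funext => x; rewrite sqr_sqrtr.
have LS : L2f (fun x => Num.sqrt (S x)).
  split; last by rewrite sq.
  apply: measurableT_comp (int3_measurable iS); apply: continuous_measurable_fun; exact: sqrt_continuous.
by rewrite Lnorm2E// /n2 sq.
Qed.

Lemma L2f_ae_mul (p q : R3 -> R) (M : R) : L2f p -> measurable_fun setT q -> 0 <= M ->
  {ae leb3, forall x, `|q x| <= M} -> L2f (fun x => p x * q x).
Proof.
move=> Lp mq M0 hq; have m : measurable_fun setT (fun x => p x * q x) by exact: measurable_funM Lp.1 mq.
split => //; apply: int3_ae_dom (int3Z (M ^+ 2) Lp.2) _; first exact: measurable_funX.
move: hq; apply: filterS => x h.
have -> : `|(p x * q x) ^+ 2| = `|q x| ^+ 2 * p x ^+ 2.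
  by rewrite normrX normrM exprMn mulrC (real_normK (num_real (p x))).
by apply: ler_wpM2r; [exact: sqr_ge0|rewrite lerXn2r ?nnegrE].
Qed.

Lemma L2f_bdd_mul (p q : R3 -> R) (M : R) : L2f p -> measurable_fun setT q ->
  (forall x, `|q x| <= M) -> L2f (fun x => q x * p x).
Proof.
move=> Lp mq hq; have M0 : 0 <= M := le_trans (normr_ge0 _) (hq 0).
have := L2f_ae_mul Lp mq M0 (aeW (@leb3 R) hq); by under eq_fun do rewrite mulrC.
Qed.

Lemma L2f_sum (p : 'I_3 -> R3 -> R) : (forall i, L2f (p i)) -> L2f (fun x => \sum_(i < 3) p i x).
Proof.
move=> Lp; rewrite (_ : (fun x => _) = fun x => p ord0 x + (p (lift ord0 ord0) x + p (lift ord0 (lift ord0 ord0)) x)).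
  by apply: L2fD => //; exact: L2fD.
by apply/funext => x; rewrite !big_ord_recl big_ord0 addr0.
Qed.

Lemma clip_abs (M s : R) : 0 <= M -> `|clip M s| <= `|s|.
Proof.
move=> M0; have h1 := ler_norm s; have h2 := ler_norm (- s); rewrite normrN in h2.
by rewrite ler_norml ge_max ge_min le_max le_min; apply/andP; split;
  [case: (leP (- M) s) => ?; apply/orP; [right|left]; [apply/andP; split|]; lra
  |apply/andP; split; [|apply/orP; right]; lra].
Qed.

Lemma wd_sub U v (f f' g g' : R3 -> R) : L2f f -> L2f f' -> L2f g -> L2f g' ->
  wd U v f g -> wd U v f' g' -> wd U v (fun x => f x - f' x) (fun x => g x - g' x).
Proof.
move=> Lf Lf' Lg Lg' h h' phi C; have Lp := Cinf_c_L2f C; have LD := Cinf_c_L2f (Cinf_c_derive v C).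
under eq_Rintegral do rewrite mulrBl.
under [in RHS]eq_Rintegral do rewrite mulrBl.
rewrite (Rint3B (int3M Lf LD) (int3M Lf' LD)) (Rint3B (int3M Lg Lp) (int3M Lg' Lp)).
by rewrite (h phi C) (h' phi C) opprB opprK addrC.
Qed.

Lemma sum3_sqr (a : 'I_3 -> R) : (\sum_(i < 3) a i) ^+ 2 <= 3 * \sum_(i < 3) a i ^+ 2.
Proof.
rewrite !big_ord_recl !big_ord0 !addr0; move: (a _) (a _) (a _) => p q r.
have := sqr_ge0 (p - q); have := sqr_ge0 (p - r); have := sqr_ge0 (q - r); nra.
Qed.

Lemma patch_int0 U (p : R3 -> R) : \int[@leb3 R]_(x in U) p x = \int[@leb3 R]_x ((p \_ U) x).
Proof. exact: Rintegral_mkcond. Qed.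

Lemma bounded_compact_closure U : bounded_set U -> compact (closure U).
Proof.
move=> [M0 [_ hM]]; pose c := `|M0| + 1.
have hc := hM c (ltr_pwDr ltr01 (ler_norm _)).
apply: (@subclosed_compact _ _ (cbox3 (- c, - c, - c) (c, c, c))); [exact: closed_closure|exact: compact_cbox3|].
rewrite [X in _ `<=` X](iffLR (closure_id _) (@closed_cbox3 R _ _)); apply: closure_subset => x /hc.
rewrite /cbox3 /= !prod_normE /= !ge_max => /andP[/andP[]].
by rewrite !ler_norml => h1 h2 h3; split; [split|]; rewrite /= in_itv.
Qed.

Lemma measurable_perforated U A eps : measurable U -> measurable (perforated U A eps).
Proof. by move=> mU; apply: measurableD => //; exact: measurable_holes. Qed.

Lemma measurable_kappa (P : data R) eps : measurable (Omega P) -> measurable_fun setT (kappa_ P eps).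
Proof.
move=> mU; have mO := measurable_perforated (hole P) eps mU.
have -> : kappa_ P eps = (fun x => ks P + \1_(Omega_ P eps) x * (kf P - ks P)).
  apply/funext => x; rewrite /kappa_ indicE; case: ifP => _; last by rewrite mul0r addr0.
  by rewrite mul1r addrC subrK.
by apply: measurable_funD => //; apply: measurable_funM => //; exact: measurable_ind.
Qed.

End Slice.

(** * Equation for the temperature difference at a fixed time *)

Section SliceEstimate.
Context {R : realType}.
Local Notation R3 := (@R3 R).
Implicit Types (x : R3).
Context (P : data R) (eps : R) (the th : R3 -> R) (Ge Gt ue u : 'I_3 -> R3 -> R)
  (Ht : 'I_3 -> 'I_3 -> R3 -> R).
Local Notation U := (Omega P).
Local Notation Om := (Omega_ P eps).
Local Notation kap := (kappa_ P eps).

Let w x := (the \_ U) x - (th \_ U) x.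
Let G i x := (Ge i \_ U) x - (Gt i \_ U) x.
Let e i x := (ue i \_ Om) x - (u i \_ U) x.
Let F x := \sum_(i < 3) (e i x * (grav P i \_ U) x).
(* Gt is bounded by Mt only almost everywhere, hence the clipping. *)
Let b Mt i x := (kf P - kap x) * clip Mt ((Gt i \_ U) x).

(** The effective equation has the constant diffusivity [kf], the microscopic one [kap]. Writing kf
    grad th = kap grad th + (kf - kap) grad th leaves the flux defect b, which vanishes off the
    holes and is bounded because grad th is. *)
Lemma slice_problem (Mt Mg : R) : measurable U -> 0 < kf P -> 0 < ks P -> 0 <= Mt -> 0 <= Mg ->
  inH1 U the Ge -> L2f (th \_ U) -> (forall i, L2f (Gt i \_ U)) ->
  (forall i, L2f (Ht i i \_ U)) -> wgrad U th Gt ->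
  (forall i, L2f (ue i \_ Om)) -> (forall i, L2f (u i \_ U)) ->
  (forall i, measurable_fun setT (grav P i \_ U)) ->
  {ae leb3, forall x, forall i, `|(grav P i \_ U) x| <= Mg} ->
  {ae leb3, forall x, forall i, `|(Gt i \_ U) x| <= Mt} ->
  (forall phi G, inH1 U phi G ->
    \int[leb3]_(x in U) (kap x * dot (fun i => Ge i x) (fun i => G i x)) =
    \int[leb3]_(x in U) (dot (fun i => (ue i \_ Om) x) (fun i => grav P i x) * phi x)) ->
  {ae leb3, forall x, U x ->
    - (kf P * \sum_(i < 3) Ht i i x) = dot (fun i => u i x) (fun i => grav P i x)} ->
  normal_trace0 U Gt (fun x => \sum_(i < 3) Ht i i x) ->
  difference_problem U (holes U (hole P) eps) (Num.min (kf P) (ks P)) (`|kf P - ks P| * Mt)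
    kap w F G (b Mt).
Proof.
move=> mU kf0 ks0 Mt0 Mg0 /inH1_L2f[Lthe LGe wGe] Lth LGt LHt wth Lue Lu mg hg hGt eqe eqt tr.
have mk := measurable_kappa eps mU.
have kb x : Num.min (kf P) (ks P) <= kap x <= kf P + ks P.
  by rewrite /kappa_ ge_min; case: ifP => _; rewrite lexx ?orbT /= ?lerDl ?lerDr ltW.
have Le i : L2f (e i) by apply: L2fB.
have Leg i (p : 'I_3 -> R3 -> R) : (forall i, L2f (p i)) -> L2f (fun x => p i x * (grav P i \_ U) x).
  move=> Lp; apply: (L2f_ae_mul (M := Mg)) => //.
  by move: hg; apply: filterS => x; apply.
have LG i : L2f (G i) by exact: L2fB.
have kb2 x : `|kf P - kap x| <= `|kf P - ks P|.
  by rewrite /kappa_; case: ifP => _; rewrite ?subrr ?normr0.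
have Lb i : L2f (b Mt i).
  apply: (L2f_bdd_mul (M := `|kf P - ks P|)) => //; last exact: measurable_funB.
  apply: (L2f_le _ _ (LGt i)); first by apply: measurable_clip; exact: (LGt i).1.
  by move=> x; exact: clip_abs.
split => //.
- by split => //; exists (kf P + ks P).
- exact: L2fB.
- exact: L2f_sum (fun i => Leg i e Le).
- move=> i; split => // x; rewrite /b indicE.
  have cM := clip_le ((Gt i \_ U) x) Mt0.
  (* Outside U the function [kap] takes the value [ks], so kf - kap need not vanish there; the
     extended gradient does. *)
  have [Ux|nU] := pselect (U x); last first.
    by rewrite patch_out// clip_id ?normr0// mulr0 normr0 !mulr_ge0.
  case: (boolP (x \in holes _ _ _)) => xH.
    by rewrite mulr1 normrM; apply: ler_pM.
  have xO : Om x by split => // h; move: xH; rewrite mem_set.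
  by rewrite /kappa_ mem_set// subrr mul0r normr0 mulr0.
- by move=> x nU; rewrite /w /G; split => [|i]; rewrite !patch_out// subrr.
- by move=> i; exact: (wd_sub Lthe Lth (LGe i) (LGt i) (wGe i) (wderiv_wd (wth i))).
move=> phi Gp Lp LGp wgp out.
have I1 := inH1_of Lp LGp wgp out.
have Lkap (p : R3 -> R) : L2f p -> L2f (fun x => kap x * p x).
  move=> L; apply: (L2f_bdd_mul (M := kf P + ks P)) => // x.
  have /andP[h1 h2] := kb x; rewrite ger0_norm//; apply: le_trans h1.
  by rewrite le_min !ltW.
have E1 := eqe phi Gp I1.
have {}E1 : \int[@leb3 R]_x (\sum_(i < 3) kap x * (Ge i \_ U) x * Gp i x) =
    \int[@leb3 R]_x ((\sum_(i < 3) (ue i \_ Om) x * (grav P i \_ U) x) * phi x).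
  transitivity (\int[@leb3 R]_(x in U) (kap x * dot (fun i => Ge i x) (fun i => Gp i x))).
    rewrite (patch_int0 U); apply: eq_Rintegral => x _.
    have [Ux|nU] := pselect (U x).
      rewrite patch_in// /dot mulr_sumr; apply: eq_bigr => i _; by rewrite patch_in// mulrA.
    by rewrite patch_out// big1// => i _; rewrite patch_out// mulr0 mul0r.
  rewrite E1 (patch_int0 U); apply: eq_Rintegral => x _.
  have [Ux|nU] := pselect (U x); last by rewrite patch_out// (out x nU).1 mulr0.
  by rewrite patch_in// /dot; congr (_ * _); apply: eq_bigr => i _; rewrite (patch_in (grav P i) Ux).
have Leg' : L2f (fun x => \sum_(i < 3) (ue i \_ Om) x * (grav P i \_ U) x).
  exact: L2f_sum (fun i => Leg i (fun i => ue i \_ Om) Lue).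
have Lug : L2f (fun x => \sum_(i < 3) (u i \_ U) x * (grav P i \_ U) x).
  exact: L2f_sum (fun i => Leg i (fun i => u i \_ U) Lu).
have ikG i : int3 (fun x => kap x * (Ge i \_ U) x * Gp i x) by exact: int3M (Lkap _ (LGe i)) (LGp i).
have iGt i : int3 (fun x => (Gt i \_ U) x * Gp i x) by exact: int3M.
have iH : int3 (fun x => (\sum_(i < 3) (Ht i i \_ U) x) * phi x).
  by apply: int3M => //; exact: L2f_sum.
have [isG sG] := sum_int3 iGt.
(* [normal_trace0] is Green's formula with zero boundary term for every H^1 test function, so the
   pointwise effective equation can be tested like the microscopic one. *)
have E2 : kf P * \int[@leb3 R]_x (\sum_(i < 3) (Gt i \_ U) x * Gp i x) =
    \int[@leb3 R]_x ((\sum_(i < 3) (u i \_ U) x * (grav P i \_ U) x) * phi x).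
  have := tr phi Gp I1.
  have -> : \int[@leb3 R]_(x in U) (\sum_(i < 3) Gt i x * Gp i x + (\sum_(i < 3) Ht i i x) * phi x) =
    \int[@leb3 R]_x (\sum_(i < 3) (Gt i \_ U) x * Gp i x + (\sum_(i < 3) (Ht i i \_ U) x) * phi x).
    rewrite (patch_int0 U); apply: eq_Rintegral => x _.
    have [Ux|nU] := pselect (U x).
      rewrite patch_in//; congr (_ + _ * _); apply: eq_bigr => i _; by rewrite [in RHS]patch_in.
    rewrite patch_out// (out x nU).1 mulr0 addr0 big1// => i _; by rewrite patch_out// mul0r.
  rewrite (Rint3D isG iH) => /eqP; rewrite addr_eq0 => /eqP ->.
  rewrite mulrN -mulNr -(Rint3Z (- kf P) iH).
  apply: Rint3_ae_eq; [exact: int3Z iH|exact: int3M Lug Lp|].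
  move: eqt; apply: filterS => x hx; rewrite mulrA; congr (_ * _).
  have [Ux|nU] := pselect (U x); last first.
    by rewrite !big1 ?mulr0// => i _; rewrite patch_out// mul0r.
  rewrite mulNr; transitivity (- (kf P * \sum_(i < 3) Ht i i x)).
    by congr (- (_ * _)); apply: eq_bigr => i _; rewrite patch_in.
  by rewrite hx// /dot; apply: eq_bigr => i _; rewrite !patch_in.
have Lkk i : L2f (fun x => (kf P - kap x) * (Gt i \_ U) x).
  by apply: (L2f_bdd_mul (M := `|kf P - ks P|)) => //; exact: measurable_funB.
have ib i : int3 (fun x => (kf P - kap x) * (Gt i \_ U) x * Gp i x) by exact: int3M.
have Eb i : \int[@leb3 R]_x (b Mt i x * Gp i x) = \int[@leb3 R]_x ((kf P - kap x) * (Gt i \_ U) x * Gp i x).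
  apply: Rint3_ae_eq; [exact: int3M|exact: ib|].
  by move: hGt; apply: filterS => x hx; rewrite /b clip_id.
under [X in _ = _ + X]eq_bigr do rewrite Eb.
have [isb sb] := sum_int3 ib; rewrite -sb.
have [isk sk] := sum_int3 ikG.
have -> : \int[@leb3 R]_x (F x * phi x) =
   \int[@leb3 R]_x ((\sum_(i < 3) (ue i \_ Om) x * (grav P i \_ U) x) * phi x) -
   \int[@leb3 R]_x ((\sum_(i < 3) (u i \_ U) x * (grav P i \_ U) x) * phi x).
  rewrite -(Rint3B (int3M Leg' Lp) (int3M Lug Lp)); apply: eq_Rintegral => x _.
  rewrite -mulrBl; congr (_ * _); rewrite /F -sumrB; apply: eq_bigr => i _.
  by rewrite /e mulrBl.
rewrite -E1 -E2 -(Rint3Z (kf P) isG).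
have isG' := int3Z (kf P) isG.
rewrite -(Rint3B isk isG') -(Rint3D (int3B isk isG') isb); apply: eq_Rintegral => x _.
rewrite !mulr_sumr -sumrB -big_split/=; apply: eq_bigr => i _.
rewrite /G; move: ((Ge i \_ U) x) ((Gt i \_ U) x) (kap x) (Gp i x) => p q r t; ring.
Qed.

End SliceEstimate.

(** * The three estimates at a fixed time *)

Section SliceBounds.
Context {R : realType}.
Local Notation R3 := (@R3 R).
Implicit Types (x : R3) (eps Mt beta : R).

(** Cauchy-Schwarz over the three components gives the factor 3, rounded up to 4 = 2^2. *)
Lemma n2_coefficients (e g : 'I_3 -> R3 -> R) (M : R) : (forall i, L2f (e i)) ->
  (forall i, measurable_fun setT (g i)) -> 0 <= M ->
  {ae leb3, forall x, forall i, `|g i x| <= M} ->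
  n2 (fun x => \sum_(i < 3) (e i x * g i x)) <= (2 * M * Num.sqrt (en e)) ^+ 2.
Proof.
move=> Le mg M0 hg.
have Leg i : L2f (fun x => e i x * g i x).
  by apply: (L2f_ae_mul (M := M)) => //; move: hg; apply: filterS.
have LF := L2f_sum Leg.
have [isq sq] := sum_int3 (fun i => (Le i).2).
rewrite exprMn sqr_sqrtr ?en_ge0// /en /n2 -sq -(Rint3Z _ isq).
apply: int3_ae_le; [exact: int3_measurable LF.2|exact: int3Z|exact: LF.2|].
move: hg; apply: filterS => x hx; apply: (le_trans (sum3_sqr _)).
have -> : (2 * M) ^+ 2 * \sum_(i < 3) e i x ^+ 2 = 4 * \sum_(i < 3) M ^+ 2 * e i x ^+ 2.
  by rewrite -mulr_sumr; ring.
apply: ler_pM => //; first by apply: sumr_ge0 => i _; exact: sqr_ge0.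
  by rewrite ler_nat.
apply: ler_sum => i _; rewrite exprMn mulrC; apply: ler_wpM2r; first exact: sqr_ge0.
by rewrite -(real_normK (num_real (g i x))) lerXn2r ?nnegrE.
Qed.

Lemma L2norm_vector (U : set R3) (a : 'I_3 -> R3 -> R) : (forall i, L2f (a i \_ U)) ->
  L2norm U a = (Num.sqrt (en (fun i => a i \_ U)))%:E.
Proof.
move=> La; have [isq sq] := sum_int3 (fun i => (La i).2).
rewrite /en /n2 -sq -(Lnorm_sqrt isq); last by move=> x; apply: sumr_ge0 => i _; exact: sqr_ge0.
rewrite /L2norm; congr (Lnorm _ _ _); apply/funext => x /=; congr EFin.
have [Ux|nU] := pselect (U x).
  by rewrite patch_in//; congr Num.sqrt; apply: eq_bigr => i _; rewrite patch_in.
by rewrite patch_out// big1 ?sqrtr0// => i _; rewrite patch_out// expr0n.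
Qed.

(** [H1norm] is an infimum over weak gradients, so any one of them, here G, gives an upper bound. *)
Lemma H1norm_le (U : set R3) (f : R3 -> R) (G : 'I_3 -> R3 -> R) (B : R) : L2f (f \_ U) ->
  (forall i, L2f (G i)) -> wgr U (f \_ U) G -> (forall x, ~ U x -> forall i, G i x = 0) ->
  0 <= B -> n2 (f \_ U) + en G <= B ^+ 2 -> (H1norm U f <= B%:E)%E.
Proof.
move=> Lf LG wG out B0 hB.
have GE i : G i \_ U = G i by apply: patch_id => x /out.
have wg : wgrad U f G by move=> i; apply: wd_wderiv; rewrite ?GE//; exact: wG.
have [isq sq] := sum_int3 (fun i => (LG i).2).
apply: (@le_trans _ _ ('N[@leb3 R]_2%:E [EFin \o
      ((fun x => Num.sqrt (f x ^+ 2 + \sum_(i < 3) G i x ^+ 2)) \_ U)])%E).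
  by apply: ereal_inf_lbound; exists G.
have -> : (fun x => Num.sqrt (f x ^+ 2 + \sum_(i < 3) G i x ^+ 2)) \_ U =
    (fun x => Num.sqrt ((f \_ U) x ^+ 2 + \sum_(i < 3) G i x ^+ 2)).
  apply/funext => x; have [Ux|nU] := pselect (U x); first by rewrite !patch_in.
  rewrite !patch_out// expr0n add0r big1 ?sqrtr0// => i _; by rewrite out// expr0n.
rewrite (Lnorm_sqrt (int3D Lf.2 isq)); last first.
  by move=> x; rewrite addr_ge0 ?sqr_ge0//; apply: sumr_ge0 => i _; exact: sqr_ge0.
rewrite (Rint3D Lf.2 isq) sq lee_fin -(ger0_norm B0) -sqrtr_sqr.
exact: ler_wsqrtr.
Qed.

Lemma patch_sub (U : set R3) (f g : R3 -> R) :
  (fun x => f x - g x) \_ U = (fun x => (f \_ U) x - (g \_ U) x).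
Proof.
apply/funext => x; have [Ux|nU] := pselect (U x); first by rewrite !patch_in.
by rewrite !patch_out// subrr.
Qed.

Lemma ae_uniform_bound (f : 'I_3 -> R3 -> R) (Q : R3 -> Prop) :
  (forall i, exists2 M, 0 <= M & {ae leb3, forall x, Q x -> `|f i x| <= M}) ->
  exists2 M, 0 <= M & {ae leb3, forall x, Q x -> forall i, `|f i x| <= M}.
Proof.
move=> h; have /choice[M hM] : forall i, exists M, 0 <= M /\ {ae leb3, forall x, Q x -> `|f i x| <= M}.
  by move=> i; have [M M0 HM] := h i; exists M.
exists (\sum_(i < 3) M i); first by apply: sumr_ge0 => i _; exact: (hM i).1.
have : {ae leb3, forall x, forall i, Q x -> `|f i x| <= M i}.
  by apply: filter_forall => i; exact: (hM i).2.
apply: filterS => x hx Qx i; apply: (le_trans (hx i Qx)).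
rewrite (bigD1 i)//= lerDl; apply: sumr_ge0 => j _; exact: (hM j).1.
Qed.

Lemma affine_le (c a d s : R) : 0 <= c -> 0 <= a -> 0 <= d -> 0 <= s ->
  c * (a * d + s) <= c * (a + 1) * (d + s).
Proof.
move=> c0 a0 d0 s0; rewrite -[leRHS]mulrA; apply: ler_wpM2l => //.
by have := mulr_ge0 a0 s0; rewrite mulrDl mulrDr; lra.
Qed.

(** Everything reduces to [difference_estimate] with a source of norm 2 Mg times the velocity
    difference. The constant is chosen from the data and Mt before eps and the functions at the
    given time, which makes it uniform in both eps and time. *)
Lemma slice_estimate beta (P : data R) Mt : admissible beta P -> 0 <= Mt ->
  exists2 C, 0 < C & forall eps (the th : R3 -> R) (Ge Gt ue u : 'I_3 -> R3 -> R)
    (Ht : 'I_3 -> 'I_3 -> R3 -> R), 0 < eps < 1 ->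
  inH1 (Omega P) the Ge -> inW2inf (Omega P) th Gt Ht ->
  (forall i, inLp 2%:E (Omega_ P eps) (ue i)) -> (forall i, inLp +oo%E (Omega P) (u i)) ->
  \int[leb3]_(x in Omega P) the x = 0 -> \int[leb3]_(x in Omega P) th x = 0 ->
  {ae leb3, forall x, Omega P x -> forall i, `|Gt i x| <= Mt} ->
  (forall phi G, inH1 (Omega P) phi G ->
    \int[leb3]_(x in Omega P) (kappa_ P eps x * dot (fun i => Ge i x) (fun i => G i x)) =
    \int[leb3]_(x in Omega P)
      (dot (fun i => (ue i \_ (Omega_ P eps)) x) (fun i => grav P i x) * phi x)) ->
  {ae leb3, forall x, Omega P x ->
    - (kf P * \sum_(i < 3) Ht i i x) = dot (fun i => u i x) (fun i => grav P i x)} ->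
  normal_trace0 (Omega P) Gt (fun x => \sum_(i < 3) Ht i i x) ->
  let du := L2norm (Omega P) (fun i x => (ue i \_ (Omega_ P eps)) x - u i x) in
  [/\ (H1norm (Omega P) (fun x => (the x - th x)%R) <= C%:E * (du + (eps ^+ 3)%:E))%E,
      (Linfnorm (Omega P) (fun x => (the x - th x)%R) <= C%:E * (du + eps%:E))%E &
      (Linfnorm (Omega P) (fun x => (visc P (the x) - visc P (th x))%R)
         <= C%:E * (du + eps%:E))%E].
Proof.
move=> [_ [oU U0 bU cU classU] [_ [_ Ain] _ _ _] _ hvisc _ _ kf0 ks0 _ [H hH] _] Mt0.
set U := Omega P in oU U0 bU cU classU hH *.
have A8 y : hole P y -> euclid y < 8^-1 by move=> Ay; exact: (Ain y (subset_closure Ay)).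
have [c c0 hc] := holes_measure bU A8.
have [L L0 hL] := W1inf_line_lipschitz hvisc.
have kU := bounded_compact_closure bU.
have mU : measurable U by exact: open_measurable3.
have fU : (@leb3 R U < +oo)%E.
  have [a [b ab]] := compact_cbox kU.
  apply: le_lt_trans (leb3_box_lty a b); apply: le_measure; rewrite ?inE//.
    exact: measurable_cbox3.
  by move=> x Ux; apply: ab; exact: subset_closure.
have [_ hgr _ _ _] := hH.
have [Mg Mg0 [mg hg]] : exists2 Mg, 0 <= Mg & (forall i, measurable_fun setT (grav P i \_ U)) /\
    {ae leb3, forall x, forall i, `|(grav P i \_ U) x| <= Mg}.
  have [Mg Mg0 h] := ae_uniform_bound (f := fun i => grav P i \_ U) (Q := setT) (fun i =>
    let: ex_intro2 M M0 hM := (Loo_L2f mU fU (hgr i)).2 in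
    ex_intro2 _ _ M M0 (filterS (fun x hx _ => hx) hM)).
  exists Mg => //; split; first by move=> i; exact: (Loo_L2f mU fU (hgr i)).1.1.
  by move: h; apply: filterS => x; exact.
pose km := Num.min (kf P) (ks P).
have km0 : 0 < km by rewrite lt_min kf0.
have M0 : 0 <= `|kf P - ks P| * Mt by rewrite mulr_ge0.
have [C C0 hC] := difference_estimate oU cU kU U0 (class_C2_cone oU classU) km0 M0 c0.
(* q absorbs the factor 2 Mg of the velocity difference, and L + 1 the Lipschitz constant of the
   viscosity. Both are at least 1, so a single constant serves all three bounds. *)
pose q := 2 * Mg + 1; have q1 : 1 <= q by rewrite lerDr mulr_ge0.
have q0 : 0 < q by apply: lt_le_trans q1.
have L1 : 0 < L + 1 by rewrite ltr_wpDl.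
exists (C * q * (L + 1)); first by apply: mulr_gt0 => //; exact: mulr_gt0.
move=> eps the th Ge Gt ue u Ht /andP[e0 e1] hthe hth hue hu ithe ith hGt eqe eqt tr du.
have [Lthe LGe wGe] := inH1_L2f hthe.
have [hth0 hGt0 hHt0 wth _] := hth.
have Lth := (Loo_L2f mU fU hth0).1.
have LGt i := (Loo_L2f mU fU (hGt0 i)).1.
have LHt i := (Loo_L2f mU fU (hHt0 i i)).1.
have Lu i := (Loo_L2f mU fU (hu i)).1.
have Lue i : L2f (ue i \_ (Omega_ P eps)) by exact/Lfun2P/hue.
have hGt' : {ae leb3, forall x, forall i, `|(Gt i \_ U) x| <= Mt}.
  move: hGt; apply: filterS => x hx i; have [Ux|nU] := pselect (U x).
    by rewrite patch_in//; exact: hx.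
  by rewrite patch_out// normr0.
pose w x := (the \_ U) x - (th \_ U) x.
pose G i x := (Ge i \_ U) x - (Gt i \_ U) x.
pose e i x := (ue i \_ (Omega_ P eps)) x - (u i \_ U) x.
pose F x := \sum_(i < 3) (e i x * (grav P i \_ U) x).
pose b i x := (kf P - kappa_ P eps x) * clip Mt ((Gt i \_ U) x).
have dp : difference_problem U (holes U (hole P) eps) km (`|kf P - ks P| * Mt) (kappa_ P eps) w F G b.
  exact: (slice_problem mU kf0 ks0 Mt0 Mg0 hthe Lth LGt LHt wth Lue Lu mg hg hGt' eqe eqt tr).
have Le i : L2f (e i) by exact: L2fB.
have eE i : (fun x => (ue i \_ (Omega_ P eps)) x - u i x) \_ U = e i.
  rewrite patch_sub patch_id// => x nU; rewrite patch_out// => -[Ux _]; exact: nU.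
pose dur := Num.sqrt (en e); have dur0 : 0 <= dur by exact: sqrtr_ge0.
have duE : du = dur%:E.
  rewrite /du L2norm_vector; last by move=> i; rewrite eE.
  by rewrite /dur; do 3! congr (_ _); apply/funext => i; rewrite eE.
have nF : n2 F <= (2 * Mg * dur) ^+ 2 by exact: n2_coefficients.
have f0 : 0 <= 2 * Mg * dur := mulr_ge0 (mulr_ge0 (ler0n _ 2) Mg0) dur0.
have mH : measurable (holes U (hole P) eps) by exact: measurable_holes.
have e01 : 0 < eps <= 1 by rewrite e0 ltW.
have iU (p : R3 -> R) : L2f (p \_ U) -> int3 (p \_ U).
  move=> Lp; have LU : L2f (\1_U : R3 -> R).
    by have := L2f_ind_cst 1 mU fU; under eq_fun do rewrite mulr1.
  have -> : p \_ U = (fun x => \1_U x * (p \_ U) x).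
    apply/funext => x; have [Ux|nU] := pselect (U x).
      by rewrite indicE mem_set// mul1r.
    by rewrite indicE memNset// mul0r patch_out.
  exact: int3M.
have w0 : \int[@leb3 R]_x w x = 0.
  rewrite (Rint3B (iU _ Lthe) (iU _ Lth)) -!patch_int0.
  by rewrite [X in X - _](_ : _ = 0)// [X in _ - X](_ : _ = 0)// subrr.
have [hE hI] := hC eps _ _ _ _ _ _ _ e01 mH (hc eps e01) dp w0 f0 nF.
have wE : (fun x => the x - th x) \_ U = w by exact: patch_sub.
have e30 : 0 < eps ^+ 3 by rewrite exprn_gt0.
have bound (s : R) : 0 <= s -> C * (2 * Mg * dur + s) <= C * q * (dur + s).
  by move=> s0; exact: affine_le (ltW C0) (mulr_ge0 (ler0n _ 2) Mg0) dur0 s0.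
have scale (s : R) : 0 <= s -> C * q * (dur + s) <= C * q * (L + 1) * (dur + s).
  move=> s0; apply: ler_wpM2r; first exact: addr_ge0.
  by rewrite ler_peMr ?lerDr// mulr_ge0 ?(ltW C0) ?(ltW q0).
have duEs (s : R) : ((C * q * (L + 1))%:E * (du + s%:E) = (C * q * (L + 1) * (dur + s))%:E)%E.
  by rewrite duE -EFinD -EFinM.
have es0 := ltW e0; have e3s0 := ltW e30.
rewrite !duEs; split.
- have [_ Lw LG _ _ ho hgr' _] := dp.
  apply: (@H1norm_le U _ G); rewrite ?wE//.
  + by move=> x /ho[].
  + by apply: mulr_ge0; [exact: mulr_ge0 (mulr_ge0 (ltW C0) (ltW q0)) (ltW L1)|exact: addr_ge0].
  apply: (le_trans hE); rewrite lerXn2r ?nnegrE//.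
  + by apply: mulr_ge0 (ltW C0) _; exact: addr_ge0.
  + by apply: mulr_ge0; [exact: mulr_ge0 (mulr_ge0 (ltW C0) (ltW q0)) (ltW L1)|exact: addr_ge0].
  exact: le_trans (bound _ e3s0) (scale _ e3s0).
- apply: Linf_le; first by apply: mulr_ge0; [exact: mulr_ge0 (mulr_ge0 (ltW C0) (ltW q0)) (ltW L1)|exact: addr_ge0].
  rewrite wE; move: hI; apply: filterS => x hx; apply: (le_trans hx).
  exact: le_trans (bound _ es0) (scale _ es0).
- apply: Linf_le; first by apply: mulr_ge0; [exact: mulr_ge0 (mulr_ge0 (ltW C0) (ltW q0)) (ltW L1)|exact: addr_ge0].
  move: hI; apply: filterS => x hx.
  have [Ux|nU] := pselect (U x); last first.
    rewrite patch_out// normr0.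
    by apply: mulr_ge0; [exact: mulr_ge0 (mulr_ge0 (ltW C0) (ltW q0)) (ltW L1)|exact: addr_ge0].
  rewrite patch_in//; apply: (le_trans (hL _ _)).
  have -> : the x - th x = w x by rewrite -wE patch_in.
  apply: (le_trans (ler_wpM2l L0 (le_trans hx (bound _ es0)))).
  rewrite [leRHS]mulrAC mulrC; apply: ler_wpM2l; last by rewrite lerDl.
  by apply: mulr_ge0; [exact: mulr_ge0 (ltW C0) (ltW q0)|exact: addr_ge0].
Qed.

End SliceBounds.

(** * From a fixed time to almost every time *)

Lemma Loo4_slices (R : realType) (T : R) (U : set (@R3 R)) (z : 'I_3 -> R -> @R3 R -> R) :
  (forall i, inLp4 +oo%E (cylinder T U) (z i)) ->
  exists2 M, 0 <= M & {ae @leb R, forall t, 0 < t < T ->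
    {ae leb3, forall x, U x -> forall i, `|z i t x| <= M}}.
Proof.
move=> hz.
have /choice[M hM] : forall i, exists M, 0 <= M /\
    {ae @leb R, forall t, 0 < t < T -> {ae leb3, forall x, U x -> `|z i t x| <= M}}.
  (* The bound is taken in space-time before slicing, so that one M serves almost every t. *)
  move=> i; have [M M0 h] := Lfun_oo_bound (hz i); exists M; split => //.
  apply: (@ae_slice R T U (fun t x => `|z i t x| <= M)).
  have FF : Filter (almost_everywhere (@leb4 R)) by exact: ae_filter_ringOfSetsType.
  by move: h; apply: filterS => y hy cy; move: hy; rewrite patchE mem_set.
exists (\sum_(i < 3) M i); first by apply: sumr_ge0 => i _; exact: (hM i).1.
have h := filter_forall leb_ae_filter (fun i => (hM i).2).
move: h; apply: filterS => t ht tT.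
have := filter_forall leb3_ae_filter (fun i => ht i tT).
apply: filterS => x hx Ux i; apply: (le_trans (hx i Ux)).
rewrite (bigD1 i)//= lerDl; apply: sumr_ge0 => j _; exact: (hM j).1.
Qed.

Theorem lemma4p3 (R : realType) (beta : R) (P : data R) (M0 : 'M[R]_3)
    (eps0 : R)
    (rho_e0 : R -> @R3 R -> R) (u_e0 : R -> 'I_3 -> @R3 R -> R)
    (rho_e : R -> R -> @R3 R -> R) (u_e : R -> R -> 'I_3 -> @R3 R -> R)
    (th_e : R -> R -> @R3 R -> R)
    (rho0 : @R3 R -> R) (u0 : 'I_3 -> @R3 R -> R)
    (rho : R -> @R3 R -> R) (u : R -> 'I_3 -> @R3 R -> R)
    (th p : R -> @R3 R -> R) :
  admissible beta P ->
  resistance_matrix (hole P) M0 ->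
  0 < eps0 ->
  (forall eps, 0 < eps < eps0 -> micro_initial P eps (rho_e0 eps) (u_e0 eps)) ->
  (forall eps, 0 < eps < eps0 ->
     finite_energy_weak_solution P eps (rho_e0 eps) (u_e0 eps)
       (rho_e eps) (u_e eps) (th_e eps)) ->
  regular_effective_solution P M0 rho0 u0 rho u th p ->
  exists C eps1 : R, [/\ 0 < C, 0 < eps1 <= eps0 &
    forall eps, 0 < eps < eps1 ->
      {ae @leb R, forall t, 0 < t < Tf P ->
        let du := L2norm (Omega P)
          (fun i x => (u_e eps t i \_ (Omega_ P eps)) x - u t i x) in
        [/\ (H1norm (Omega P) (fun x => (th_e eps t x - th t x)%R)
               <= C%:E * (du + (eps ^+ 3)%:E))%E,
            (Linfnorm (Omega P) (fun x => (th_e eps t x - th t x)%R)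
               <= C%:E * (du + eps%:E))%E &
            (Linfnorm (Omega P)
               (fun x => (visc P (th_e eps t x) - visc P (th t x))%R)
               <= C%:E * (du + eps%:E))%E]}].
Proof.
move=> adm _ e0 _ micro [Du [D2u [ut [Dut [D2ut [Gth [Hth es]]]]]]].
have [_ hG _ th2] := es_th es.
have [Mt Mt0 hMt] := Loo4_slices hG.
have [C C0 hC] := slice_estimate adm Mt0.
(* The volume bound for the holes asks for eps <= 1. [C] is already fixed here, before eps and t,
   from the data and [Mt]. *)
exists C, (Num.min eps0 1); split => //; first by rewrite lt_min e0 ltr01 ge_min lexx.
move=> eps /andP[eps_gt0]; rewrite lt_min => /andP[lt_eps0 eps_lt1].
have [|Due [Ge ws]] := micro eps; first by rewrite eps_gt0.
have [_ _ the1] := ws_th ws.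
have hue : {ae @leb R, forall t i, 0 < t < Tf P -> inLp 2%:E (Omega_ P eps) (u_e eps t i)}.
  apply: filter_forall => i; have [_ _ h] := ws_u_L2H1 ws i.
  by move: h; apply: filterS => t h tT; have [] := h tT.
have hu : {ae @leb R, forall t i, 0 < t < Tf P -> inLp +oo%E (Omega P) (u t i)}.
  apply: filter_forall => i; have [_ _ _ h] := es_u es i.
  by move: h; apply: filterS => t h tT; have [] := h tT.
have eqt := ae_slice (Q := fun t x => - (kf P * \sum_(i < 3) Hth t i i x) =
  dot (fun i => u t i x) (fun i => grav P i x)) (es_temperature es).
have FF := @leb_ae_filter R.
have hall := @filterI _ _ FF _ _
  (@filterI _ _ FF _ _ (@filterI _ _ FF _ _ the1 th2) (@filterI _ _ FF _ _ hue hu))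
  (@filterI _ _ FF _ _ (@filterI _ _ FF _ _ (ws_th_mean ws) (es_th_mean es))
    (@filterI _ _ FF _ _ (@filterI _ _ FF _ _ hMt (ws_temperature ws))
      (@filterI _ _ FF _ _ eqt (es_th_boundary es)))).
move: hall; apply: filterS => t hall tT.
have [[h12 h34] [h56 [h78 h910]]] := hall.
have [h1 h2] := h12; have [h3 h4] := h34; have [h5 h6] := h56.
have [h7 h8] := h78; have [h9 h10] := h910.
apply: (hC eps _ _ _ _ _ _ _ _ (h1 tT) (h2 tT) _ _ (h5 tT) (h6 tT) (h7 tT) (h8 tT) (h9 tT) (h10 tT)).
- by rewrite eps_gt0.
- by move=> i; exact: h3.
- by move=> i; exact: h4.
Qed.
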